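(* Let $u_0\in\mathbf{H}^1(\mathbb{R})$, let $\rho_0$ be such that $\bar\rho_0:=\rho_0-\rho_\infty\in\mathbf{L}^2(\mathbb{R})$ for some $\rho_\infty\ge0$, and let $\mu_0$ be a positive finite Radon measure on $\mathbb{R}$ whose absolutely continuous part is $\mu_{0,\rm ac}=\frac12(u_0^2+u_{0,x}^2+\bar\rho_0^2)\,dx$, while its singular part may be an atomic measure (the singular continuous part is zero). Let $X_0=(\zeta_0,U_0,H_0,\bar r_0)\in\mathbf{E}$ be the Lagrangian initial datum constructed from $(u_0,\rho_0,\mu_0)$ as in the context. Then one can construct a sequence of initial data for the semi-discrete scheme, $X_{0,n}=(\zeta_{0,n},U_{0,n},H_{0,n},\bar r_{0,n})\in\mathbf{E}_{\Delta\xi_n}$ with $\Delta\xi_n\to0$, such that each element of the sequence (together with its associated kernels) belongs to the set $\mathcal{B}$, and the sequence of interpolations of $X_{0,n}$ converges to $X_0$ in $\mathbf{E}$.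
   Context: Lagrangian initial datum. Given $(u_0,\rho_0,\mu_0)$, define $$y(\xi)=\sup\{x:\mu_0((-\infty,x))+x<\xi\},\quad U_0(\xi)=u_0(y(\xi)),\quad H_0(\xi)=\xi-y(\xi),\quad \bar r_0(\xi)=\bar\rho_0(y(\xi))\,y_\xi(\xi),\quad \zeta_0(\xi)=y(\xi)-\xi.$$ (The global conservative solution of the two-component Camassa--Holm system $u_t-u_{txx}+3uu_x-2u_xu_{xx}-uu_{xxx}+\rho\rho_x=0$, $\rho_t+(\rho u)_x=0$ is by definition obtained from an equivalent Lagrangian system with this initial datum.) Spaces: $\mathbf{V}=\{f\in\mathbf{C}_{\rm b}(\mathbb{R}):f_\xi\in\mathbf{L}^2(\mathbb{R})\}$, $\|f\|_{\mathbf{V}}=\|f\|_{\mathbf{L}^\infty}+\|f_\xi\|_{\mathbf{L}^2}$; $\mathbf{E}=\mathbf{V}\times\mathbf{H}^1\times\mathbf{V}\times\mathbf{L}^2$ with the sum norm. Grid and discrete norms. For $\Delta\xi>0$, $\xi_j=j\Delta\xi$, $\mathrm{D}_\pm v_j=\pm(v_{j\pm1}-v_j)/\Delta\xi$ ($\mathrm{D}_{j\pm}$ acts on index $j$). $\|v\|_{\boldsymbol{\ell}^p}=(\Delta\xi\sum_j|v_j|^p)^{1/p}$, $\|v\|_{\boldsymbol{\ell}^\infty}=\sup_j|v_j|$, $\|v\|_{\mathbf{h}^1}^2=\|v\|_{\boldsymbol{\ell}^2}^2+\|\mathrm{D}_+v\|_{\boldsymbol{\ell}^2}^2$, $\mathbf{V}_{\Delta\xi}=\{v\in\boldsymbol{\ell}^\infty:\mathrm{D}_+v\in\boldsymbol{\ell}^2\}$,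 $\mathbf{E}_{\Delta\xi}=\mathbf{V}_{\Delta\xi}\times\mathbf{h}^1\times\mathbf{V}_{\Delta\xi}\times\boldsymbol{\ell}^2$. For kernels $\|g\|_{\boldsymbol{\ell}^p}=\sup_i(\Delta\xi\sum_j|g_{i,j}|^p)^{1/p}$, $\|g\|_{\boldsymbol{\ell}^\infty}=\sup_{i,j}|g_{i,j}|$, $\boldsymbol{\ell}^*=\boldsymbol{\ell}^1\cap\boldsymbol{\ell}^\infty$. Set $\mathcal{B}$ (for a given $\Delta\xi$): all $(\zeta,U,H,\bar r,g,k,\gamma,\kappa)\in\mathbf{E}_{\Delta\xi}\times(\boldsymbol{\ell}^* )^4$ such that, with $y_j=\xi_j+\zeta_j$, (a) for all $i,j$: $(\mathrm{D}_+y_j)g_{i,j}-\mathrm{D}_{j-}\gamma_{i,j}=\delta_{i,j}/\Delta\xi$, $\ \mathrm{D}_{j+}g_{i,j}=(\mathrm{D}_+y_j)\gamma_{i,j}$, $\ (\mathrm{D}_+y_j)k_{i,j}-\mathrm{D}_{j+}\kappa_{i,j}=\delta_{i,j}/\Delta\xi$, $\ \mathrm{D}_{j-}k_{i,j}=(\mathrm{D}_+y_j)\kappa_{i,j}$, and $g_{j,i}=g_{i,j}$, $k_{j,i}=k_{i,j}$, $\gamma_{j,i}=-\kappa_{i,j}$; (b) $\mathrm{D}_+y,\mathrm{D}_+U,\mathrm{D}_+H,\bar r\in\boldsymbol{\ell}^\infty$; (c) $2(\mathrm{D}_+y_j)(\mathrm{D}_+H_j)=U_j^2(\mathrm{D}_+y_j)^2+(\mathrm{D}_+U_j)^2+\bar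 r_j^2$ for all $j$; (d) $\mathrm{D}_+y_j\ge0$, $\mathrm{D}_+H_j\ge0$, $\mathrm{D}_+y_j+\mathrm{D}_+H_j>0$ for all $j$. The kernels associated with $(\zeta,U,H,\bar r)$ are the ones in $\boldsymbol{\ell}^*$ determined by (a). Interpolation. With $\chi_j$ the indicator function of $[\xi_j,\xi_{j+1})$, for $V\in\{\zeta,U,H\}$ set $V_\Delta(\xi)=\sum_j[V_j+(\xi-\xi_j)\mathrm{D}_+V_j]\chi_j(\xi)$, and $\bar r_\Delta(\xi)=\sum_j\bar r_j\chi_j(\xi)$. The interpolation of $(\zeta,U,H,\bar r)$ is $(\zeta_\Delta,U_\Delta,H_\Delta,\bar r_\Delta)$. *)

(* Defs.v *)
From HB Require Import structures.
From mathcomp Require Import all_boot all_order all_algebra.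
From mathcomp Require Import all_classical all_reals all_analysis.
Import Order.TTheory GRing.Theory Num.Theory.
Import numFieldNormedType.Exports.

Set Implicit Arguments.
Unset Strict Implicit.
Unset Printing Implicit Defensive.

Local Open Scope classical_set_scope.
Local Open Scope ring_scope.

(* Quadruples (zeta, U, H, rbar), indexed by R (Lagrangian data) or by int
   (grid data). *)
Record quadruple (I R : Type) := Quadruple {
  q_zeta : I -> R;
  q_U : I -> R;
  q_H : I -> R;
  q_r : I -> R }.

Definition quad_sub {I : Type} {R : realType} (X Y : quadruple I R) :
    quadruple I R :=
  Quadruple (fun i => q_zeta X i - q_zeta Y i) (fun i => q_U X i - q_U Y i)
            (fun i => q_H X i - q_H Y i) (fun i => q_r X i - q_r Y i).

Section function_spaces.
Context {R : realType}.
Implicit Types f g u phi : R -> R.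
Local Notation leb := (@lebesgue_measure R).

Definition L2norm f : \bar R := 'N[leb]_(2%:E) [EFin \o f].

Definition Linfnorm f : \bar R := 'N[leb]_(+oo%E) [EFin \o f].

(* An element of L2 is represented by a Borel function. *)
Definition inL2 f : Prop := f \in Lfun leb 2%:E.

Definition test_function phi : Prop :=
  [/\ forall x, derivable phi x 1, continuous (derive1 phi) &
      compact (closure [set x | phi x != 0])].

(* Weak derivatives in one dimension are defined with C^1 test functions of
   compact support, as in Brezis, "Functional Analysis, Sobolev Spaces and
   Partial Differential Equations", Section 8.2. *)
Definition weak_derivative f g : Prop :=
  [/\ locally_integrable setT f, locally_integrable setT g &
      forall phi, test_function phi ->
        \int[leb]_x (f x * derive1 phi x) = - \int[leb]_x (g x * phi x)].

Definition weakly_derivable f : Prop := exists g, weak_derivative f g.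

(* A choice of representative of the weak derivative, which is unique up to
   null sets; it is meaningful only if [weakly_derivable f]. *)
Definition wderiv f : R -> R := xget (cst 0) [set g | weak_derivative f g].

Definition inH1 u : Prop := [/\ inL2 u, weakly_derivable u & inL2 (wderiv u)].

Definition H1norm u : \bar R :=
  ((L2norm u `^ 2 + L2norm (wderiv u) `^ 2) `^ 2^-1)%E.

Definition inV f : Prop :=
  [/\ continuous f, bounded_fun f, weakly_derivable f & inL2 (wderiv f)].

Definition Vnorm f : \bar R := (Linfnorm f + L2norm (wderiv f))%E.

Definition inE (X : quadruple R R) : Prop :=
  [/\ inV (q_zeta X), inH1 (q_U X), inV (q_H X) & inL2 (q_r X)].

Definition Enorm (X : quadruple R R) : \bar R :=
  (Vnorm (q_zeta X) + H1norm (q_U X) + Vnorm (q_H X) + L2norm (q_r X))%E.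

Definition cvg_in_E (X : nat -> quadruple R R) (X0 : quadruple R R) : Prop :=
  [/\ forall n, inE (X n), inE X0 &
      Enorm (quad_sub (X n) X0) @[n --> \oo] --> 0%E].

End function_spaces.

Section lagrangian_initial_datum.
Context {R : realType}.
Implicit Types (u rho_bar : R -> R).

(* [mu = f dx + nu] is the Lebesgue decomposition of [mu] with absolutely
   continuous part [f dx] and singular part [nu]. *)
Definition lebesgue_decomposition
    (mu : set (measurableTypeR R) -> \bar R) (f : R -> R)
    (nu : set (measurableTypeR R) -> \bar R) : Prop :=
  (forall A : set (measurableTypeR R), measurable A ->
     mu A = (\int[lebesgue_measure]_(x in A) (f x)%:E + nu A)%E) /\
  exists N : set (measurableTypeR R),
    [/\ measurable N, lebesgue_measure N = 0%E & nu (~` N) = 0%E].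

Definition atomic (nu : set (measurableTypeR R) -> \bar R) : Prop :=
  exists2 A : set (measurableTypeR R), countable A & nu (~` A) = 0%E.

Definition energy_density u rho_bar : R -> R :=
  fun x => 2^-1 * (u x ^+ 2 + wderiv u x ^+ 2 + rho_bar x ^+ 2).

Definition lagr_y (mu : set (measurableTypeR R) -> \bar R) : R -> R :=
  fun xi => sup [set x : R | fine (mu [set` `]-oo, x[]) + x < xi].

(* [u] has to be the continuous representative of its class in H1, since it is
   evaluated pointwise. *)
Definition lagrangian_datum u rho_bar
    (mu : set (measurableTypeR R) -> \bar R) : quadruple R R :=
  let y := lagr_y mu in
  Quadruple (fun xi => y xi - xi) (fun xi => u (y xi)) (fun xi => xi - y xi)
            (fun xi => rho_bar (y xi) * wderiv y xi).

End lagrangian_initial_datum.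

Section grid.
Context {R : realType}.
Variable dxi : R.
Implicit Types (v : int -> R) (g : int -> int -> R).

Definition gridpt (j : int) : R := j%:~R * dxi.

Definition Dplus v (j : int) : R := (v (j + 1) - v j) / dxi.

Definition Dminus v (j : int) : R := (v j - v (j - 1)) / dxi.

Definition ellnorm (p : R) v : \bar R :=
  ((dxi%:E * \esum_(j in [set: int]) (`|v j| `^ p)%:E) `^ p^-1)%E.

Definition ellinfnorm v : \bar R := ereal_sup (range (fun j => `|v j|%:E)).

Definition h1norm v : \bar R :=
  ((ellnorm 2 v `^ 2 + ellnorm 2 (Dplus v) `^ 2) `^ 2^-1)%E.

Definition in_ell (p : R) v : Prop := (ellnorm p v < +oo)%E.

Definition in_ellinf v : Prop := (ellinfnorm v < +oo)%E.

Definition in_h1 v : Prop := (h1norm v < +oo)%E.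

Definition in_Vgrid v : Prop := in_ellinf v /\ in_ell 2 (Dplus v).

Definition in_Egrid (X : quadruple int R) : Prop :=
  [/\ in_Vgrid (q_zeta X), in_h1 (q_U X), in_Vgrid (q_H X) & in_ell 2 (q_r X)].

Definition kernel_ellnorm (p : R) g : \bar R :=
  ereal_sup (range (fun i => ellnorm p (g i))).

Definition kernel_ellinfnorm g : \bar R :=
  ereal_sup (range (fun i => ellinfnorm (g i))).

Definition in_ellstar g : Prop :=
  (kernel_ellnorm 1 g < +oo)%E /\ (kernel_ellinfnorm g < +oo)%E.

Definition grid_y (X : quadruple int R) (j : int) : R := gridpt j + q_zeta X j.

Definition kernel_equations (X : quadruple int R)
    (g k gamma kappa : int -> int -> R) : Prop :=
  let y := grid_y X in
  forall i j : int,
    [/\ Dplus y j * g i j - Dminus (gamma i) j = (i == j)%:R / dxi,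
        Dplus (g i) j = Dplus y j * gamma i j,
        Dplus y j * k i j - Dplus (kappa i) j = (i == j)%:R / dxi &
        Dminus (k i) j = Dplus y j * kappa i j] /\
    [/\ g j i = g i j, k j i = k i j & gamma j i = - kappa i j].

Definition associated_kernels (X : quadruple int R)
    (g k gamma kappa : int -> int -> R) : Prop :=
  [/\ in_ellstar g, in_ellstar k, in_ellstar gamma & in_ellstar kappa] /\
  kernel_equations X g k gamma kappa.

Definition in_B (X : quadruple int R) (g k gamma kappa : int -> int -> R) :
    Prop :=
  let y := grid_y X in
  let U := q_U X in let H := q_H X in let r := q_r X in
  [/\ in_Egrid X,
      associated_kernels X g k gamma kappa,
      [/\ in_ellinf (Dplus y), in_ellinf (Dplus U), in_ellinf (Dplus H)
        & in_ellinf r],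
      forall j, 2 * Dplus y j * Dplus H j =
        U j ^+ 2 * Dplus y j ^+ 2 + Dplus U j ^+ 2 + r j ^+ 2 &
      forall j, [/\ 0 <= Dplus y j, 0 <= Dplus H j
                  & 0 < Dplus y j + Dplus H j]].

Definition grid_cell (j : int) : set R := `[gridpt j, gridpt (j + 1)[.

(* At each point the two sums have at most one nonzero term. *)
Definition interp_linear v : R -> R := fun xi =>
  \sum_(j \in [set: int])
    (v j + (xi - gridpt j) * Dplus v j) * \1_(grid_cell j) xi.

Definition interp_const v : R -> R := fun xi =>
  \sum_(j \in [set: int]) v j * \1_(grid_cell j) xi.

Definition interpolation (X : quadruple int R) : quadruple R R :=
  Quadruple (interp_linear (q_zeta X)) (interp_linear (q_U X))
            (interp_linear (q_H X)) (interp_const (q_r X)).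

End grid.

(* Main.v *)
(* In Lagrangian coordinates the datum is described by p = y', q = U', 1 - p = H'
   and r = rbar, which are bounded and satisfy, for almost every label,
     2 p (1 - p) = U^2 p^2 + q^2 + r^2;
   the atoms of the singular part of mu_0 only produce intervals with p = 0. With
   s = H' - U^2 p / 2 the relation reads 2 p s = q^2 + r^2, i.e. (p, s, q, r) lies
   on a cone that is parametrized by q, r and one more scalar b, with Lipschitz
   dependence along the datum. Cell averages of q, r and b (cut off to a compact set,
   where U is closed up affinely to 0) converge in L^2, L^2 and L^1; feeding them
   into the parametrization, together with the grid function U itself, gives discrete
   D+y and D+H that satisfy the identity (c) exactly and converge. Since D+y = 1
   outside a finite set of cells, the kernels are a discrete Green function built
   from two positive solutions of the homogeneous equation that decay at -oo and +oo
   respectively. *)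

Require Import Defs.
From HB Require Import structures.
From mathcomp Require Import all_boot all_order all_algebra.
From mathcomp Require Import all_classical all_reals all_analysis.
From mathcomp Require Import measurable_realfun ess_sup_inf.
From mathcomp Require Import zify ring lra.
Import Order.TTheory GRing.Theory Num.Theory.
Import numFieldNormedType.Exports.
Local Open Scope classical_set_scope.
Local Open Scope ring_scope.
Set Implicit Arguments.
Unset Strict Implicit.
Unset Printing Implicit Defensive.

(** * Primitives and weak derivatives *)

(** Condition (c) is a nonlinear pointwise identity, so cell averages do not inherit it, and solving
    it for D+H would divide by D+y, which degenerates where p = 0. The cone treats p and s
    symmetrically, and the datum stays away from its vertex: p + H' = 1 and |U| <= K give p + s >=
    2/(K^2 + 2). Hence the square root in the parametrization is Lipschitz along the datum, although
    the averaged parameters may themselves hit the vertex. The third parameter b = (H' + s)/2 lies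
    between 0 and H', so it is integrable; and (b, q, r) = (0, 0, 0) is sent to D+y = 1, s = 0, so
    the cutoff leaves the trivial state outside finitely many cells. U is sampled rather than
    averaged, because D+U is then exactly a cell average of the slope. L^1 closeness of the slopes
    of zeta and H controls the sup norms of their primitives, anchored at label 0; L^2 closeness
    controls the derivative part of the norm. *)

Section primitives.
Context {R : realType}.
Local Notation leb := (@lebesgue_measure R).
Implicit Types f g : R -> R.

Definition locint f :=
  measurable_fun setT f /\ forall a b : R, leb.-integrable `[a, b] (EFin \o f).

(** Absolute continuity in integral form. Such a pair is the working substitute for a function with
    its derivative: it survives composition with the label map and is linked to weak derivatives in
    both directions. *)
Definition primitive f g :=
  forall a b : R, a <= b -> f b - f a = \int[leb]_(x in `[a, b]) g x.

Lemma lebesgue_itvcc_lty (a b : R) : (leb `[a, b]%classic < +oo)%E.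
Proof. by rewrite lebesgue_measure_itv/= lte_fin; case: ifP; rewrite ltry. Qed.

Lemma locint_bounded g (C : R) : measurable_fun setT g ->
  (forall x, `|g x| <= C) -> locint g.
Proof.
move=> mg gC; split=> // a b; apply: measurable_bounded_integrable => //.
- exact: lebesgue_itvcc_lty.
- exact: measurable_funTS.
- by exists C; split; [exact: num_real | move=> M CM x _ /=; apply: le_trans (gC x) (ltW CM)].
Qed.

Lemma Rintegral_itvcc_cst (a b c : R) : a <= b ->
  \int[leb]_(x in `[a, b]) c = c * (b - a).
Proof.
move=> ab; rewrite Rintegral_cst//; have := lebesgue_measure_itv `[a, b] => /= ->; rewrite lte_fin.
by case: ltgtP ab => //= -> _; rewrite subrr !mulr0.
Qed.

Lemma Rintegral_itvcc_split g (a b c : R) : locint g -> a <= b -> b <= c ->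
  \int[leb]_(x in `[a, c]) g x =
  \int[leb]_(x in `[a, b]) g x + \int[leb]_(x in `[b, c]) g x.
Proof.
move=> [mg ig] ab bc.
rewrite -(@Rintegral_itv_obnd_cbnd _ b); last first.
  by apply: integrableS (ig b c) => //; apply: subset_itvr; rewrite bnd_simp.
rewrite -(Rintegral_itvB (ig a c))//; first by rewrite addrC subrK.
Qed.

Lemma le_Rintegral_itvcc f g (a b : R) : locint f -> locint g ->
  (forall x, a <= x <= b -> f x <= g x) ->
  \int[leb]_(x in `[a, b]) f x <= \int[leb]_(x in `[a, b]) g x.
Proof.
by move=> [_ fi] [_ gi] fg; apply: le_Rintegral => // x; rewrite in_itv; exact: fg.
Qed.

Lemma normr_Rintegral_itvcc_le g (a b C : R) : locint g -> a <= b ->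
  (forall x, a <= x <= b -> `|g x| <= C) ->
  `|\int[leb]_(x in `[a, b]) g x| <= C * (b - a).
Proof.
move=> [mg ig] ab gC; apply: (le_trans (le_normr_Rintegral _ (ig a b))) => //.
rewrite -Rintegral_itvcc_cst//; apply: le_Rintegral => //.
- by move: (ig a b) => /integrable_norm.
- by case: (@locint_bounded (cst C) `|C|) => //.
Qed.

Lemma locintD f g : locint f -> locint g -> locint (fun x => f x + g x).
Proof.
move=> [mf fi] [mg gi]; split; first exact: measurable_funD.
move=> a b; exact: (integrableD _ (fi a b) (gi a b)).
Qed.

Lemma locintN f : locint f -> locint (fun x => - f x).
Proof.
move=> [mf fi]; split; first exact: measurableT_comp.
by move=> a b; exact: (integrableN (fi a b)).
Qed.

Lemma RintegralD_itvcc f g (a b : R) : locint f -> locint g ->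
  \int[leb]_(x in `[a, b]) (f x + g x) =
  \int[leb]_(x in `[a, b]) f x + \int[leb]_(x in `[a, b]) g x.
Proof. by move=> [mf fi] [mg gi]; rewrite RintegralD. Qed.

Lemma primitive_lip f g (C : R) : locint g -> primitive f g ->
  (forall x, `|g x| <= C) -> forall x y, `|f x - f y| <= C * `|x - y|.
Proof.
move=> ig fg gC x y; wlog xy : x y / y <= x => [H|].
  have [|/ltW] := leP y x; first exact: H.
  by rewrite distrC (distrC x); exact: H.
rewrite (ger0_norm (_ : 0 <= x - y)) ?subr_ge0// fg//.
by apply: normr_Rintegral_itvcc_le.
Qed.

Lemma lip_continuous f (C : R) :
  (forall x y, `|f x - f y| <= C * `|x - y|) -> continuous f.
Proof.
move=> fC x; apply/cvgrPdist_le => e e0 /=.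
have C0 : 0 < `|C| + 1 by rewrite ltr_pwDr.
near=> y; apply: (le_trans (fC x y)).
apply: (@le_trans _ _ ((`|C| + 1) * `|x - y|)).
  by rewrite ler_wpM2r// (le_trans (ler_norm _))// lerDl.
rewrite -ler_pdivlMl//; near: y; apply: cvgr_dist_le; first exact: cvg_id.
by rewrite mulr_gt0// invr_gt0.
Unshelve. all: by end_near. Qed.

Lemma continuous_locint f : continuous f -> locint f.
Proof.
move=> fc; split; first exact: continuous_measurable_fun.
move=> a b; apply: continuous_compact_integrable; first exact: segment_compact.
exact: continuous_subspaceT.
Qed.

(* [D] is an additive interval function that is quadratically small, hence zero. *)
Lemma additive_quadratic_eq0 (D : R -> R -> R) (K : R) :
  (forall a b c, a <= b -> b <= c -> D a c = D a b + D b c) ->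
  (forall a b, a <= b -> `|D a b| <= K * (b - a) ^+ 2) ->
  forall a b, a <= b -> D a b = 0.
Proof.
move=> Dadd DK.
(* Each bisection halves the bound: two halves contribute 2 (1/2)^2 = 1/2 of it. *)
have H n : forall a b, a <= b -> `|D a b| <= K * (b - a) ^+ 2 / 2 ^+ n.
  elim: n => [|n IH] a b ab; first by rewrite expr0 divr1 DK.
  have am : a <= (a + b) / 2 by lra.
  have mb : (a + b) / 2 <= b by lra.
  rewrite (Dadd _ _ _ am mb); apply: (le_trans (ler_normD _ _)).
  apply: (le_trans (lerD (IH _ _ am) (IH _ _ mb))).
  rewrite [2 ^+ n.+1]exprS; have n0 : (2 : R) ^+ n != 0 by rewrite expf_neq0.
  by rewrite le_eqVlt; apply/orP; left; apply/eqP; field.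
move=> a b ab; apply/eqP; rewrite -normr_le0; apply/ler_addgt0Pl => e e0.
rewrite addr0; set M := K * (b - a) ^+ 2.
have : `|M| / 2 ^+ n @[n --> \oo] --> (0 : R).
  rewrite -(mulr0 `|M|); apply: cvgM; first exact: cvg_cst.
  under eq_fun do rewrite -exprVn.
  by apply: cvg_expr; rewrite ger0_norm; lra.
move=> /cvgrPdist_le/(_ _ e0)[n _ /(_ n (leqnn _))]; rewrite sub0r normrN => Hn.
apply: (le_trans (H n _ _ ab)); apply: le_trans Hn.
by rewrite -/M (le_trans (ler_norm _))// !normrM !normr_id.
Qed.

Lemma locint_mulbc f g (C : R) : measurable_fun setT g -> (forall x, `|g x| <= C) ->
  continuous f -> locint (fun x => f x * g x).
Proof.
move=> mg gC fc; have mf : measurable_fun setT f by exact: continuous_measurable_fun.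
split; first exact: measurable_funM.
move=> a b; apply: measurable_bounded_integrable => //.
- exact: lebesgue_itvcc_lty.
- by apply: measurable_funTS; exact: measurable_funM.
have [M [Mr MP]] : bounded_set (f @` `[a, b]).
  apply: compact_bounded; apply: continuous_compact; last exact: segment_compact.
  exact: continuous_subspaceT.
exists ((`|M| + 1) * C); split; first exact: num_real.
move=> M' MM' x abx /=; apply: le_trans (ltW MM'); rewrite normrM.
apply: ler_pM => //; apply: MP; last by exists x.
by rewrite (le_lt_trans (ler_norm _))// ltrDl.
Qed.

(** The defect of the formula on [a, b] is additive in the interval. Both factors are C-Lipschitz,
    so the defect is at most 2 C^2 (b - a)^2 and must vanish. *)
Lemma integration_by_parts_primitive (f g u v : R -> R) (C : R) :
  measurable_fun setT g -> (forall x, `|g x| <= C) -> primitive f g ->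
  measurable_fun setT v -> (forall x, `|v x| <= C) -> primitive u v ->
  primitive (fun x => f x * u x) (fun x => f x * v x + u x * g x).
Proof.
move=> mg gC fg mv vC uv.
have C0 : 0 <= C by rewrite (le_trans _ (gC 0)).
have ig := locint_bounded mg gC; have iv := locint_bounded mv vC.
have fl := primitive_lip ig fg gC; have ul := primitive_lip iv uv vC.
have fc := lip_continuous fl; have uc := lip_continuous ul.
have ifv := locint_mulbc mv vC fc; have iug := locint_mulbc mg gC uc.
set F := (fun x => f x * v x + u x * g x).
have iF : locint F by exact: locintD.
pose D a b := f b * u b - f a * u a - \int[leb]_(x in `[a, b]) F x.
move=> a b ab; apply/eqP; rewrite -subr_eq0 -/(D a b); apply/eqP.
apply: (@additive_quadratic_eq0 D (2 * C ^+ 2)) ab.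
  move=> {}a {}b c ab bc; rewrite /D (Rintegral_itvcc_split iF ab bc); ring.
move=> {}a {}b ab.
have i1 (w h : R -> R) (c : R) : continuous w -> measurable_fun setT h ->
    (forall x, `|h x| <= C) -> locint (fun x => (w x - c) * h x).
  move=> wc mh hC; apply: (locint_mulbc (C := C)) => // x.
  by apply: cvgB; [exact: wc|exact: cvg_cst].
have i2 (h : R -> R) (c : R) : measurable_fun setT h ->
    (forall x, `|h x| <= C) -> locint (fun x => c * h x).
  by move=> mh hC; apply: (locint_mulbc (C := C)) => //; apply: cst_continuous.
(* Freezing f at b and u at a is exact: f b u b - f a u a = f b (u b - u a) + u a (f b - f a). Only
   the small oscillations remain under the integral. *)
have E : D a b = - \int[leb]_(x in `[a, b]) ((f x - f b) * v x + (u x - u a) * g x).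
  rewrite /D.
  have -> : \int[leb]_(x in `[a, b]) F x =
     \int[leb]_(x in `[a, b]) (((f x - f b) * v x + (u x - u a) * g x) + (f b * v x + u a * g x)).
    by apply: eq_Rintegral => x _; rewrite /F; ring.
  rewrite (RintegralD_itvcc (f := fun x => (f x - f b) * v x + (u x - u a) * g x)); last 2 first.
    by apply: locintD; exact: i1.
    by apply: locintD; exact: i2.
  rewrite (RintegralD_itvcc (f := fun x => f b * v x) _ _ (i2 v (f b) mv vC) (i2 g (u a) mg gC)).
  rewrite !RintegralZl//; last 2 first.
    by case: ig.
    by case: iv.
  by rewrite -(uv _ _ ab) -(fg _ _ ab); ring.
rewrite E normrN.
apply: (@le_trans _ _ ((2 * C ^+ 2 * (b - a)) * (b - a))); last by rewrite -mulrA -expr2.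
apply: normr_Rintegral_itvcc_le => //.
  by apply: locintD; exact: i1.
move=> x /andP[ax xb]; apply: (le_trans (ler_normD _ _)); rewrite !normrM.
have l1 : `|f x - f b| <= C * (b - a).
  by apply: (le_trans (fl _ _)); rewrite ler_wpM2l// distrC ger0_norm; lra.
have l2 : `|u x - u a| <= C * (b - a).
  by apply: (le_trans (ul _ _)); rewrite ler_wpM2l// ger0_norm; lra.
have := ler_pM (normr_ge0 _) (normr_ge0 _) l1 (vC x).
have := ler_pM (normr_ge0 _) (normr_ge0 _) l2 (gC x).
move=> h1 h2; apply: (le_trans (lerD h2 h1)); rewrite le_eqVlt; apply/orP; left.
by apply/eqP; ring.
Qed.

End primitives.

Section weak_derivatives.
Context {R : realType}.
Local Notation leb := (@lebesgue_measure R).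
Implicit Types f g u phi : R -> R.

Lemma RintegralT_supp (D : set R) (h : R -> R) :
  (forall x, ~ D x -> h x = 0) -> \int[leb]_x h x = \int[leb]_(x in D) h x.
Proof.
move=> hD; rewrite [RHS]Rintegral_mkcond; apply: eq_Rintegral => x _.
rewrite patchE; case: ifPn => // /negP xD; apply/hD => Dx; apply: xD.
exact: mem_set.
Qed.

Lemma test_function_continuous phi : test_function phi -> continuous phi.
Proof.
by move=> [phid _ _] x; apply: differentiable_continuous; apply/derivable1_diffP.
Qed.

Lemma test_function_primitive phi : test_function phi ->
  primitive phi (derive1 phi).
Proof.
move=> tphi; have [phid phic _] := tphi => a b; rewrite le_eqVlt => /orP[/eqP <-|ab].
  by rewrite subrr set_itv1 Rintegral_set1.
have phiC := test_function_continuous tphi.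
have E : (\int[leb]_(x in `[a, b]) (derive1 phi x)%:E = (phi b)%:E - (phi a)%:E)%E.
  apply: continuous_FTC2 ab _ _ _.
  - exact: continuous_subspaceT.
  - split; first by move=> x _; exact: phid.
      by apply: cvg_at_right_filter; exact: phiC.
    by apply: cvg_at_left_filter; exact: phiC.
  - by [].
by rewrite /Rintegral E.
Qed.

Lemma test_function_support phi : test_function phi ->
  exists2 M : R, 0 < M &
    forall x, M <= `|x| -> phi x = 0 /\ derive1 phi x = 0.
Proof.
move=> [_ _ /compact_bounded[M [Mr MP]]].
have supp x : `|M| + 1 < `|x| -> phi x = 0.
  move=> Mx; apply: contrapT => /eqP px.
  suff : `|x| <= `|M| + 1 by rewrite leNgt Mx.
  apply: (MP (`|M| + 1)); first by rewrite (le_lt_trans (ler_norm _))// ltr_pwDr.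
  exact: (@subset_closure R [set x | phi x != 0] x px).
(* phi vanishes on the open set |M| + 1 < |x|, hence so does its derivative; the extra unit turns
   the strict bound into a non-strict one. *)
exists (`|M| + 2); first by rewrite ltr_wpDl.
move=> x Mx; have Mx' : `|M| + 1 < `|x| by lra.
split; first exact: supp.
rewrite derive1E (@near_eq_derive _ _ _ phi (cst 0) x 1); first by rewrite derive_cst.
near=> y; apply: supp; near: y; apply: (cvgr_gt `|x|) => //.
exact: cvg_norm.
Unshelve. all: by end_near. Qed.

Lemma locint_locally_integrable h : locint h -> @locally_integrable R setT h.
Proof.
move=> [mh ih]; split => // [|K _ cK]; first exact: openT.
have [M [Mr MP]] := compact_bounded cK.
have /integrableP[_] := ih (- (`|M| + 1)) (`|M| + 1).
apply: le_lt_trans; apply: ge0_subset_integral => //=.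
- exact: compact_measurable.
- by apply/measurable_EFinP; apply: measurableT_comp => //; exact: measurable_funTS.
- move=> x Kx /=; rewrite in_itv/= -ler_norml; apply: MP => //.
  by rewrite (le_lt_trans (ler_norm _))// ltr_pwDr.
Qed.

(** Integration by parts on a segment [-M, M] outside which phi and its derivative vanish; the
    boundary terms are zero. *)
Lemma primitive_weak_derivative f g (C : R) :
  measurable_fun setT g -> (forall x, `|g x| <= C) -> primitive f g ->
  weak_derivative f g.
Proof.
move=> mg gC fg; have ig := locint_bounded mg gC.
have fc : continuous f by exact: lip_continuous (primitive_lip ig fg gC).
split; [exact/locint_locally_integrable/continuous_locint | exact: locint_locally_integrable | move=> phi tphi].
have [M M0 MP] := test_function_support tphi.
have pc := test_function_continuous tphi; have [_ dpc _] := tphi.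
have out x : ~ `[- M, M]%classic x -> M <= `|x|.
  by rewrite /= in_itv/= -ler_norml => /negP; rewrite -ltNge => /ltW.
rewrite (RintegralT_supp (D := `[- M, M])); last first.
  by move=> x /out /MP[_ ->]; rewrite mulr0.
rewrite (RintegralT_supp (D := `[- M, M])); last first.
  by move=> x /out /MP[-> _]; rewrite mulr0.
have [K KP] : exists K, forall x, `|derive1 phi x| <= K.
  have [K [Kr KP]] : bounded_set (derive1 phi @` `[- M, M]).
    apply: compact_bounded; apply: continuous_compact; last exact: segment_compact.
    exact: continuous_subspaceT.
  exists (`|K| + 1) => x; have [Mx|Mx] := leP M `|x|.
    by have [_ ->] := MP _ Mx; rewrite normr0 addr_ge0.
  apply: KP; first by rewrite (le_lt_trans (ler_norm _))// ltr_pwDr.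
  by exists x => //=; rewrite in_itv/= -ler_norml ltW.
have mdp : measurable_fun setT (derive1 phi) by exact: continuous_measurable_fun.
(* Integration by parts asks for a single constant bounding both slopes. *)
have KP' x : `|derive1 phi x| <= `|C| + `|K|.
  by rewrite (le_trans (KP x))// (le_trans (ler_norm _))// lerDr.
have gC' x : `|g x| <= `|C| + `|K|.
  by rewrite (le_trans (gC x))// (le_trans (ler_norm _))// lerDl.
have := integration_by_parts_primitive mg gC' fg mdp KP' (test_function_primitive tphi).
move=> /(_ (- M) M); rewrite ge0_cp ?ltW// => /(_ isT).
have [-> _] : phi M = 0 /\ derive1 phi M = 0 by apply: MP; rewrite ger0_norm// ltW.
have [-> _] : phi (- M) = 0 /\ derive1 phi (- M) = 0.
  by apply: MP; rewrite normrN ger0_norm// ltW.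
rewrite !mulr0 subrr RintegralD_itvcc; last 2 first.
  exact: locint_mulbc mdp KP fc.
  exact: locint_mulbc mg gC pc.
move=> /esym/eqP; rewrite addr_eq0 => /eqP ->; congr (- _).
by apply: eq_Rintegral => x _; rewrite mulrC.
Qed.
End weak_derivatives.

(** * Cell averages and Lebesgue differentiation *)

Section grid_averages.
Context {R : realType}.
Local Notation leb := (@lebesgue_measure R).
Implicit Types f g : R -> R.

Lemma leb_ae_mono (P Q : R -> Prop) : (forall x, P x -> Q x) ->
  {ae leb, forall x, P x} -> {ae leb, forall x, Q x}.
Proof.
move=> PQ; apply: filterS; [exact: (ae_filter_ringOfSetsType leb) | exact: PQ].
Qed.

Lemma leb_ae_and (P Q : R -> Prop) :
  {ae leb, forall x, P x} -> {ae leb, forall x, Q x} ->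
  {ae leb, forall x, P x /\ Q x}.
Proof.
by apply: filterS2 => //; exact: (ae_filter_ringOfSetsType leb).
Qed.

Lemma locally_integrable_locint g : locally_integrable setT g -> locint g.
Proof.
move=> [mg _ ig]; split => // a b; apply/integrableP; split.
  by apply/measurable_EFinP; exact: measurable_funTS.
by apply: ig => //; exact: segment_compact.
Qed.

Definition cellno (h x : R) : int := Num.floor (x / h).

Lemma cellnoP (h x : R) : 0 < h ->
  gridpt h (cellno h x) <= x < gridpt h (cellno h x + 1).
Proof.
move=> h0; rewrite /gridpt -ler_pdivlMr// -ltr_pdivrMr//.
exact: floor_itv.
Qed.

Lemma gridptS (h : R) j : gridpt h (j + 1) = gridpt h j + h.
Proof. by rewrite /gridpt intrD mulrDl mul1r. Qed.

Lemma cellno_eq (h x : R) j : 0 < h ->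
  gridpt h j <= x -> x < gridpt h (j + 1) -> cellno h x = j.
Proof.
move=> h0; rewrite /gridpt -ler_pdivlMr// -ltr_pdivrMr// => h1 h2.
by apply/eqP; rewrite /cellno floor_eq h1 h2.
Qed.

Lemma grid_cellE (h : R) j : grid_cell h j = `[gridpt h j, gridpt h j + h[%classic.
Proof. by rewrite /grid_cell gridptS. Qed.

Lemma lebesgue_grid_cell (h : R) j : 0 < h -> leb (grid_cell h j) = h%:E.
Proof.
move=> h0; rewrite grid_cellE; have -> := (@lebesgue_measure_itv R (Interval (BLeft (gridpt h j)) (BLeft (gridpt h j + h)))).
by rewrite /= lte_fin ltrDl h0 -EFinB addrAC subrr add0r.
Qed.

Definition cell_avg (g : R -> R) (h : R) (j : int) : R :=
  h^-1 * \int[leb]_(x in grid_cell h j) g x.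

Lemma cell_avg_itvcc g h j : locint g ->
  cell_avg g h j = h^-1 * \int[leb]_(x in `[gridpt h j, gridpt h j + h]) g x.
Proof.
move=> [mg ig]; rewrite /cell_avg grid_cellE Rintegral_itv_bndo_bndc//.
apply: integrableS (ig (gridpt h j) (gridpt h j + h)) => //.
by apply: subset_itvl; rewrite bnd_simp.
Qed.

(** The cell containing x is not centred at x, so Lebesgue differentiation is used along nicely
    shrinking sets. *)
Lemma ae_cvg_cell_avg g : locint g ->
  {ae leb, forall x, cell_avg g n.+1%:R^-1 (cellno n.+1%:R^-1 x) @[n --> \oo] --> g x}.
Proof.
move=> ig; have lg := locint_locally_integrable ig.
pose E (x : R) (n : nat) : set R := grid_cell n.+1%:R^-1 (cellno n.+1%:R^-1 x).
have h0 n : 0 < n.+1%:R^-1 :> R by rewrite invr_gt0.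
have nE x : nicely_shrinking x (E x).
  split; first by move=> n; rewrite /E grid_cellE.
  have r0 n : 0 < 2 * n.+1%:R^-1 :> R by rewrite mulr_gt0.
  (* The ball of radius 2 h about x contains the cell of x and has measure 4 h, four times that of
     the cell. *)
  exists (4, fun n => PosNum (r0 n)); split => //=.
  - rewrite -(mulr0 2); apply: cvgM; first exact: cvg_cst.
    exact: cvg_harmonic.
  - move=> n y; have := cellnoP x (h0 n); rewrite /E grid_cellE gridptS/= in_itv/=.
    move=> /andP[h1 h2] /andP[h3 h4]; rewrite /ball/=.
    move: (h0 n) h1 h2 h3 h4; set k := gridpt _ _.
    rewrite ltr_norml; move: (n.+1%:R^-1 : R) k => e k e0 h1 h2 h3 h4.
    by apply/andP; split; lra.
  - move=> n; rewrite lebesgue_measure_ball//.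
    by rewrite /E lebesgue_grid_cell// -EFinM lee_fin -mulr_natr; move: (h0 n); move: (n.+1%:R^-1 : R) => e e0; lra.
have := lebesgue_differentiation lg; apply: leb_ae_mono => x lx.
have := nice_lebesgue_differentiation nE lg lx.
move=> /fine_cvg /=; apply: cvg_trans; apply: near_eq_cvg; apply: nearW => n /=.
rewrite /E lebesgue_grid_cell// inver gt_eqF// fineM//.
have ig' : leb.-integrable (grid_cell n.+1%:R^-1 (cellno n.+1%:R^-1 x)) (EFin \o g).
  rewrite grid_cellE; case: ig => mg /(_ (gridpt n.+1%:R^-1 (cellno n.+1%:R^-1 x)) (gridpt n.+1%:R^-1 (cellno n.+1%:R^-1 x) + n.+1%:R^-1)).
  apply: integrableS => //.
  by apply: subset_itvl; rewrite bnd_simp.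
apply: (integrable_fin_num _ ig'); rewrite grid_cellE; exact: measurable_itv.
Qed.

End grid_averages.

(** * Piecewise quadratic C^1 steps, used as test functions *)

Section weak_derivative_primitive.
Context {R : realType}.
Local Notation leb := (@lebesgue_measure R).
Implicit Types (f g F l : R -> R) (C : R).

(** A derivative with uniform quadratic remainder. It is stable under linear combinations, and for a
    piecewise quadratic function it reduces to a case analysis without limits. *)
Definition quad_diff F l :=
  exists C, forall x h, `|F (x + h) - F x - h * l x| <= C * h ^+ 2.

Lemma quad_diff_is_derive F l (x : R) : quad_diff F l -> is_derive x (1 : R) F (l x).
Proof.
move=> [C FC].
have cv : h^-1 *: ((F \o shift x) (h *: (1 : R)) - F x) @[h --> (0 : R)^'] --> l x.
  apply/cvgrPdist_le => e e0; near=> h.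
  have h0 : h != 0 by near: h; exact: nbhs_dnbhs_neq.
  have hC : (`|C| + 1) * `|h| <= e.
    rewrite -ler_pdivlMl ?ltr_wpDl//; near: h.
    apply: dnbhs0_le; by rewrite mulr_gt0// invr_gt0 ltr_wpDl.
  apply: le_trans hC; rewrite distrC /= /GRing.scale/= mulr1.
  have -> : h^-1 * (F (h + x) - F x) - l x = h^-1 * (F (x + h) - F x - h * l x).
    by rewrite (addrC h); field.
  rewrite normrM normfV ler_pdivrMl ?normr_gt0//.
  apply: (le_trans (FC x h)).
  have -> : `|h| * ((`|C| + 1) * `|h|) = (`|C| + 1) * h ^+ 2.
    by rewrite -(real_normK (num_real h)); ring.
  rewrite ler_wpM2r ?sqr_ge0//.
  by rewrite (le_trans (ler_norm _))// lerDl.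
apply: DeriveDef; first by apply/cvg_ex; exists (l x).
exact: cvg_lim cv.
Unshelve. all: by end_near. Qed.

Lemma quad_diffB F G l m : quad_diff F l -> quad_diff G m ->
  quad_diff (fun x => F x - G x) (fun x => l x - m x).
Proof.
move=> [C FC] [D GD]; exists (C + D) => x h; rewrite mulrDl.
apply: le_trans (lerD (FC x h) (GD x h)); rewrite -[leRHS]/(_ + _).
apply: le_trans (ler_normB _ _); rewrite le_eqVlt; apply/orP; left; apply/eqP.
by congr (`| _ |); ring.
Qed.

Lemma quad_diffZ F l c : quad_diff F l ->
  quad_diff (fun x => c * F x) (fun x => c * l x).
Proof.
move=> [C FC]; exists (`|c| * C) => x h.
rewrite (_ : _ - _ = c * (F (x + h) - F x - h * l x)); last by ring.
by rewrite normrM -mulrA ler_wpM2l.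
Qed.

Definition pospart (x : R) : R := Num.max x 0.

Lemma pospart_continuous : continuous pospart.
Proof. by move=> x; apply: continuous_max; [exact: cvg_id|exact: cvg_cst]. Qed.

Lemma quad_diff_pospart (a c : R) :
  quad_diff (fun x => pospart (a * (x - c)) ^+ 2)
            (fun x => 2 * a * pospart (a * (x - c))).
Proof.
exists (a ^+ 2) => x h; rewrite -exprMn.
rewrite (_ : a * (x + h - c) = a * (x - c) + a * h); last by ring.
rewrite (_ : h * (2 * a * pospart (a * (x - c))) = 2 * (a * h) * pospart (a * (x - c))); last by ring.
move: (a * (x - c)) (a * h) => {a c}x {}h.
rewrite /pospart ler_norml; case: (lerP 0 (x + h)) => h1; case: (lerP 0 x) => h2;
  rewrite ?(max_l h1) ?(max_l h2) ?(max_r (ltW h1)) ?(max_r (ltW h2)); apply/andP; split; nra.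
Qed.

(* The C^1 step with value 0 on ]-oo, 0] and 1 on [1, +oo[, rescaled to ]c, c + 1/a[. *)
Definition C1step (a c : R) (x : R) : R :=
  2 * (pospart (a * (x - c)) ^+ 2 - 2 * pospart (a * (x - (c + (2 * a)^-1))) ^+ 2
       - - pospart (a * (x - (c + a^-1))) ^+ 2).

(** The derivative of [C1step a c]: a tent of height 2 a on [c, c + 1/a], hence a mollifier of unit
    mass. *)
Definition C1step' (a c : R) (x : R) : R :=
  2 * (2 * a * pospart (a * (x - c)) - 2 * (2 * a * pospart (a * (x - (c + (2 * a)^-1))))
       - - (2 * a * pospart (a * (x - (c + a^-1))))).

Lemma quad_diff_C1step a c : quad_diff (C1step a c) (C1step' a c).
Proof.
apply: quad_diffZ; apply: quad_diffB.
  by apply: quad_diffB; [|apply: quad_diffZ]; exact: quad_diff_pospart.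
have := quad_diffZ (-1) (quad_diff_pospart a (c + a^-1)).
by congr quad_diff; apply/funext => x; rewrite mulN1r.
Qed.

Lemma C1step'_continuous a c : continuous (C1step' a c).
Proof.
have pc d : continuous (fun x : R => pospart (a * (x - d))).
  move=> x; apply: (@continuous_comp _ _ _ (fun x => a * (x - d)) pospart).
    by apply: cvgM; [exact: cvg_cst|apply: cvgB; [exact: cvg_id|exact: cvg_cst]].
  exact: pospart_continuous.
move=> x; apply: cvgM; first exact: cvg_cst.
apply: cvgB; first apply: cvgB.
- by apply: cvgM; [exact: cvg_cst|exact: pc].
- by apply: cvgM; [exact: cvg_cst|apply: cvgM; [exact: cvg_cst|exact: pc]].
- by apply: cvgN; apply: cvgM; [exact: cvg_cst|exact: pc].
Qed.

Lemma C1step_unit a c x : 0 < a -> exists t,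
  [/\ t = a * (x - c),
    C1step a c x = 2 * (pospart t ^+ 2 - 2 * pospart (t - 2^-1) ^+ 2 + pospart (t - 1) ^+ 2) &
    C1step' a c x = 4 * a * (pospart t - 2 * pospart (t - 2^-1) + pospart (t - 1))].
Proof.
move=> a0; exists (a * (x - c)).
have e1 : a * (x - (c + (2 * a)^-1)) = a * (x - c) - 2^-1 by field; rewrite gt_eqF.
have e2 : a * (x - (c + a^-1)) = a * (x - c) - 1 by field; rewrite gt_eqF.
by split => //; rewrite /C1step /C1step' e1 e2; ring.
Qed.

Lemma C1step_left a c x : 0 < a -> x <= c -> C1step a c x = 0 /\ C1step' a c x = 0.
Proof.
move=> a0 xc; have [t [tE -> ->]] := C1step_unit c x a0.
have t0 : t <= 0 by rewrite tE mulr_ge0_le0 ?subr_le0// ltW.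
by rewrite /pospart !max_r; try lra; split; ring.
Qed.

Lemma C1step_right a c x : 0 < a -> c + a^-1 <= x ->
  C1step a c x = 1 /\ C1step' a c x = 0.
Proof.
move=> a0 xc; have [t [tE -> ->]] := C1step_unit c x a0.
have t1 : 1 <= t by rewrite tE mulrC -ler_pdivrMr// mul1r lerBrDl.
by rewrite /pospart !max_l; try lra; split; field.
Qed.

Lemma C1step_bounds a c x : 0 < a -> 0 <= C1step a c x <= 1 /\ 0 <= C1step' a c x.
Proof.
move=> a0; have [t [tE -> ->]] := C1step_unit c x a0.
have : 0 <= pospart t ^+ 2 - 2 * pospart (t - 2^-1) ^+ 2 + pospart (t - 1) ^+ 2 <= 2^-1 /\
  0 <= pospart t - 2 * pospart (t - 2^-1) + pospart (t - 1).
  rewrite /pospart; case: (lerP 0 t) => h1; case: (lerP 0 (t - 2^-1)) => h2;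
  case: (lerP 0 (t - 1)) => h3;
    rewrite ?(max_l h1) ?(max_l h2) ?(max_l h3) ?(max_r (ltW h1)) ?(max_r (ltW h2)) ?(max_r (ltW h3));
    (split; [apply/andP; split|]); nra.
move=> [/andP[h1 h2] h3]; split; first by apply/andP; split; lra.
by rewrite mulr_ge0// mulr_ge0// ltW.
Qed.

Lemma C1step'_mass a c : 0 < a ->
  \int[leb]_(x in `[c, c + a^-1]) C1step' a c x = 1.
Proof.
move=> a0; have ca : c < c + a^-1 by rewrite ltrDl invr_gt0.
have E : (\int[leb]_(x in `[c, (c + a^-1)%R]) (C1step' a c x)%:E =
    (C1step a c (c + a^-1))%:E - (C1step a c c)%:E)%E.
  have D x := quad_diff_is_derive x (quad_diff_C1step a c).
  have Cc : continuous (C1step a c).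
    move=> x; apply: differentiable_continuous; apply/derivable1_diffP.
    by case: (D x).
  apply: continuous_FTC2 ca _ _ _.
  - by apply: continuous_subspaceT; exact: C1step'_continuous.
  - split; first by move=> x _; case: (D x).
      by apply: cvg_at_right_filter; exact: Cc.
    by apply: cvg_at_left_filter; exact: Cc.
  - by move=> x _; rewrite derive1E; case: (D x).
have [C1 _] := C1step_right a0 (lexx (c + a^-1)).
have [C0 _] := C1step_left a0 (lexx c).
by rewrite /Rintegral E C1 C0 sube0.
Qed.

End weak_derivative_primitive.

(** * Weak derivatives of continuous functions are unique almost everywhere *)

Section weak_derivative_unique.
Context {R : realType}.
Local Notation leb := (@lebesgue_measure R).
Implicit Types (f g : R -> R).

Lemma near_invS_lt (d : R) : 0 < d -> \forall n \near \oo, n.+1%:R^-1 < d.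
Proof. by move=> d0; exact: (near_infty_natSinv_lt (PosNum d0)). Qed.

Lemma continuous_mul f g : continuous f -> continuous g ->
  continuous (fun x => f x * g x).
Proof. by move=> fc gc x; apply: cvgM; [exact: fc|exact: gc]. Qed.

(** The tents are nonnegative, have mass 1 and concentrate on [c, c + 1/n], where a continuous f is
    close to f c. *)
Lemma cvg_mollify f (c : R) : continuous f ->
  \int[leb]_x (f x * C1step' n.+1%:R c x) @[n --> \oo] --> f c.
Proof.
move=> fc; apply/cvgrPdist_le => e e0.
have /cvgrPdist_le/(_ _ e0)[d /= d0 dP] := fc c.
have dn : \forall n \near \oo, n.+1%:R^-1 < d.
  exact: near_invS_lt.
near=> n; have nd : n.+1%:R^-1 < d by near: n.
have N0 : 0 < n.+1%:R :> R by [].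
have i0 : 0 < n.+1%:R^-1 :> R by rewrite invr_gt0.
move: (n.+1%:R : R) N0 i0 nd => N N0 i0 nd.
rewrite (RintegralT_supp (D := `[c, c + N^-1])); last first.
  move=> x; rewrite /= in_itv/= => /negP; rewrite negb_and -!ltNge => /orP[|] xc.
    by have [_ ->] := C1step_left N0 (ltW xc); rewrite mulr0.
  by have [_ ->] := C1step_right N0 (ltW xc); rewrite mulr0.
have ec := @C1step'_continuous R N c.
have cc : continuous (cst (f c) : R -> R) by exact: cst_continuous.
have i1 : locint (fun x => f c * C1step' N c x).
  exact: continuous_locint (continuous_mul cc ec).
have fN : continuous (fun x => - f x) by move=> x; apply: cvgN; exact: fc.
have i2 : locint (fun x => - f x * C1step' N c x).
  exact: continuous_locint (continuous_mul fN ec).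
have fcE : f c = \int[leb]_(x in `[c, c + N^-1]) (f c * C1step' N c x).
  rewrite RintegralZl//; first by rewrite C1step'_mass// mulr1.
  by have [_] := continuous_locint ec; exact.
have -> : f c - \int[leb]_(x in `[c, c + N^-1]) (f x * C1step' N c x) =
    \int[leb]_(x in `[c, c + N^-1]) (f c * C1step' N c x + - f x * C1step' N c x).
  rewrite RintegralD_itvcc// -fcE; congr (_ + _); rewrite -mulN1r -RintegralZl//.
    by apply: eq_Rintegral => x _; rewrite mulN1r mulNr.
  by have [_] := continuous_locint (continuous_mul fc ec); exact.
have i12 := locintD i1 i2.
apply: (le_trans (le_normr_Rintegral _ _)) => //; first by case: i12.
have -> : e = \int[leb]_(x in `[c, c + N^-1]) (e * C1step' N c x).
  rewrite RintegralZl//; first by rewrite C1step'_mass// mulr1.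
  by have [_] := continuous_locint ec; exact.
apply: le_Rintegral => //.
- by apply: integrable_norm; case: i12.
- have [_] := continuous_locint (continuous_mul (@cst_continuous R R e) ec); exact.
move=> x; rewrite /= in_itv/= => /andP[cx xc].
rewrite -mulrDl normrM [X in _ * X]ger0_norm; last by case: (C1step_bounds c x N0).
apply: ler_wpM2r; first by case: (C1step_bounds c x N0).
by apply: dP; rewrite /ball/= distrC ger0_norm; lra.
Unshelve. all: by end_near. Qed.

(** A C^1 approximation of the indicator of ]a, b], whose derivative is the difference of the
    mollifiers at a and at b. *)
Definition bump (n : nat) (a b x : R) : R := C1step n.+1%:R a x - C1step n.+1%:R b x.

Lemma bump_supp n (a b x : R) : a <= b -> ~ `[a, b + 1]%classic x ->
  [/\ C1step n.+1%:R a x = C1step n.+1%:R b x, C1step' n.+1%:R a x = 0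
    & C1step' n.+1%:R b x = 0].
Proof.
move=> ab; have N0 : 0 < n.+1%:R :> R by [].
have i1 : n.+1%:R^-1 <= 1 :> R by rewrite invf_le1// ler1n.
rewrite /= in_itv/= => /negP; rewrite negb_and -!ltNge => /orP[|] xc.
  have xb : x <= b by lra.
  have [-> ->] := C1step_left N0 (ltW xc).
  by have [-> ->] := C1step_left N0 xb.
have h1 : b + n.+1%:R^-1 <= x by rewrite (le_trans _ (ltW xc))// lerD2l.
have h2 : a + n.+1%:R^-1 <= x by rewrite (le_trans _ h1)// lerD2r.
have [-> ->] := C1step_right N0 h1.
by have [-> ->] := C1step_right N0 h2.
Qed.

Lemma derive1_bump n (a b : R) :
  derive1 (bump n a b) = fun x => C1step' n.+1%:R a x - C1step' n.+1%:R b x.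
Proof.
have Q := quad_diffB (quad_diff_C1step n.+1%:R a) (quad_diff_C1step n.+1%:R b).
by apply/funext => x; rewrite derive1E; case: (quad_diff_is_derive x Q).
Qed.

Lemma test_function_bump n (a b : R) : a <= b -> test_function (bump n a b).
Proof.
move=> ab; split.
- move=> x; have Q := quad_diffB (quad_diff_C1step n.+1%:R a) (quad_diff_C1step n.+1%:R b).
  by case: (quad_diff_is_derive x Q).
- rewrite derive1_bump => x; apply: cvgB; exact: C1step'_continuous.
- apply: (subclosed_compact (@closed_closure _ _) (@segment_compact _ a (b + 1))).
  have /closure_id -> : closed (`[a, b + 1]%classic : set R) by exact: itv_closed.
  apply: closure_subset => x /= bx; apply: contrapT => /(bump_supp n ab)[E _ _].
  by move: bx; rewrite /bump E subrr eqxx.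
Qed.

Lemma cvg_Rintegral_bump g (a b : R) : locint g -> a <= b ->
  \int[leb]_x (g x * bump n a b x) @[n --> \oo] --> \int[leb]_(x in `[a, b]) g x.
Proof.
move=> [mg ig] ab; pose D := `[a, b + 1]%classic : set R.
have mD : measurable D by exact: measurable_itv.
(* The pointwise limit is half-open because each step is 0 up to its left end: every bump vanishes
   at a, and the step at b is still 0 at b. *)
pose chi (x : R) : R := if (a < x) && (x <= b) then 1 else 0.
have mbump n : measurable_fun setT (bump n a b).
  by apply: continuous_measurable_fun; apply: test_function_continuous; exact: test_function_bump.
have N0 n : 0 < n.+1%:R :> R by [].
have cvb x : bump n a b x @[n --> \oo] --> chi x.
  rewrite /chi /bump; have [ax|xa] := ltP a x => /=; last first.
    apply: cvg_near_cst; apply: nearW => n.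
    have [-> _] := C1step_left (N0 n) xa.
    by have [-> _] := C1step_left (N0 n) (le_trans xa ab); rewrite subrr.
  have xa0 : 0 < x - a by rewrite subr_gt0.
  have an : \forall n \near \oo, n.+1%:R^-1 < x - a by exact: near_invS_lt.
  have [xb|bx] := leP x b.
    apply: cvg_near_cst; near=> n.
    have [|-> _] := @C1step_right _ _ a x (N0 n).
      by rewrite -lerBrDl; apply: ltW; near: n.
    by have [-> _] := C1step_left (N0 n) xb; rewrite subr0.
  have xb0 : 0 < x - b by rewrite subr_gt0.
  have bn : \forall n \near \oo, n.+1%:R^-1 < x - b by exact: near_invS_lt.
  apply: cvg_near_cst; near=> n.
  have [|-> _] := @C1step_right _ _ a x (N0 n).
    by rewrite -lerBrDl; apply: ltW; near: n.
  have [|-> _] := @C1step_right _ _ b x (N0 n); last by rewrite subrr.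
  by rewrite -lerBrDl; apply: ltW; near: n.
have -> : \int[leb]_(x in `[a, b]) g x = fine (\int[leb]_(x in D) (g x * chi x)%:E)%E.
  rewrite -(@Rintegral_itv_obnd_cbnd _ a); last first.
    by apply: integrableS (ig a b) => //; apply: subset_itvr; rewrite bnd_simp.
  rewrite [LHS]Rintegral_mkcond -[RHS]/(Rintegral _ _ _) [RHS]Rintegral_mkcond.
  apply: eq_Rintegral => x _; rewrite !patchE !mem_setE /chi !in_itv/=.
  case: (boolP ((a < x) && (x <= b))) => [/andP[ax xb]|_]; last by rewrite mulr0 if_same.
  by rewrite (ltW ax) mulr1 ifT//=; lra.
have ichi : leb.-integrable D (EFin \o (fun x => `|g x|)).
  by apply: integrable_norm; exact: ig.
have -> : (fun n => \int[leb]_x (g x * bump n a b x)) =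
    (fun n => fine (\int[leb]_(x in D) (g x * bump n a b x)%:E)%E).
  apply/funext => n; apply: RintegralT_supp => x /(bump_supp n ab)[E _ _].
  by rewrite /bump E subrr mulr0.
apply: fine_cvg; rewrite fineK; last first.
  apply: integrable_fin_num => //; apply: (@le_integrable _ _ _ leb D _ _ (EFin \o (fun x => `|g x|))) => //.
    apply/measurable_EFinP; apply: measurable_funM; first exact: measurable_funTS.
    apply: measurable_funTS; apply: measurable_fun_ifT => //; apply: measurable_and.
      by apply: measurable_fun_ltr.
    by apply: measurable_fun_ler.
  move=> x _ /=; rewrite lee_fin !normrM normr_id /chi.
  by case: ifP => _; rewrite ?normr1 ?mulr1// normr0 mulr0.
apply: (@dominated_cvg _ _ _ leb D _ (fun n x => (g x * bump n a b x)%:E) _ (EFin \o (fun x => `|g x|))) => //.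
- move=> n; apply/measurable_EFinP; apply: measurable_funTS;
  exact: (measurable_funM mg (mbump n)).
- by move=> x _; apply: cvg_EFin; [exact: nearW|apply: cvgM; [exact: cvg_cst|exact: cvb]].
- move=> n x _ /=; rewrite lee_fin normrM ler_piMr//.
  have [/andP[h1 h2] _] := C1step_bounds a x (N0 n).
  have [/andP[h3 h4] _] := C1step_bounds b x (N0 n).
  by rewrite /bump ler_norml; apply/andP; split; lra.
Unshelve. all: by end_near. Qed.

(** Testing with bumps: the side carrying the derivative of the bump tends to f a - f b, the other
    one to minus the integral of g over [a, b]. *)
Lemma weak_derivative_primitive f g : continuous f -> weak_derivative f g ->
  primitive f g.
Proof.
move=> fc [_ lg fg] a b ab; have ig := locally_integrable_locint lg.
have H1 := cvg_Rintegral_bump ig ab.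
have H2 : \int[leb]_x (f x * derive1 (bump n a b) x) @[n --> \oo] --> f a - f b.
  have -> : (fun n => \int[leb]_x (f x * derive1 (bump n a b) x)) =
      (fun n => \int[leb]_x (f x * C1step' n.+1%:R a x) - \int[leb]_x (f x * C1step' n.+1%:R b x)).
    apply/funext => n; rewrite derive1_bump.
    have i1 c : leb.-integrable `[a, b + 1] (EFin \o (fun x => f x * C1step' n.+1%:R c x)).
      have [_] := continuous_locint (continuous_mul fc (@C1step'_continuous R n.+1%:R c)); exact.
    have S := bump_supp n ab.
    rewrite [LHS](RintegralT_supp (D := `[a, b + 1])); last first.
      by move=> x /S[_ -> ->]; rewrite subrr mulr0.
    rewrite [X in _ = X - _](RintegralT_supp (D := `[a, b + 1])); last first.
      by move=> x /S[_ -> _]; rewrite mulr0.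
    rewrite [X in _ = _ - X](RintegralT_supp (D := `[a, b + 1])); last first.
      by move=> x /S[_ _ ->]; rewrite mulr0.
    by rewrite -RintegralB//; apply: eq_Rintegral => x _; rewrite mulrBr.
  by apply: cvgB; exact: cvg_mollify.
have H3 : (- \int[leb]_x (g x * bump n a b x)) @[n --> \oo] --> - \int[leb]_(x in `[a, b]) g x.
  exact: cvgN H1.
have E3 : (fun n => - \int[leb]_x (g x * bump n a b x)) =
    (fun n => \int[leb]_x (f x * derive1 (bump n a b) x)).
  by apply/funext => n; rewrite fg//; exact: test_function_bump.
move: H3; rewrite E3.
move=> /(cvg_unique (@Rhausdorff R) H2) E.
by rewrite -[RHS]opprK -E opprB.
Qed.

(** Both slopes have the same cell averages, namely difference quotients of f, and cell averages
    recover a function almost everywhere. *)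
Lemma primitive_ae_unique f g1 g2 : locint g1 -> locint g2 ->
  primitive f g1 -> primitive f g2 -> {ae leb, forall x, g1 x = g2 x}.
Proof.
move=> i1 i2 p1 p2.
apply: leb_ae_mono (leb_ae_and (ae_cvg_cell_avg i1) (ae_cvg_cell_avg i2)) => x [c1 c2].
apply: (cvg_unique (@Rhausdorff R) c1); apply: cvg_trans c2.
apply: near_eq_cvg; apply: nearW => n.
rewrite !cell_avg_itvcc// -p1 -?p2// lerDl invr_ge0//.
Qed.

Lemma wderivP f g : weak_derivative f g -> weak_derivative f (wderiv f).
Proof. by move=> fg; rewrite /wderiv; case: xgetP => // /(_ g). Qed.

Lemma wderiv_ae f g : continuous f -> weak_derivative f g ->
  {ae leb, forall x, wderiv f x = g x}.
Proof.
move=> fc fg; have fw := wderivP fg.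
have [_ /locally_integrable_locint ig _] := fg.
have [_ /locally_integrable_locint iw _] := fw.
by apply: (primitive_ae_unique iw ig); exact: weak_derivative_primitive.
Qed.

End weak_derivative_unique.

Section L2.
Context {R : realType}.
Local Notation leb := (@lebesgue_measure R).
Implicit Types (f g : R -> R).

Lemma L2normE f : L2norm f = ((\int[leb]_x (f x ^+ 2)%:E) `^ 2^-1)%E.
Proof.
rewrite /L2norm unlock; congr (_ `^ _)%E; apply: eq_integral => x _ /=.
by rewrite powR_mulrn// real_normK ?num_real.
Qed.

Lemma inL2P f : inL2 f <->
  measurable_fun setT f /\ (\int[leb]_x (f x ^+ 2)%:E < +oo)%E.
Proof.
have e : finite_norm leb 2%:E f <-> (\int[leb]_x (f x ^+ 2)%:E < +oo)%E.
  rewrite /finite_norm -/(L2norm f) L2normE; split; last exact: poweR_lty.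
  by apply: lty_poweRy; rewrite invr_neq0.
rewrite /inL2 inE; split => [/andP[]|[mf /e f2]].
  by rewrite !inE /= => mf /e; split.
by apply/andP; split; rewrite inE.
Qed.

Lemma measurable_sqr_EFin f : measurable_fun setT f ->
  measurable_fun setT (fun x => (f x ^+ 2)%:E).
Proof. by move=> mf; apply/measurable_EFinP; exact: measurable_funX. Qed.

Lemma ae_eq_integral_sqr f g : measurable_fun setT f -> measurable_fun setT g ->
  {ae leb, forall x, f x = g x} ->
  (\int[leb]_x (f x ^+ 2)%:E = \int[leb]_x (g x ^+ 2)%:E)%E.
Proof.
move=> mf mg fg; apply: ae_eq_integral => //; try exact: measurable_sqr_EFin.
by apply: leb_ae_mono fg => x -> _.
Qed.

Lemma integral_bounded_intervals f (C : R) : measurable_fun setT f ->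
  (forall x, 0 <= f x) ->
  (forall a b : R, a <= b -> (\int[leb]_(x in `[a, b]) (f x)%:E <= C%:E)%E) ->
  (\int[leb]_x (f x)%:E <= C%:E)%E.
Proof.
move=> mf f0 fC; pose F (n : nat) : set R := [set` `[- n%:R, n%:R]].
have cv : (\int[leb]_(x in F n) (f x)%:E)%E @[n --> \oo] --> (\int[leb]_(x in \bigcup_n F n) (f x)%:E)%E.
  apply: ge0_nondecreasing_set_cvg_integral => //.
  - move=> m n mn; rewrite subsetEset /F; apply: subset_itv; rewrite bnd_simp.
      by rewrite lerN2 ler_nat.
    by rewrite ler_nat.
  - by move=> n; exact: measurable_itv.
  - by move=> n; apply/measurable_EFinP; exact: measurable_funTS.
  - by move=> n x _; rewrite lee_fin.
have FT : \bigcup_n F n = setT.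
  apply/seteqP; split => // x _; exists (Num.bound `|x|) => //; rewrite /F /= in_itv/=.
  by have := archi_boundP (normr_ge0 x); rewrite ltr_norml => /andP[/ltW -> /ltW ->].
rewrite FT in cv.
rewrite -(cvg_lim _ cv)//; apply: lime_le; first by apply/cvg_ex; eexists; exact: cv.
by apply: nearW => n; apply: fC; rewrite lerNl (le_trans (y := 0))// oppr_le0.
Qed.

Lemma EFin_Rintegral_itvcc f (a b : R) : locint f ->
  ((\int[leb]_(x in `[a, b]) f x)%:E = \int[leb]_(x in `[a, b]) (f x)%:E)%E.
Proof.
move=> [_ /(_ a b) fi]; rewrite /Rintegral fineK//.
by apply: integrable_fin_num fi; exact: measurable_itv.
Qed.

End L2.

(** * Lagrangian initial datum *)

Section density.
Context d (T : measurableType d) (R : realType).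
Local Open Scope ereal_scope.
Import HBNNSimple.

(** Only subsets of E are required to have density g, because leb + mu has a density only away from
    the singular set. The formula passes from indicators to simple functions and then to f by
    monotone convergence. *)
Lemma ge0_integral_density (m mu : {measure set T -> \bar R}) (E : set T)
    (g : T -> R) (f : T -> \bar R) :
  measurable E -> measurable_fun setT g -> (forall x, 0 <= g x)%R ->
  (forall A, measurable A -> A `<=` E -> m A = \int[mu]_(x in A) (g x)%:E) ->
  measurable_fun setT f -> (forall x, 0 <= f x) ->
  \int[m]_(x in E) f x = \int[mu]_(x in E) (f x * (g x)%:E).
Proof.
move=> mE mg g0 mgE mf f0.
pose h := nnsfun_approx measurableT mf.
have mge : measurable_fun E (fun x => (g x)%:E).
  by apply/measurable_EFinP; exact: measurable_funTS.
have cvh x : EFin \o h ^~ x @ \oo --> f x by exact: cvg_nnsfun_approx.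
have -> : \int[m]_(x in E) f x = limn (fun n => \int[m]_(x in E) (h n x)%:E).
  rewrite -monotone_convergence//=.
  - by apply: eq_integral => x _; apply/esym/cvg_lim => //; exact: cvh.
  - by move=> n; apply/measurable_EFinP; exact: measurable_funTS.
  - by move=> n x _; rewrite lee_fin.
  - by move=> x _ a b ab; rewrite lee_fin; exact/lefP/nd_nnsfun_approx.
have -> : \int[mu]_(x in E) (f x * (g x)%:E) =
    limn (fun n => \int[mu]_(x in E) ((h n x)%:E * (g x)%:E)).
  rewrite -monotone_convergence//=.
  - apply: eq_integral => x _; apply/esym/cvg_lim => //.
    by apply: cvgeZr => //; exact: cvh.
  - move=> n; apply: emeasurable_funM => //.
    by apply/measurable_EFinP; exact: measurable_funTS.
  - by move=> n x _; rewrite mule_ge0 ?lee_fin.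
  - move=> x _ a b ab; rewrite lee_wpmul2r ?lee_fin//; exact/lefP/nd_nnsfun_approx.
congr (limn _); apply/funext => n.
have hind (m' : {measure set T -> \bar R}) r :
    measurable_fun E (fun x => (r * \1_(h n @^-1` [set r]) x)%:E).
  by apply/measurable_EFinP; apply: measurable_funTS; exact: measurable_funM.
under [LHS]eq_integral do rewrite fimfunE -fsumEFin//.
rewrite [LHS]ge0_integral_fsum//; last 2 first.
  - by move=> r; exact: hind.
  - by move=> r x _; rewrite EFinM nnfun_muleindic_ge0.
under [RHS]eq_integral => x xE.
  rewrite fimfunE -fsumEFin// ge0_mule_fsuml; last first.
    by move=> r; rewrite EFinM nnfun_muleindic_ge0.
  over.
rewrite [RHS]ge0_integral_fsum//; last 2 first.
  - by move=> r; apply: emeasurable_funM => //; exact: hind.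
  - by move=> r x _; apply: mule_ge0; [rewrite EFinM nnfun_muleindic_ge0|rewrite lee_fin].
apply: eq_fsbigr => r rhn.
have [r0|r0] := leP 0%R r; last first.
  have e0 : h n @^-1` [set r] = set0.
    by apply/seteqP; split => // x /= hx; have : (0 <= h n x)%R by []; rewrite hx leNgt r0.
  rewrite e0; under eq_integral do rewrite indic0/= mulr0.
  by rewrite integral0; under eq_integral do rewrite indic0/= mulr0 mul0e; rewrite integral0.
have mh : measurable (h n @^-1` [set r]) by exact: measurable_sfunP.
under eq_integral do rewrite EFinM.
rewrite ge0_integralZl//; last first.
  by apply/measurable_EFinP; exact: measurable_funTS.
rewrite integral_indic//.
under [RHS]eq_integral do rewrite EFinM -muleA.
rewrite ge0_integralZl//; last 2 first.
  - apply: emeasurable_funM => //.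
    by apply/measurable_EFinP; exact: measurable_funTS.
  - by move=> x _; rewrite mule_ge0 ?lee_fin.
congr (_ * _); rewrite mgE; last 2 first.
  - exact: measurableI.
  - exact: subIsetr.
rewrite setIC integral_mkcondr; apply: eq_integral => x _.
by rewrite epatch_indic muleC.
Qed.

End density.

(** * The label map as a generalized inverse and its pushforward *)

Section lagrangian_position.
Context {R : realType}.
Local Notation leb := (@lebesgue_measure R).
Variable mu : {finite_measure set (measurableTypeR R) -> \bar R}.

(** [lagr_y mu] is the generalized inverse of this function. Slope at least 1 makes the inverse
    1-Lipschitz, and an atom of mass m, a jump here, becomes a plateau of the inverse of length
    m. *)
Definition Fcum (x : R) : R := fine (mu [set` `]-oo, x[]) + x.
Local Notation y := (lagr_y mu).
Local Notation M := (fine (mu setT)).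

Let mu_fin A : measurable A -> mu A \is a fin_num.
Proof. exact: fin_num_measure. Qed.

Lemma Fcum_incr (x x' : R) : x <= x' -> Fcum x + (x' - x) <= Fcum x'.
Proof.
move=> xx'; rewrite /Fcum.
have : fine (mu [set` `]-oo, x[]) <= fine (mu [set` `]-oo, x'[]).
  apply: fine_le; rewrite ?mu_fin//.
  by apply: le_measure; rewrite ?inE//; apply: subset_itvl; rewrite bnd_simp.
lra.
Qed.

Lemma Fcum_ge (x : R) : x <= Fcum x.
Proof. by rewrite /Fcum lerDr fine_ge0. Qed.

Lemma Fcum_le (x : R) : Fcum x <= M + x.
Proof.
rewrite /Fcum lerD2r; apply: fine_le; rewrite ?mu_fin//.
by apply: le_measure; rewrite ?inE.
Qed.

Lemma Fcum_sub (a b : R) : a <= b ->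
  ((Fcum b - Fcum a)%:E = leb `[a, b[ + mu [set` `[a, b[])%E.
Proof.
move=> ab; have -> := lebesgue_measure_itv `[a, b[.
have -> : (mu [set` `[a, b[] = (fine (mu [set` `]-oo, b[]) - fine (mu [set` `]-oo, a[]))%:E)%E.
  rewrite EFinB !fineK ?mu_fin//.
  have <- : ([set` `]-oo, b[] : set R) `\` [set` `]-oo, a[] = [set` `[a, b[].
    apply/seteqP; split => x /=; rewrite !in_itv/=.
      by move=> [-> /negP]; rewrite -leNgt => ->.
    by move=> /andP[ax ->]; split => //; apply/negP; rewrite -leNgt.
  rewrite measureD//; last by rewrite ltey_eq mu_fin.
  by congr (_ - mu _)%E; apply: setIidr; apply: subset_itvl; rewrite bnd_simp.
rewrite /= lte_fin /Fcum; case: ltP => ab'; rewrite -?EFinB -?EFinD ?add0e; congr (_%:E); first ring.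
have -> : b = a by apply/eqP; rewrite eq_le ab ab'.
ring.
Qed.

Let has_sup_y (xi : R) : has_sup [set x : R | Fcum x < xi].
Proof.
split.
  exists (xi - M - 1) => /=; apply: (le_lt_trans (Fcum_le _)); lra.
by exists xi => x /= xxi; apply: ltW; apply: le_lt_trans xxi; exact: Fcum_ge.
Qed.

Lemma lagr_y_ge (x xi : R) : Fcum x < xi -> x <= y xi.
Proof. by move=> xxi; apply: sup_upper_bound => //; exact: has_sup_y. Qed.

Lemma lagr_y_gt (x xi : R) : x < y xi -> Fcum x < xi.
Proof.
move=> xy; have e0 : 0 < y xi - x by rewrite subr_gt0.
have [z /= zxi xz] := sup_adherent e0 (has_sup_y xi).
apply: le_lt_trans zxi; have xz' : x <= z by move: xz; rewrite -/(y xi); lra.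
by apply: le_trans (Fcum_incr xz'); rewrite lerDl; lra.
Qed.

Lemma lagr_y_bounds (xi : R) : xi - M <= y xi <= xi.
Proof.
apply/andP; split.
  rewrite leNgt; apply/negP => h; set z := (y xi + (xi - M)) / 2.
  have : z <= y xi.
    by apply: lagr_y_ge; apply: (le_lt_trans (Fcum_le _)); rewrite /z; lra.
  by rewrite /z; lra.
rewrite leNgt; apply/negP => h; set z := (y xi + xi) / 2.
have : Fcum z < xi by apply: lagr_y_gt; rewrite /z; lra.
by move=> /(le_lt_trans (Fcum_ge _)); rewrite /z; lra.
Qed.

Lemma lagr_y_mono (s t : R) : s <= t -> y s <= y t.
Proof.
move=> st; rewrite leNgt; apply/negP => h; set z := (y s + y t) / 2.
have : Fcum z < s by apply: lagr_y_gt; rewrite /z; lra.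
by move=> /lt_le_trans/(_ st)/lagr_y_ge; rewrite /z; lra.
Qed.

Lemma lagr_y_lip (s t : R) : s <= t -> y t <= y s + (t - s).
Proof.
move=> st; rewrite leNgt; apply/negP => h; set z := (y t + (y s + (t - s))) / 2.
have zt : Fcum z < t by apply: lagr_y_gt; rewrite /z; lra.
have /Fcum_incr : z - (t - s) <= z by lra.
move=> H; have /lagr_y_ge : Fcum (z - (t - s)) < s by lra.
by rewrite /z; lra.
Qed.

Lemma lagr_y_continuous : continuous y.
Proof.
apply: (@lip_continuous _ _ 1) => s t; wlog st : s t / s <= t => [H|].
  have [|/ltW] := leP s t; first exact: H.
  by rewrite distrC (distrC s); exact: H.
rewrite mul1r distrC (distrC s) !ger0_norm ?subr_ge0 ?lagr_y_mono//.
by have := lagr_y_lip st; lra.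
Qed.

(** The open half-line ending at b is the increasing union of those ending at b - 1/(n + 1), so
    their measures converge. *)
Lemma Fcum_left_continuous (b xi : R) : xi < Fcum b -> exists2 x, x < b & xi < Fcum x.
Proof.
move=> xib.
have cv : mu [set` `]-oo, (b - n.+1%:R^-1)[] @[n --> \oo] --> mu [set` `]-oo, b[].
  have -> : [set` `]-oo, b[] = \bigcup_n [set` `]-oo, (b - n.+1%:R^-1)[].
    apply/seteqP; split => [x|x [n _]]; rewrite /= !in_itv/=; last first.
      by move=> /lt_trans; apply; rewrite ltrBlDr ltrDl.
    move=> xb; have bx0 : 0 < b - x by rewrite subr_gt0.
    have [n _ /(_ n (leqnn _))/= nP] := near_infty_natSinv_lt (PosNum bx0).
    by exists n => //=; rewrite in_itv/= ltrBrDr -ltrBrDl.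
  apply: nondecreasing_cvg_mu => //.
    exact: bigcupT_measurable.
  move=> m n mn; rewrite subsetEset; apply: subset_itvl; rewrite bnd_simp.
  by rewrite lerD2l lerN2 lef_pV2 ?posrE// ler_nat.
have {}cv : fine (mu [set` `]-oo, (b - n.+1%:R^-1)[]) + (b - n.+1%:R^-1) @[n --> \oo] --> Fcum b.
  apply: cvgD.
    by apply: fine_cvg; rewrite fineK// mu_fin.
  rewrite -[X in _ --> X]subr0; apply: cvgB; first exact: cvg_cst.
  exact: cvg_harmonic.
have [n _ /(_ n (leqnn _))/= nP] := cvgr_gt _ cv _ xib.
by exists (b - n.+1%:R^-1) => //; rewrite ltrBlDr ltrDl.
Qed.

(** Left continuity makes the strict inequalities equivalent; consequently the preimage of [a, b[
    under y is exactly [Fcum a, Fcum b[. *)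
Lemma lagr_y_lt (xi b : R) : (y xi < b) = (xi < Fcum b).
Proof.
apply/idP/idP => [h|/Fcum_left_continuous[x xb xix]].
  rewrite ltNge; apply/negP => Fb; set z := (y xi + b) / 2.
  have zb : z <= b by rewrite /z; lra.
  have /lagr_y_ge : Fcum z < xi by have := Fcum_incr zb; rewrite /z; lra.
  by rewrite /z; lra.
apply: le_lt_trans xb; rewrite leNgt; apply/negP => /lagr_y_gt.
by rewrite ltNge (ltW xix).
Qed.

Lemma lagr_y_measurable : measurable_fun [set: measurableTypeR R] (y : measurableTypeR R -> measurableTypeR R).
Proof. exact: (continuous_measurable_fun lagr_y_continuous). Qed.

Let my : measurable_fun [set: measurableTypeR R] (y : measurableTypeR R -> measurableTypeR R) := lagr_y_measurable.

(** The preimage of [a, b[ has length Fcum b - Fcum a, which is leb + mu of [a, b[. These intervals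
    form a pi-system that generates the Borel sets and exhausts the line with finite measure. *)
Lemma pushforward_lagr_y (A : set (measurableTypeR R)) : measurable A ->
  leb (y @^-1` A) = (leb A + mu A)%E.
Proof.
pose G := [set A : set (measurableTypeR R) | exists a b : R, A = [set` `[a, b[]].
pose m1 : {measure set (measurableTypeR R) -> \bar R} :=
  @measure_function_pushforward__canonical__measure_function_Measure _ _ _ _ R leb _ my.
suff H : forall A : set (measurableTypeR R), measurable A -> m1 A = measure_add leb mu A.
  by move=> mA; rewrite -measure_addE -H.
have pre (a b : R) : a <= b -> y @^-1` [set` `[a, b[] = [set` `[Fcum a, Fcum b[].
  move=> ab; apply/seteqP; split => x; rewrite /= !in_itv/= -lagr_y_lt => /andP[h1 ->];
  rewrite andbT; first by rewrite leNgt -lagr_y_lt -leNgt.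
  by move: h1; rewrite leNgt -lagr_y_lt -leNgt.
have GE (a b : R) : m1 [set` `[a, b[] = measure_add leb mu [set` `[a, b[].
  rewrite measure_addE; have [ab|ba] := leP a b; last first.
    by rewrite set_itv_ge ?measure0 ?adde0// bnd_simp -leNgt ltW.
  rewrite -Fcum_sub// /m1/= /pushforward pre//.
  have -> := lebesgue_measure_itv `[Fcum a, Fcum b[.
  rewrite /= lte_fin -EFinB; case: ltP => // ba; congr (_%:E).
  by have := Fcum_incr ab; lra.
apply: (@measure_unique _ _ _ G (fun n : nat => [set` `[- n%:R, n%:R[] : set (measurableTypeR R))).
- apply/seteqP; split => B; last first.
    apply: smallest_sub; first exact: sigma_algebra_measurable.
    by move=> _ [a [b ->]]; exact: measurable_itv.
  move=> mB; suff : <<s @RGenInftyO.G R >> `<=` <<s G >>.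
    apply; have := RGenInftyO.measurableE R; rewrite /measurable /= => <-; exact: mB.
  apply: smallest_sub; first exact: smallest_sigma_algebra.
  move=> _ [x ->].
  have -> : [set` `]-oo, x[] = \bigcup_n [set` `[x - n%:R, x[].
    apply/seteqP; split => [z|z [n _]]; rewrite /= !in_itv/=; last by move=> /andP[].
    move=> zx; exists (Num.bound `|x - z|) => //=; rewrite in_itv/= zx andbT.
    rewrite lerBlDr -lerBlDl ltW//.
    exact: le_lt_trans (ler_norm _) (archi_boundP (normr_ge0 _)).
  apply: sigma_algebra_bigcup => n;
  by apply: sub_gen_smallest; exists (x - n%:R), x.
- move=> _ _ [a [b ->]] [c [d ->]]; exists (Num.max a c), (Num.min b d).
  apply/seteqP; split => z; rewrite /= !in_itv/= ge_max lt_min.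
    by move=> [/andP[-> ->] /andP[-> ->]].
  by move=> /andP[/andP[-> ->] /andP[-> ->]].
- by move=> n; exists (- n%:R), n%:R.
- apply/seteqP; split => // x _; exists (Num.bound `|x|) => //=; rewrite in_itv/=.
  have := archi_boundP (normr_ge0 x).
  by rewrite ltr_norml => /andP[/ltW -> ->].
- by move=> _ [a [b ->]]; exact: GE.
- move=> n; rewrite GE measure_addE; apply: lte_add_pinfty; last first.
    by rewrite ltey_eq mu_fin.
  apply: le_lt_trans (lebesgue_itvcc_lty (- n%:R) n%:R).
  by apply: le_measure; rewrite ?inE//; apply: subset_itvl; rewrite bnd_simp.
Qed.

End lagrangian_position.

Section lagrangian_weight.
Context {R : realType}.
Local Notation leb := (@lebesgue_measure R).
Variables (mu : {finite_measure set (measurableTypeR R) -> \bar R})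
          (mus : {measure set (measurableTypeR R) -> \bar R})
          (f : R -> R) (N : set (measurableTypeR R)).
Hypotheses (mf : measurable_fun [set: R] f) (f0 : forall x, 0 <= f x)
  (muE : forall A : set (measurableTypeR R), measurable A ->
     mu A = (\int[leb]_(x in A) (f x)%:E + mus A)%E)
  (mN : measurable N) (lebN : leb N = 0%E) (musN : mus (~` N) = 0%E).

Local Notation y := (lagr_y mu).

(* The density of the Lagrangian label with respect to the position:
   [y' = weight \o y]. It vanishes where the singular part is concentrated. *)
Definition weight (x : R) : R := \1_(~` N) x / (1 + f x).

Lemma weight_measurable : measurable_fun [set: R] weight.
Proof.
apply: measurable_funM.
  by apply: measurable_indic; exact: measurableC.
(* Since f >= 0, 1 + f equals its maximum with 1, and the inverse of max(t, 1) is continuous on the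
   whole line. *)
rewrite (_ : (fun x => _) = (fun t : R => (Num.max t 1)^-1) \o (fun x => 1 + f x)); last first.
  by apply/funext => x /=; rewrite max_l// lerDl.
apply: measurableT_comp; last exact: measurable_funD.
apply: continuous_measurable_fun => t; apply: cvgV.
  by rewrite gt_eqF// lt_max ltr01 orbT.
by apply: continuous_max; [exact: cvg_id|exact: cvg_cst].
Qed.

Lemma weight_cases (x : R) : (weight x = 0 /\ N x) \/ (weight x = (1 + f x)^-1 /\ ~ N x).
Proof.
rewrite /weight indicE; case: (pselect (N x)) => Nx.
  by left; rewrite memNset ?mul0r//; apply.
by right; rewrite mem_set// mul1r.
Qed.

Lemma weight01 (x : R) : 0 <= weight x <= 1.
Proof.
have [[-> _]|[-> _]] := weight_cases x; first by rewrite lexx ler01.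
have f1 : 1 <= 1 + f x by rewrite lerDl.
by rewrite invr_ge0 (le_trans ler01)//= invf_le1// (lt_le_trans ltr01).
Qed.

(** The left side is an integral against the pushforward leb + mu. The weight discards the singular
    set N, which is Lebesgue null, and off N it cancels the density 1 + f of leb + mu. *)
Lemma integral_lagr_y_weight (psi : R -> R) : measurable_fun [set: R] psi ->
  (forall x, 0 <= psi x) ->
  (\int[leb]_xi (psi (y xi) * weight (y xi))%:E = \int[leb]_x (psi x)%:E)%E.
Proof.
move=> mpsi psi0; have mw := weight_measurable.
have my := lagr_y_measurable mu.
pose m1 : {measure set (measurableTypeR R) -> \bar R} :=
  @measure_function_pushforward__canonical__measure_function_Measure _ _ _ _ R leb _ my.
pose h (x : R) := (psi x * weight x)%:E.
have mh : measurable_fun [set: measurableTypeR R] h.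
  by apply/measurable_EFinP; exact: measurable_funM.
have h0 x : (0 <= h x)%E.
  by rewrite lee_fin mulr_ge0//; case/andP: (weight01 x).
have m1f : measurable_fun [set: R] (fun x => 1 + f x) by exact: measurable_funD.
have mNc : measurable (~` N) by exact: measurableC.
transitivity (\int[m1]_x h x)%E.
  rewrite (@ge0_integral_pushforward _ _ _ _ _ _ my leb setT h)//.
rewrite (@eq_measure_integral _ _ _ setT (measure_add leb mu)); last first.
  move=> A mA _; rewrite -[LHS]/(leb (y @^-1` A)) pushforward_lagr_y//.
  by rewrite -measure_addE.
transitivity (\int[measure_add leb mu]_(x in ~` N) h x)%E.
  rewrite integral_mkcond [RHS]integral_mkcond; apply: eq_integral => x _.
  rewrite !patchE mem_setT /h; case: ifPn => // /negP; rewrite inE => nNx.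
  have [[-> _]|[_ nx]] := weight_cases x; first by rewrite mulr0.
  by exfalso; exact: nNx.
rewrite (@ge0_integral_density _ _ _ (measure_add leb mu) leb (~` N) (fun x => 1 + f x)%R h)//.
- transitivity (\int[leb]_(x in ~` N) (psi x)%:E)%E.
    apply: eq_integral => x /set_mem nNx; rewrite /h -EFinM; congr (_%:E).
    have [[_ Nx]|[-> _]] := weight_cases x; first by [].
    by rewrite -mulrA mulVf ?mulr1// gt_eqF// ltr_pwDl.
  rewrite [RHS](@ge0_negligible_integral _ _ _ leb setT N)//.
  - by rewrite setTD.
  - by apply/measurable_EFinP.
  - by move=> x _; rewrite lee_fin.
- by move=> x; rewrite addr_ge0.
- move=> A mA AN; transitivity (leb A + mu A)%E; first by rewrite -measure_addE.
  rewrite muE//.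
  have -> : mus A = 0%E.
    apply/eqP; rewrite eq_le measure_ge0 andbT -musN.
    by apply: le_measure; rewrite ?inE.
  rewrite adde0; under [RHS]eq_integral do rewrite EFinD.
  rewrite ge0_integralD//.
  - by rewrite integral_cst// mul1e.
  - by move=> x _; rewrite lee_fin.
  - by apply/measurable_EFinP; exact: measurable_funTS.
Qed.

End lagrangian_weight.

(** * Change of variables from labels to positions *)

Section change_of_label.
Context {R : realType}.
Local Notation leb := (@lebesgue_measure R).
Variables (y w : R -> R).
Hypotheses (y_mono : forall s t, s <= t -> y s <= y t) (yc : continuous y)
  (mw : measurable_fun setT w) (w01 : forall x, 0 <= w x <= 1)
  (yw : forall psi : R -> R, measurable_fun setT psi -> (forall x, 0 <= psi x) ->
    (\int[leb]_xi (psi (y xi) * w (y xi))%:E = \int[leb]_x (psi x)%:E)%E).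

Let my : measurable_fun setT y. Proof. exact: continuous_measurable_fun. Qed.

Lemma measurable_label (psi : R -> R) : measurable_fun setT psi ->
  measurable_fun setT (fun xi => psi (y xi) * w (y xi)).
Proof.
move=> mpsi; apply: measurable_funM; first exact: measurableT_comp mpsi my.
exact: measurableT_comp mw my.
Qed.

Let integral_patch (A : set R) (psi : R -> R) :
  (\int[leb]_(x in A) (psi x)%:E = \int[leb]_x ((psi \_ A) x)%:E)%E.
Proof. by rewrite integral_mkcond restrict_EFin. Qed.

(** y may have plateaus reaching beyond s or t, so [s, t] need not be a preimage. It lies between
    the preimages of ]y s, y t[ and of [y s, y t], and the integrals over these two intervals
    coincide. *)
Lemma integral_label_itv (psi : R -> R) (s t : R) : measurable_fun setT psi ->
  (forall x, 0 <= psi x) -> s <= t ->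
  (\int[leb]_(xi in `[s, t]) (psi (y xi) * w (y xi))%:E =
   \int[leb]_(x in `[y s, y t]) (psi x)%:E)%E.
Proof.
move=> mpsi psi0 st.
have pw (A : set R) : measurable A ->
    (\int[leb]_xi ((psi \_ A) (y xi) * w (y xi))%:E = \int[leb]_(x in A) (psi x)%:E)%E.
  move=> mA; rewrite integral_patch yw//.
    by apply/(measurable_restrictT _ _).1 => //; exact: measurable_funTS.
  by move=> x; rewrite patchE; case: ifP.
have mp (A : set R) : measurable A -> measurable_fun setT (fun xi => ((psi \_ A) (y xi) * w (y xi))%:E).
  move=> mA; apply/measurable_EFinP; apply: measurable_label.
  by apply/(measurable_restrictT _ _).1 => //; exact: measurable_funTS.
have w0 x : 0 <= w x by case/andP: (w01 x).
have ms : measurable_fun setT (fun xi => (((fun xi => psi (y xi) * w (y xi)) \_ `[s, t]) xi)%:E).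
  apply/measurable_EFinP; apply/(measurable_restrictT _ _).1 => //.
  by apply: measurable_funTS; exact: measurable_label.
apply/eqP; rewrite eq_le; apply/andP; split.
  rewrite -pw// [X in (X <= _)%E]integral_patch; apply: ge0_le_integral => //=.
  - by move=> xi _; rewrite lee_fin patchE; case: ifP => // _; rewrite mulr_ge0.
  - exact: mp.
  move=> xi _; rewrite lee_fin !patchE; case: ifPn => [|_].
    rewrite inE/= in_itv/= => /andP[sxi xit].
    by rewrite mem_set//= in_itv/= !y_mono.
  by case: ifP => _; rewrite ?mul0r// mulr_ge0.
rewrite (@integral_itv_bndoo _ (y s) (y t) (fun x => (psi x)%:E) true false); last first.
  by apply/measurable_EFinP; exact: measurable_funTS.
rewrite -pw// [X in (_ <= X)%E]integral_patch; apply: ge0_le_integral => //=.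
- by move=> xi _; rewrite lee_fin patchE; case: ifP => _; rewrite ?mul0r// mulr_ge0.
- exact: mp.
move=> xi _; rewrite lee_fin !patchE; case: ifPn => [|_].
  rewrite inE/= in_itv/= => /andP[ysxi xiyt].
  rewrite mem_set//= in_itv/=; apply/andP; split.
    by rewrite leNgt; apply/negP => /ltW/y_mono; rewrite leNgt ysxi.
  by rewrite leNgt; apply/negP => /ltW/y_mono; rewrite leNgt xiyt.
by rewrite mul0r; case: ifP => // _; rewrite mulr_ge0.
Qed.

Lemma Rintegral_label_itv (psi : R -> R) (s t : R) : locint psi -> s <= t ->
  \int[leb]_(xi in `[s, t]) (psi (y xi) * w (y xi)) =
  \int[leb]_(x in `[y s, y t]) psi x.
Proof.
move=> [mpsi ipsi] st.
have pE z : psi z = pospart (psi z) - pospart (- psi z).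
  by rewrite /pospart; case: (lerP 0 (psi z)) => h; case: (lerP 0 (- psi z)) => h'; lra.
have mpp (h : R -> R) : measurable_fun setT h -> measurable_fun setT (fun z => pospart (h z)).
  by move=> mh; apply: measurableT_comp mh; apply: continuous_measurable_fun; exact: pospart_continuous.
have pp0 (z : R) : 0 <= pospart z by rewrite le_max lexx orbT.
have ppn (z : R) : `|pospart z| <= `|z|.
  by rewrite ger0_norm// /pospart; case: (lerP 0 z) => h; rewrite ?normr_ge0// ler_norm.
have mNpsi : measurable_fun setT (fun z => - psi z) by exact: measurableT_comp.
have i1 (h : R -> R) : measurable_fun setT h -> (forall z, `|h z| <= `|psi z|) ->
    leb.-integrable `[y s, y t] (EFin \o (fun z => pospart (h z))).
  move=> mh hpsi; apply: (@le_integrable _ _ _ leb _ _ _ (EFin \o psi)) => //.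
    by apply/measurable_EFinP; apply: measurable_funTS; exact: mpp.
  by move=> z _ /=; rewrite lee_fin (le_trans (ppn _)).
have i2 (h : R -> R) : measurable_fun setT h -> (forall z, `|h z| <= `|psi z|) ->
    leb.-integrable `[s, t] (EFin \o (fun xi => pospart (h (y xi)) * w (y xi))).
  move=> mh hpsi; apply/integrableP; split.
    apply/measurable_EFinP; apply: measurable_funTS.
    exact: (measurable_label (mpp _ mh)).
  have -> : (\int[leb]_(x in `[s, t]) `|(EFin \o (fun xi => (pospart (h (y xi)) * w (y xi))%R)) x| =
      \int[leb]_(x in `[s, t]) (pospart (h (y x)) * w (y x))%:E)%E.
    by apply: eq_integral => x _ /=; rewrite ger0_norm// mulr_ge0//; case/andP: (w01 (y x)).
  rewrite (integral_label_itv (mpp _ mh))//.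
  have /integrableP[_] := i1 h mh hpsi; apply: le_lt_trans.
  by rewrite le_eqVlt; apply/orP; left; apply/eqP; apply: eq_integral => x _ /=; rewrite ger0_norm.
have E (h : R -> R) : measurable_fun setT h ->
    \int[leb]_(xi in `[s, t]) (pospart (h (y xi)) * w (y xi)) =
    \int[leb]_(x in `[y s, y t]) pospart (h x).
  by move=> mh; rewrite /Rintegral (integral_label_itv (mpp _ mh)).
transitivity (\int[leb]_(xi in `[s, t]) (pospart (psi (y xi)) * w (y xi)) -
              \int[leb]_(xi in `[s, t]) (pospart (- psi (y xi)) * w (y xi))).
  rewrite -RintegralB//.
  - by apply: eq_Rintegral => xi _; rewrite [in LHS]pE mulrBl.
  - exact: i2.
  - by apply: (i2 (fun z => - psi z)) => // z; rewrite normrN.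
rewrite (E _ mpsi) (E _ mNpsi) -RintegralB//.
- by apply: eq_Rintegral => x _; rewrite -pE.
- exact: i1.
- by apply: (i1 (fun z => - psi z)) => // z; rewrite normrN.
Qed.

(** A chain rule that differentiates neither u nor y pointwise. *)
Lemma primitive_label (u v : R -> R) : locint v -> primitive u v ->
  primitive (fun xi => u (y xi)) (fun xi => v (y xi) * w (y xi)).
Proof.
by move=> iv uv s t st; rewrite Rintegral_label_itv// uv// y_mono.
Qed.

Lemma primitive_label_id : primitive y (fun xi => w (y xi)).
Proof.
have ic : locint (cst (1 : R)) by exact/continuous_locint/cst_continuous.
have := @primitive_label id (cst 1) ic; rewrite /=.
have -> : (fun xi => 1 * w (y xi)) = (fun xi => w (y xi)) by apply/funext => xi; rewrite mul1r.
by apply => a b ab; rewrite Rintegral_itvcc_cst// mul1r.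
Qed.

End change_of_label.

(** * Bounds on Lagrangian profiles *)

Section profile.
Context {R : realType}.
Local Notation leb := (@lebesgue_measure R).
Implicit Types (u v f g U p q r : R -> R).

Lemma integrableT_locint f : leb.-integrable setT (EFin \o f) -> locint f.
Proof.
move=> fi; split; first by apply/measurable_EFinP; exact: measurable_int fi.
by move=> a b; apply: (integrableS _ _ _ fi).
Qed.

Lemma ge0_integrableT f : measurable_fun setT f -> (forall x, 0 <= f x) ->
  (\int[leb]_x (f x)%:E < +oo)%E -> leb.-integrable setT (EFin \o f).
Proof.
move=> mf f0 fi; apply/integrableP; split; first exact/measurable_EFinP.
by under eq_integral do rewrite /= ger0_norm//.
Qed.

Lemma Rintegral_itvcc_leT f (a b : R) : measurable_fun setT f -> (forall x, 0 <= f x) ->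
  (\int[leb]_x (f x)%:E < +oo)%E ->
  \int[leb]_(x in `[a, b]) f x <= \int[leb]_x f x.
Proof.
move=> mf f0 fi; have ii := ge0_integrableT mf f0 fi.
rewrite /Rintegral; apply: fine_le.
- by apply: integrable_fin_num; [exact: measurable_itv|apply: (integrableS _ _ _ ii)].
- exact: integrable_fin_num ii.
- apply: ge0_subset_integral => //.
    exact/measurable_EFinP.
  by move=> x _; rewrite lee_fin.
Qed.

(** One-dimensional Sobolev embedding. For s in [x, x + 1], |t| <= 1 + t^2 bounds |u x| by u(s)^2 +
    2 plus the integral of v^2; averaging over s gives the constant. *)
Lemma H1_bounded u v : continuous u -> locint v -> primitive u v ->
  (\int[leb]_x (u x ^+ 2)%:E < +oo)%E -> (\int[leb]_x (v x ^+ 2)%:E < +oo)%E ->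
  exists K : R, forall x, `|u x| <= K.
Proof.
move=> uc iv uv u2 v2; have mu : measurable_fun setT u by exact: continuous_measurable_fun.
have mv : measurable_fun setT v by case: iv.
have mu2 : measurable_fun setT (fun x => u x ^+ 2) by exact: measurable_funX.
have mv2 : measurable_fun setT (fun x => v x ^+ 2) by exact: measurable_funX.
have sq0 (w : R -> R) x : 0 <= w x ^+ 2 by exact: sqr_ge0.
have iu2 := integrableT_locint (ge0_integrableT mu2 (sq0 u) u2).
have iv2 := integrableT_locint (ge0_integrableT mv2 (sq0 v) v2).
have ic (c : R) : locint (cst c) by exact/continuous_locint/cst_continuous.
exists (\int[leb]_x (u x ^+ 2) + \int[leb]_x (v x ^+ 2) + 2) => x.
have x1 : x <= x + 1 by lra.
have h1 s : x <= s <= x + 1 -> `|u x| <= u s ^+ 2 + (\int[leb]_x (v x ^+ 2) + 2).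
  move=> /andP[xs sx].
  have : `|u s - u x| <= 1 + \int[leb]_x (v x ^+ 2).
    rewrite uv//; apply: (le_trans (le_normr_Rintegral _ _)) => //.
      by case: iv.
    apply: (@le_trans _ _ (\int[leb]_(z in `[x, s]) (1 + v z ^+ 2))).
      apply: le_Rintegral => //.
      - by apply: integrable_norm; case: iv.
      - by case: (locintD (ic 1) iv2).
      - by move=> z _; have := sqr_ge0 (`|v z| - 1); rewrite -[v z ^+ 2]real_normK ?num_real//; nra.
    rewrite (RintegralD_itvcc _ _ (ic 1) iv2) Rintegral_itvcc_cst//.
    apply: lerD; first by rewrite mul1r; lra.
    exact: Rintegral_itvcc_leT.
  have := ler_normD (u s) (u x - u s); rewrite addrC subrK distrC.
  have : `|u s| <= 1 + u s ^+ 2.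
    by have := sqr_ge0 (`|u s| - 1); rewrite -[u s ^+ 2]real_normK ?num_real//; nra.
  lra.
have : \int[leb]_(s in `[x, x + 1]) `|u x| <=
    \int[leb]_(s in `[x, x + 1]) (u s ^+ 2 + (\int[leb]_x (v x ^+ 2) + 2)).
  apply: le_Rintegral_itvcc h1.
    exact: ic.
  exact: (locintD iu2 (ic _)).
rewrite (RintegralD_itvcc _ _ iu2 (ic (\int[leb]_x (v x ^+ 2) + 2))) !Rintegral_itvcc_cst//.
have := Rintegral_itvcc_leT x (x + 1) mu2 (sq0 u) u2.
have -> : x + 1 - x = 1 by ring.
by rewrite /cst !mulr1; lra.
Qed.

(* The data of a Lagrangian state: [p = y'], [q = U'], [1 - p = H'], [r = rbar]. *)
Record profile U p q r : Prop := Profile {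
  profile_mp : measurable_fun setT p;
  profile_mq : measurable_fun setT q;
  profile_mr : measurable_fun setT r;
  profile_p01 : forall x, 0 <= p x <= 1;
  profile_Uq : primitive U q;
  profile_rel : forall x, 2 * p x * (1 - p x) = U x ^+ 2 * p x ^+ 2 + q x ^+ 2 + r x ^+ 2;
  profile_U2 : (\int[leb]_x (U x ^+ 2)%:E < +oo)%E;
  profile_q2 : (\int[leb]_x (q x ^+ 2)%:E < +oo)%E;
  profile_r2 : (\int[leb]_x (r x ^+ 2)%:E < +oo)%E;
  profile_H1 : (\int[leb]_x (1 - p x)%:E < +oo)%E;
  profile_bnd : exists K, forall x, `|U x| <= K }.

(** The relation gives q^2 <= 2 p (1 - p) <= 1. *)
Lemma profile_q1 U p q r : profile U p q r -> forall x, `|q x| <= 1.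
Proof.
move=> P x; have := profile_rel P x; have /andP[p0 p1] := profile_p01 P x => E.
rewrite -(@expr_le1 _ 2)//.
have -> : `|q x| ^+ 2 = q x ^+ 2 by rewrite real_normK ?num_real.
have := sqr_ge0 (U x * p x); rewrite exprMn; have := sqr_ge0 (r x).
nra.
Qed.

Lemma profile_r1 U p q r : profile U p q r -> forall x, `|r x| <= 1.
Proof.
move=> P x; have := profile_rel P x; have /andP[p0 p1] := profile_p01 P x => E.
rewrite -(@expr_le1 _ 2)//.
have -> : `|r x| ^+ 2 = r x ^+ 2 by rewrite real_normK ?num_real.
have := sqr_ge0 (U x * p x); rewrite exprMn; have := sqr_ge0 (q x).
nra.
Qed.

End profile.

Section datum_profile.
Context {R : realType}.
Local Notation leb := (@lebesgue_measure R).
Implicit Types (u rho : R -> R).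

Lemma profile_of_weight (y w u v rho f : R -> R) (M : R) :
  (forall s t, s <= t -> y s <= y t) -> continuous y ->
  measurable_fun setT w -> (forall x, 0 <= w x <= 1) ->
  (forall psi : R -> R, measurable_fun setT psi -> (forall x, 0 <= psi x) ->
    (\int[leb]_xi (psi (y xi) * w (y xi))%:E = \int[leb]_x (psi x)%:E)%E) ->
  (forall xi, xi - M <= y xi <= xi) ->
  f = (fun x => 2^-1 * (u x ^+ 2 + v x ^+ 2 + rho x ^+ 2)) ->
  (forall x, w x = 0 \/ w x = (1 + f x)^-1) ->
  continuous u -> locint v -> primitive u v -> measurable_fun setT rho ->
  (\int[leb]_x (u x ^+ 2)%:E < +oo)%E ->
  (\int[leb]_x (v x ^+ 2)%:E < +oo)%E ->
  (\int[leb]_x (rho x ^+ 2)%:E < +oo)%E ->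
  profile (fun xi => u (y xi)) (fun xi => w (y xi))
    (fun xi => v (y xi) * w (y xi)) (fun xi => rho (y xi) * w (y xi)).
Proof.
move=> y_mono yc mw w01 yw yM fE wf uc iv uv mrho u2 v2 rho2.
have my : measurable_fun setT y by exact: continuous_measurable_fun.
have mu : measurable_fun setT u by exact: continuous_measurable_fun.
have mv : measurable_fun setT v by case: iv.
have mwy : measurable_fun setT (fun xi => w (y xi)) by exact: measurableT_comp mw my.
have w0 x : 0 <= w x by case/andP: (w01 x).
have w1 x : w x <= 1 by case/andP: (w01 x).
have [K uK] := H1_bounded uc iv uv u2 v2.
have sqw (g : R -> R) : measurable_fun setT g -> (\int[leb]_x (g x ^+ 2)%:E < +oo)%E ->
    (\int[leb]_xi ((g (y xi) ^+ 2) * w (y xi))%:E < +oo)%E.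
  move=> mg g2; rewrite (yw (fun x => g x ^+ 2))//; first exact: measurable_funX.
  by move=> x; exact: sqr_ge0.
have sqw2 (g : R -> R) : measurable_fun setT g -> (\int[leb]_x (g x ^+ 2)%:E < +oo)%E ->
    (\int[leb]_xi ((g (y xi) * w (y xi)) ^+ 2)%:E < +oo)%E.
  move=> mg g2; apply: le_lt_trans (sqw g mg g2); apply: ge0_le_integral => //.
  - by move=> x _; rewrite lee_fin sqr_ge0.
  - by apply: measurable_sqr_EFin; exact: measurable_label.
  - by apply/measurable_EFinP; apply: (measurable_label yc mw (psi := fun x => g x ^+ 2)) => //; exact: measurable_funX.
  - move=> x _; rewrite lee_fin exprMn ler_wpM2l ?sqr_ge0// expr2 ler_piMl//.
have p1 := primitive_label_id y_mono yc mw w01 yw.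
(* Over [a, b] the integral is (b - a) - (y b - y a), at most M because xi - M <= y xi <= xi. *)
have H1 : (\int[leb]_x (1 - w (y x))%:E < +oo)%E.
  apply: (@le_lt_trans _ _ M%:E); last by rewrite ltry.
  have m1w : measurable_fun setT (fun x => 1 - w (y x)) by exact: measurable_funB.
  apply: integral_bounded_intervals => //; first by move=> x; rewrite subr_ge0.
  move=> a b ab.
  have i1 : locint (cst (1 : R)) by exact/continuous_locint/cst_continuous.
  have iwy : locint (fun x => w (y x)).
    by apply: (locint_bounded mwy (C := 1)) => x; rewrite ger0_norm.
  have i1w := locintD i1 (locintN iwy).
  rewrite -(EFin_Rintegral_itvcc _ _ i1w) lee_fin (RintegralD_itvcc _ _ i1 (locintN iwy)).
  have -> : \int[leb]_(x in `[a, b]) - w (y x) = - \int[leb]_(x in `[a, b]) w (y x).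
    rewrite -mulN1r -RintegralZl//; last by case: iwy.
    by apply: eq_Rintegral => x _; rewrite mulN1r.
  rewrite Rintegral_itvcc_cst// -p1// mul1r.
  by have /andP[h1 h2] := yM a; have /andP[h3 h4] := yM b; lra.
split => //.
- exact: measurable_label.
- exact: measurable_label.
- exact: primitive_label.
(* Where w = 0 both sides vanish; elsewhere w (1 + f) = 1 turns 2 w (1 - w) into 2 w^2 f, and 2 f =
   u^2 + v^2 + rho^2. *)
- move=> xi; set x := y xi; have [->|wE] := wf x; first by ring.
  have f0 : 0 <= f x.
    by rewrite fE mulr_ge0// !addr_ge0// sqr_ge0.
  have f1 : 1 + f x != 0 by rewrite gt_eqF// ltr_wpDr.
  have e1 : w x * (1 + f x) = 1 by rewrite wE mulVf.
  have -> : 2 * w x * (1 - w x) = 2 * w x * (w x * (1 + f x) - w x) by rewrite e1.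
  by rewrite fE; field.
- have m2 : measurable_fun setT (fun xi => u (y xi) ^+ 2 * w (y xi)).
    by apply: (measurable_label yc mw (psi := fun x => u x ^+ 2)) => //; exact: measurable_funX.
  have mK : measurable_fun setT (fun xi => K ^+ 2 * (1 - w (y xi))).
    by apply: measurable_funM => //; exact: measurable_funB.
  (* The change of variables needs a factor w, which U^2 lacks. Split U^2 = U^2 w + U^2 (1 - w): the
     first part integrates to that of u^2, and the second is at most K^2 (1 - w). *)
  apply: (@le_lt_trans _ _ (\int[leb]_xi ((u (y xi) ^+ 2 * w (y xi))%:E + (K ^+ 2 * (1 - w (y xi)))%:E))%E).
    apply: ge0_le_integral => //.
    + by move=> x _; rewrite lee_fin sqr_ge0.
    + by apply: measurable_sqr_EFin; exact: measurableT_comp.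
    + by apply: emeasurable_funD; apply/measurable_EFinP.
    + move=> x _; rewrite -EFinD lee_fin.
      have : u (y x) ^+ 2 <= K ^+ 2 by rewrite -[u _ ^+ 2]real_normK ?num_real// lerXn2r ?nnegrE// (le_trans _ (uK 0)).
      have := w1 (y x); nra.
  rewrite ge0_integralD//; last 4 first.
  + by move=> x _; rewrite lee_fin mulr_ge0// sqr_ge0.
  + exact/measurable_EFinP.
  + by move=> x _; rewrite lee_fin mulr_ge0 ?sqr_ge0// subr_ge0.
  + exact/measurable_EFinP.
  apply: lte_add_pinfty; first exact: sqw.
  under eq_integral do rewrite EFinM.
  rewrite ge0_integralZl//.
  + by rewrite lte_mul_pinfty// ?lee_fin ?sqr_ge0.
  + by apply/measurable_EFinP; exact: measurable_funB.
  + by move=> x _; rewrite lee_fin subr_ge0.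
  + by rewrite lee_fin sqr_ge0.
- exact: sqw2.
- exact: sqw2.
- by exists K.
Qed.

(** The datum contains rbar through the chosen representative of the weak derivative of y, known
    only almost everywhere. The profile uses the weight along y instead, so its relation holds at
    every label and the two versions of rbar are compared almost everywhere. *)
Lemma lagrangian_datum_profile u rho
    (mu : {finite_measure set (measurableTypeR R) -> \bar R})
    (mus : {measure set (measurableTypeR R) -> \bar R}) :
  inH1 u -> continuous u -> inL2 rho ->
  lebesgue_decomposition mu (energy_density u rho) mus ->
  let X := lagrangian_datum u rho mu in
  exists p q r,
    [/\ profile (q_U X) p q r, primitive (q_zeta X) (fun xi => p xi - 1),
        primitive (q_H X) (fun xi => 1 - p xi),
        exists M, forall xi, `|q_zeta X xi| <= M /\ `|q_H X xi| <= M &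
        measurable_fun setT (q_r X) /\ {ae leb, forall xi, q_r X xi = r xi}].
Proof.
move=> [/inL2P[mu' u2] [g ug] /inL2P[mv v2]] uc /inL2P[mrho rho2] [muE [N [mN lebN musN]]] X.
set v := wderiv u in mv v2 *.
have uv' : weak_derivative u v by exact: wderivP ug.
have uv := weak_derivative_primitive uc uv'.
have iv : locint v by have [_ /locally_integrable_locint] := uv'.
pose f := energy_density u rho.
have mf : measurable_fun setT f.
  apply: measurable_funM => //; apply: measurable_funD; last exact: measurable_funX.
  by apply: measurable_funD; exact: measurable_funX.
have f0 x : 0 <= f x by rewrite /f /energy_density mulr_ge0// !addr_ge0// sqr_ge0.
pose w := weight f N; pose y := lagr_y mu.
have mw : measurable_fun setT w by exact: weight_measurable.
have w01 x : 0 <= w x <= 1 by exact: weight01.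
have yc : continuous y by exact: lagr_y_continuous.
have ym : forall s t, s <= t -> y s <= y t by exact: lagr_y_mono.
have yb := lagr_y_bounds mu.
have yw (psi : R -> R) : measurable_fun setT psi -> (forall x, 0 <= psi x) ->
    (\int[leb]_xi (psi (y xi) * w (y xi))%:E = \int[leb]_x (psi x)%:E)%E.
  exact: (integral_lagr_y_weight mf f0 muE mN lebN musN).
have wf x : w x = 0 \/ w x = (1 + f x)^-1.
  by have [[]|[]] := weight_cases f N x; [left|right].
have P := profile_of_weight ym yc mw w01 yw yb erefl wf uc iv uv mrho u2 v2 rho2.
have p1 := primitive_label_id ym yc mw w01 yw.
have mwy : measurable_fun setT (fun xi => w (y xi)) := profile_mp P.
have w0 x : 0 <= w x by case/andP: (w01 x).
have iwy : locint (fun x => w (y x)).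
  by apply: (locint_bounded mwy (C := 1)) => x; rewrite ger0_norm//; case/andP: (w01 (y x)).
have i1 (c : R) : locint (cst c) by exact/continuous_locint/cst_continuous.
have pN (a b : R) : \int[leb]_(x in `[a, b]) - w (y x) = - \int[leb]_(x in `[a, b]) w (y x).
  rewrite -mulN1r -RintegralZl//; last by case: iwy.
  by apply: eq_Rintegral => x _; rewrite mulN1r.
have ywk : weak_derivative y (fun xi => w (y xi)).
  apply: (@primitive_weak_derivative _ _ _ 1) => // x.
  by rewrite ger0_norm//; case/andP: (w01 (y x)).
exists (fun xi => w (y xi)), (fun xi => v (y xi) * w (y xi)), (fun xi => rho (y xi) * w (y xi)).
split => //.
- move=> a b ab; rewrite (RintegralD_itvcc _ _ iwy (i1 (-1))) Rintegral_itvcc_cst// -p1//=.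
  by rewrite -/y; ring.
- move=> a b ab; rewrite (RintegralD_itvcc _ _ (i1 1) (locintN iwy)) Rintegral_itvcc_cst// pN -p1//=.
  by rewrite -/y; ring.
- exists (fine (mu setT)) => xi; have /andP[h1 h2] := yb xi.
  by rewrite /= -/y !ler_norml; split; apply/andP; split; rewrite /y; lra.
- have [_ lw _] := wderivP ywk; have [mwd _] := locally_integrable_locint lw.
  split.
    apply: measurable_funM => //; apply: measurableT_comp mrho _.
    exact: continuous_measurable_fun.
  by apply: leb_ae_mono (wderiv_ae yc ywk) => xi /= ->.
Qed.

End datum_profile.

(** * Discrete Green kernels *)

Section int_sequences.
Context {R : realType}.

Lemma Posz_subr1 (n : nat) : n.+1%:Z - 1 = n. Proof. by rewrite intS addrAC subrr add0r. Qed.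
Lemma Posz_addr1 (n : nat) : n%:Z + 1 = n.+1. Proof. by rewrite intS addrC. Qed.
Lemma Negz_subr1 (n : nat) : Negz n - 1 = Negz n.+1. Proof. by rewrite !NegzE !intS; ring. Qed.
Lemma Negz_addr1 (n : nat) : Negz n.+1 + 1 = Negz n. Proof. by rewrite !NegzE !intS; ring. Qed.
Lemma Negz0_addr1 : Negz 0 + 1 = 0. Proof. by []. Qed.

(** Telescoping: each of the two half-lines of indices contributes at most 2 C. *)
Lemma esum_int_le (x S : int -> R) (C : R) :
  (forall j, 0 <= x j) -> (forall j, x j <= S (j + 1) - S j) ->
  (forall j, `|S j| <= C) ->
  (\esum_(j in [set: int]) (x j)%:E <= (4 * C)%:E)%E.
Proof.
move=> x0 xS SC.
have x0' j : (0 <= (x j)%:E)%E by rewrite lee_fin.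
have Cge j : - C <= S j /\ S j <= C by have := SC j; rewrite ler_norml => /andP.
rewrite (esumID (range Posz)) // !setTI.
rewrite (_ : ~` range Posz = range Negz); last first.
  apply/seteqP; split => [[n|n] /= H|_ [n _ <-] [m _] //]; last by exists n.
  by exfalso; apply: H; exists n.
have inj1 : set_inj [set: nat] Posz by move=> i j _ _ [].
have inj2 : set_inj [set: nat] Negz by move=> i j _ _ [].
rewrite !esum_image// -!nneseries_esumT//.
have -> : (4 * C)%:E = ((2 * C)%:E + (2 * C)%:E)%E by rewrite -EFinD; congr (_%:E); ring.
apply: leeD; (apply: lime_le; first by apply: is_cvg_nneseries => n _ _; exact: x0');
  apply: nearW => n; rewrite sumEFin lee_fin.
  have : \sum_(0 <= i < n) x i <= S n - S 0.
    elim: n => [|n IH]; first by rewrite big_geq// subrr.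
    by rewrite big_nat_recr//= -Posz_addr1; have := xS n; lra.
  by have := Cge n; have := Cge 0; lra.
have : \sum_(0 <= i < n) x (Negz i) <= S 0 - S (- n%:Z).
  elim: n => [|n IH]; first by rewrite big_geq// oppr0 subrr.
  rewrite big_nat_recr//= -NegzE; have := xS (Negz n).
  by rewrite (_ : Negz n + 1 = - n%:Z); [lra|rewrite NegzE intS; ring].
by have := Cge (- n%:Z); have := Cge 0; lra.
Qed.

(** Telescoping controls the sum of a x, but a may vanish on the block [-J, J[. Elsewhere a = h can
    be divided out; the block consists of 2 J indices, where x <= M. *)
Lemma esum_weighted_le (a x T : int -> R) (h C M : R) (J : nat) :
  0 < h -> (forall j, 0 <= x j) -> (forall j, x j <= M) ->
  (forall j, J%:Z <= j \/ j < - J%:Z -> a j = h) -> (forall j, 0 <= a j) ->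
  (forall j, a j * x j <= T (j + 1) - T j) -> (forall j, `|T j| <= C) ->
  (\esum_(j in [set: int]) (x j)%:E <= (4 * (C / h + M * J%:R))%:E)%E.
Proof.
move=> h0 x0 xM aJ a0 axT TC.
have M0 : 0 <= M by exact: le_trans (x0 0) (xM 0).
(* Increases by one exactly on the block, so the increments of M c dominate x there. *)
pose c (j : int) : int := Num.max (- J%:Z) (Num.min j J%:Z).
apply: (@esum_int_le _ (fun j => T j / h + M * (c j)%:~R)) => // j.
  have Tj : T (j + 1) / h - T j / h = (T (j + 1) - T j) / h by rewrite mulrBl.
  have dT : 0 <= T (j + 1) - T j by rewrite (le_trans _ (axT j))// mulr_ge0.
  have dTh : 0 <= (T (j + 1) - T j) / h by rewrite divr_ge0// ltW.
  have [jJ|jJ] : (J%:Z <= j \/ j < - J%:Z) \/ (- J%:Z <= j /\ j < J%:Z) by lia.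
    have E : c (j + 1) = c j by rewrite /c; lia.
    have -> : T (j + 1) / h + M * (c (j + 1))%:~R - (T j / h + M * (c j)%:~R) = (T (j + 1) - T j) / h.
      by rewrite E; ring.
    rewrite ler_pdivlMr// mulrC; have := axT j; rewrite aJ//.
  have E : c (j + 1) = c j + 1 by rewrite /c; lia.
  have -> : T (j + 1) / h + M * (c (j + 1))%:~R - (T j / h + M * (c j)%:~R) = (T (j + 1) - T j) / h + M.
    by rewrite E intrD; ring.
  by have := xM j; lra.
apply: (le_trans (ler_normD _ _)); apply: lerD.
  by rewrite normrM normfV (gtr0_norm h0) ler_pM2r ?invr_gt0.
rewrite normrM ger0_norm// ler_wpM2l// -intr_norm.
have : `|c j| <= J%:Z by rewrite /c; lia.
by rewrite -(ler_int R).
Qed.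

(* In the range where [a = h], the pair [(th^(2j), th^(2j+1))] with [th - 1/th = h]
   solves the recurrence; it is continued to the right by the recurrence. *)
Lemma growing_solution (h : R) (a : int -> R) (J : nat) :
  0 < h -> (forall j, 0 <= a j) -> (forall j, j < - J%:Z -> a j = h) ->
  exists f s : int -> R, [/\ forall j, 0 < f j, forall j, 0 < s j,
    forall j, s j = s (j - 1) + a j * f j &
    forall j, f (j + 1) = f j + a j * s j].
Proof.
move=> h0 a0 aJ.
pose th := (h + Num.sqrt (h ^+ 2 + 4)) / 2.
have s0 : 0 < Num.sqrt (h ^+ 2 + 4) by rewrite sqrtr_gt0 ltr_wpDl// sqr_ge0.
have th0 : 0 < th by rewrite divr_gt0// addr_gt0.
have thE : th ^+ 2 = 1 + h * th.
  have : Num.sqrt (h ^+ 2 + 4) ^+ 2 = h ^+ 2 + 4 by rewrite sqr_sqrtr// addr_ge0// sqr_ge0.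
  rewrite /th; set q := Num.sqrt _; move=> q2; nra.
(* The shift by J makes the negative indices the range where a = h, so the constructors of [int]
   separate the closed form from the recursion. The start values continue the closed form: f = 1 and
   s = 1/th + b 0, where 1/th is s at index -1. *)
pose b (n : nat) : R := a (n%:Z - J%:Z).
pose st := fix st (n : nat) : R * R := if n is n'.+1 then
   let f := (st n').1 + b n' * (st n').2 in (f, (st n').2 + b n'.+1 * f)
   else (1, th^-1 + b 0%N).
have st0 n : 0 < (st n).1 /\ 0 < (st n).2.
  have b0 m : 0 <= b m by exact: a0.
  elim: n => [|n [IH1 IH2]] /=; first by rewrite ltr01 ltr_wpDr// invr_gt0.
  have p : 0 < (st n).1 + b n * (st n).2 by rewrite ltr_wpDr// mulr_ge0// ltW.
  by split => //; rewrite ltr_wpDr// mulr_ge0// ltW.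
pose F (j : int) : R := match j with Posz n => (st n).1 | Negz n => th ^- (2 * n.+1) end.
pose S (j : int) : R := match j with Posz n => (st n).2 | Negz n => th ^- (2 * n + 1) end.
pose A (j : int) : R := a (j - J%:Z).
have AN n : A (Negz n) = h by apply: aJ; lia.
have F0 j : 0 < F j by case: j => n; [case: (st0 n)|rewrite /= invr_gt0 exprn_gt0].
have S0 j : 0 < S j by case: j => n; [case: (st0 n)|rewrite /= invr_gt0 exprn_gt0].
have thn n : th ^+ n != 0 by rewrite expf_neq0// gt_eqF.
have th1 : th != 0 by rewrite gt_eqF.
have key n : th ^- n = th ^- (n.+2) + h * th ^- n.+1.
  rewrite !exprS; move: (th ^+ n) (thn n) => t t0.
  have -> : t^-1 = th ^+ 2 * (th * (th * t))^-1 by field; rewrite t0 th1.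
  by rewrite thE; field; rewrite t0 th1.
have RS j : S j = S (j - 1) + A j * F j.
  case: j => [[|n]|n].
  - by rewrite sub0r /= expr1 mulr1.
  - by rewrite Posz_subr1.
  - rewrite Negz_subr1 AN /= (_ : 2 * n.+1 + 1 = (2 * n + 1).+2)%N; last by lia.
    by rewrite (_ : 2 * n.+1 = (2 * n + 1).+1)%N; [exact: key|lia].
have RF j : F (j + 1) = F j + A j * S j.
  case: j => [n|[|n]].
  - by rewrite Posz_addr1.
  - by rewrite Negz0_addr1 AN /=; have := key 0%N; rewrite expr0 invr1.
  - rewrite Negz_addr1 AN /= (_ : 2 * n.+2 = (2 * n.+1).+2)%N; last by lia.
    by rewrite addn1; exact: key.
exists (fun j => F (j + J%:Z)), (fun j => S (j + J%:Z)); split => // j.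
  by rewrite RS /A addrK addrAC.
by rewrite addrAC RF /A addrK.
Qed.

End int_sequences.

(** * Green kernels from a growing and a decaying solution *)

Section kernels.
Context {R : realType}.

Lemma int_nondecreasing (f : int -> R) : (forall j, f j <= f (j + 1)) ->
  forall i j, i <= j -> f i <= f j.
Proof.
move=> fS i j ij; have -> : j = i + `|(j - i)%R|%N by lia.
elim: `|(j - i)%R|%N => [|n IH]; first by rewrite addr0.
by apply: (le_trans IH); rewrite -Posz_addr1 addrA fS.
Qed.

Lemma in_ellstar_bound (h : R) (g : int -> int -> R) (M B : R) : 0 < h ->
  (forall i j, `|g i j| <= M) ->
  (forall i, (\esum_(j in [set: int]) `|g i j|%:E <= B%:E)%E) -> in_ellstar h g.
Proof.
move=> h0 gM gB; split.
  apply: (@le_lt_trans _ _ (h * B)%:E); last by rewrite ltry.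
  apply: ub_ereal_sup => _ [i _ <-]; rewrite /ellnorm invr1 poweRe1; last first.
    rewrite mule_ge0 ?lee_fin ?(ltW h0)//; apply: esum_ge0 => j _.
    by rewrite lee_fin powR_ge0.
  rewrite EFinM lee_pmul2l ?lte_fin//.
  by under eq_esum do rewrite powRr1//.
apply: (@le_lt_trans _ _ M%:E); last by rewrite ltry.
apply: ub_ereal_sup => _ [i _ <-]; apply: ub_ereal_sup => _ [j _ <-].
by rewrite lee_fin.
Qed.

Section green.
Variables (h : R) (a f s e c : int -> R) (J : nat).
Hypotheses (h0 : 0 < h) (a0 : forall j, 0 <= a j)
  (aJ : forall j, J%:Z <= j \/ j < - J%:Z -> a j = h)
  (f0 : forall j, 0 < f j) (s0 : forall j, 0 < s j)
  (e0 : forall j, 0 < e j) (c0 : forall j, 0 < c j)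
  (sE : forall j, s j = s (j - 1) + a j * f j)
  (fE : forall j, f (j + 1) = f j + a j * s j)
  (cE : forall j, c (j - 1) = c j + a j * e j)
  (eE : forall j, e j = e (j + 1) + a j * c j)
  (W : forall j, e j * s j + f j * c j = 1).

(** The usual product of the solution decaying on the left, at the smaller index, and the one
    decaying on the right, at the larger. As s and -c are the slopes of f and e with respect to y,
    gamma is the slope of g in j; k is the analogous kernel of the dual equation, built from the
    slopes. *)
Definition green_g (i j : int) : R := if i <= j then f i * e j else f j * e i.
Definition green_gamma (i j : int) : R := if i <= j then - (f i * c j) else e i * s j.
Definition green_k (i j : int) : R := if i <= j then s i * c j else s j * c i.
Definition green_kappa (i j : int) : R := - green_gamma j i.

Let cE' j : c j = c (j + 1) + a (j + 1) * e (j + 1). Proof. by rewrite -cE addrK. Qed.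
Let sE' j : s (j + 1) = s j + a (j + 1) * f (j + 1). Proof. by rewrite sE addrK. Qed.

(** The Wronskian [W] read across a cell, the form needed to bound the diagonal of k. *)
Let W' j : e (j + 1) * s j + f (j + 1) * c j = 1.
Proof. by rewrite -[RHS](W (j + 1)) sE' (cE' j); ring. Qed.

(** Off the diagonal the recurrences cancel; on it the jump of gamma leaves the Wronskian,
    normalized to 1. *)
Lemma green_g_eq i j :
  a j * green_g i j - (green_gamma i j - green_gamma i (j - 1)) = (i == j)%:R.
Proof.
rewrite /green_g /green_gamma; have [ij|ji|->] := ltgtP i j.
- by rewrite ifT; [rewrite cE mulr0n; ring|lia].
- by rewrite ifF; [rewrite (sE j) mulr0n; ring|lia].
- rewrite ifF; last by lia.
  by rewrite mulr1n -[RHS](W j) (sE j); ring.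
Qed.

Lemma green_g_eq2 i j : green_g i (j + 1) - green_g i j = a j * green_gamma i j.
Proof.
rewrite /green_g /green_gamma; have [ij|ji] := leP i j.
  by rewrite ifT; [rewrite (eE j); ring|lia].
have [->|ne] := eqVneq i (j + 1); first by rewrite lexx fE; ring.
by rewrite ifF; [rewrite fE; ring|lia].
Qed.

Lemma green_k_eq i j :
  a j * green_k i j - (green_kappa i (j + 1) - green_kappa i j) = (i == j)%:R.
Proof.
rewrite /green_k /green_kappa /green_gamma; have [ij|ji|->] := ltgtP i j.
- by rewrite ifF; [rewrite (eE j) mulr0n; ring|lia].
- rewrite ifT; last by lia.
  by rewrite fE mulr0n; ring.
- by rewrite ifF; [rewrite mulr1n -[RHS](W j) (eE j); ring|lia].
Qed.

Lemma green_k_eq2 i j : green_k i j - green_k i (j - 1) = a j * green_kappa i j.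
Proof.
rewrite /green_k /green_kappa /green_gamma; have [ij|ji|->] := ltgtP i j.
- by rewrite ifT; [rewrite cE; ring|lia].
- by rewrite ifF; [rewrite (sE j); ring|lia].
- by rewrite ifF; [rewrite (sE j); ring|lia].
Qed.

Lemma green_symm i j : [/\ green_g j i = green_g i j, green_k j i = green_k i j &
  green_gamma j i = - green_kappa i j].
Proof.
by rewrite /green_kappa opprK /green_g /green_k; split => //; case: ltgtP => // ->.
Qed.

Let f_mono i j : i <= j -> f i <= f j.
Proof. by apply: int_nondecreasing => {}j; rewrite fE lerDl mulr_ge0// ltW. Qed.

Let s_mono i j : i <= j -> s i <= s j.
Proof. by apply: int_nondecreasing => {}j; rewrite sE' lerDl mulr_ge0// ltW. Qed.

Let e_anti i j : i <= j -> e j <= e i.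
Proof.
move=> ij; rewrite -lerN2; apply: (@int_nondecreasing (fun j => - e j)) ij => {}j.
by rewrite lerN2 (eE j) lerDl mulr_ge0// ltW.
Qed.

Let c_anti i j : i <= j -> c j <= c i.
Proof.
move=> ij; rewrite -lerN2; apply: (@int_nondecreasing (fun j => - c j)) ij => {}j.
by rewrite lerN2 (cE' j) lerDl mulr_ge0// ltW.
Qed.

Let fc1 i j : i <= j -> f i * c j <= 1.
Proof.
move=> ij; apply: (@le_trans _ _ (f j * c j)); first by rewrite ler_wpM2r ?f_mono// ltW.
by rewrite -(W j) lerDr mulr_ge0// ltW.
Qed.

Let es1 i j : j <= i -> e i * s j <= 1.
Proof.
move=> ij; apply: (@le_trans _ _ (e i * s i)); first by rewrite ler_wpM2l ?s_mono// ltW.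
by rewrite -(W i) lerDl mulr_ge0// ltW.
Qed.

(** Monotonicity moves each product to the diagonal, where it is one of the two positive terms of
    [W]. *)
Lemma green_gamma_le1 i j : `|green_gamma i j| <= 1.
Proof.
rewrite /green_gamma; case: (leP i j) => ij.
  by rewrite normrN ger0_norm ?fc1// mulr_ge0// ltW.
by rewrite ger0_norm ?es1 ?mulr_ge0 ?ltW.
Qed.

(** A common bound for the diagonals of g and k. Where a = h the Wronskian gives 1/h; on the
    remaining indices, between -J and J, the increasing factor is largest at J and the decreasing
    one at -J. *)
Let M := h^-1 + f J%:Z * e (- J%:Z) + s J%:Z * c (- J%:Z).

Let inJ i : (J%:Z <= i \/ i < - J%:Z) \/ (- J%:Z <= i /\ i <= J%:Z).
Proof. lia. Qed.

Let fe_bound i : f i * e i <= M.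
Proof.
have p1 := mulr_ge0 (ltW (f0 J%:Z)) (ltW (e0 (- J%:Z))).
have p2 := mulr_ge0 (ltW (s0 J%:Z)) (ltW (c0 (- J%:Z))).
have p3 : 0 <= h^-1 by rewrite invr_ge0 ltW.
have [aiJ|[Ji iJ]] := inJ i.
  suff : f i * e i <= h^-1 by rewrite /M; lra.
  rewrite -[leRHS]mul1r ler_pdivlMr// -(aJ aiJ).
  apply: le_trans (es1 (lexx i)); rewrite [in leRHS](sE i).
  have := mulr_gt0 (e0 i) (s0 (i - 1)); lra.
suff : f i * e i <= f J%:Z * e (- J%:Z) by rewrite /M; lra.
by apply: ler_pM; [exact: ltW|exact: ltW|exact: f_mono|exact: e_anti].
Qed.

Let sc_bound i : s i * c i <= M.
Proof.
have p1 := mulr_ge0 (ltW (f0 J%:Z)) (ltW (e0 (- J%:Z))).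
have p2 := mulr_ge0 (ltW (s0 J%:Z)) (ltW (c0 (- J%:Z))).
have p3 : 0 <= h^-1 by rewrite invr_ge0 ltW.
have [aiJ|[Ji iJ]] := inJ i.
  suff : s i * c i <= h^-1 by rewrite /M; lra.
  rewrite -[leRHS]mul1r ler_pdivlMr// -(aJ aiJ) -(W' i) fE.
  have := mulr_gt0 (e0 (i + 1)) (s0 i); have := mulr_gt0 (f0 i) (c0 i); lra.
suff : s i * c i <= s J%:Z * c (- J%:Z) by rewrite /M; lra.
by apply: ler_pM; [exact: ltW|exact: ltW|exact: s_mono|exact: c_anti].
Qed.

Lemma green_g_bounds i j : 0 <= green_g i j <= M.
Proof.
rewrite /green_g; case: (leP i j) => ij; rewrite (mulr_ge0 (ltW (f0 _)) (ltW (e0 _)))/=; apply: le_trans (fe_bound i).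
  by rewrite ler_wpM2l ?e_anti// ltW.
by rewrite ler_wpM2r ?f_mono// ltW.
Qed.

Lemma green_k_bounds i j : 0 <= green_k i j <= M.
Proof.
rewrite /green_k; case: (leP i j) => ij; rewrite (mulr_ge0 (ltW (s0 _)) (ltW (c0 _)))/=; apply: le_trans (sc_bound i).
  by rewrite ler_wpM2l ?c_anti// ltW.
by rewrite ler_wpM2r ?s_mono// ltW.
Qed.

(** In the kernel equations a kernel multiplied by a is a difference of its partner kernel, up to
    the diagonal. The sequences T below are these partners, corrected at the diagonal. *)
Let in_ellstar_weighted (x : int -> int -> R) (T : int -> int -> R) (C M' : R) :
  (forall i j, `|x i j| <= M') ->
  (forall i j, a j * `|x i j| <= T i (j + 1) - T i j) ->
  (forall i j, `|T i j| <= C) -> in_ellstar h x.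
Proof.
move=> xM axT TC; apply: (in_ellstar_bound h0 xM) => i.
exact: (esum_weighted_le h0 (fun j => normr_ge0 _) (xM i) aJ a0 (axT i) (TC i)).
Qed.

(** a g is the difference of gamma plus a Kronecker delta; the indicator of i < j added to gamma
    absorbs the delta. *)
Lemma green_g_ellstar : in_ellstar h green_g.
Proof.
apply: (@in_ellstar_weighted _ (fun i j => green_gamma i (j - 1) + (i < j)%R%:R) 2 M).
- by move=> i j; have /andP[h1 h2] := green_g_bounds i j; rewrite ger0_norm.
- move=> i j; have /andP[h1 h2] := green_g_bounds i j; rewrite ger0_norm// addrK.
  have := green_g_eq i j; have [ij|ji|->] := ltgtP i j.
  + rewrite [i < j + 1](_ : _ = true); last by lia.
    by rewrite mulr0n mulr1n; lra.
  + rewrite [i < j + 1](_ : _ = false); last by lia.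
    by rewrite mulr0n; lra.
  + rewrite [j < j + 1](_ : _ = true); last by lia.
    by rewrite mulr0n mulr1n; lra.
- move=> i j; apply: (le_trans (ler_normD _ _)).
  have := green_gamma_le1 i (j - 1); rewrite normr_nat.
  by case: (i < j)%R => /=; lra.
Qed.

Lemma green_k_ellstar : in_ellstar h green_k.
Proof.
apply: (@in_ellstar_weighted _ (fun i j => green_kappa i j + (i < j)%R%:R) 2 M).
- by move=> i j; have /andP[h1 h2] := green_k_bounds i j; rewrite ger0_norm.
- move=> i j; have /andP[h1 h2] := green_k_bounds i j; rewrite ger0_norm//.
  have := green_k_eq i j; have [ij|ji|->] := ltgtP i j.
  + rewrite [i < j + 1](_ : _ = true); last by lia.
    by rewrite mulr0n mulr1n; lra.
  + rewrite [i < j + 1](_ : _ = false); last by lia.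
    by rewrite mulr0n; lra.
  + rewrite [j < j + 1](_ : _ = true); last by lia.
    by rewrite mulr0n mulr1n; lra.
- move=> i j; apply: (le_trans (ler_normD _ _)).
  have := green_gamma_le1 j i; rewrite /green_kappa normrN normr_nat.
  by case: (i < j)%R => /=; lra.
Qed.

(** g increases in j up to the diagonal and decreases afterwards. Reflecting the decreasing branch
    at its peak gives a nondecreasing T with increments a |gamma|. *)
Lemma green_gamma_ellstar : in_ellstar h green_gamma.
Proof.
apply: (@in_ellstar_weighted _
  (fun i j => if j <= i then green_g i j else 2 * green_g i i - green_g i j) (3 * M) 1).
- exact: green_gamma_le1.
- move=> i j; have := green_g_eq2 i j; rewrite [in `|_|]/green_gamma.
  have p1 := mulr_gt0 (f0 i) (c0 j); have p2 := mulr_gt0 (e0 i) (s0 j).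
  rewrite /green_gamma; have [ij|ji] := leP i j.
    rewrite normrN gtr0_norm// ifF; last by lia.
    have [ij'|ij'] := leP j i; last by lra.
    have -> : i = j by lia.
    by lra.
  by rewrite gtr0_norm// ifT ?ifT; [lra|lia|lia].
- move=> i j; have /andP[h1 h2] := green_g_bounds i j; have /andP[h3 h4] := green_g_bounds i i.
  by rewrite ler_norml; case: ifP => _; apply/andP; split; lra.
Qed.

(** The same reflection for k, shifted by one index because its equation uses the backward
    difference. *)
Lemma green_kappa_ellstar : in_ellstar h green_kappa.
Proof.
apply: (@in_ellstar_weighted _
  (fun i j => if j <= i then green_k i (j - 1) else 2 * green_k i i - green_k i (j - 1)) (3 * M) 1).
- by move=> i j; rewrite normrN; exact: green_gamma_le1.
- move=> i j; have := green_k_eq2 i j; rewrite /green_kappa /green_gamma addrK.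
  have p1 := mulr_gt0 (f0 j) (c0 i); have p2 := mulr_gt0 (e0 j) (s0 i).
  have [ij|ji] := leP j i.
    rewrite opprK gtr0_norm//; have [ij'|ij'] := leP (j + 1) i; first by lra.
    have -> : i = j by lia.
    by lra.
  rewrite normrN gtr0_norm// ifF; last by lia.
  by lra.
- move=> i j; have /andP[h1 h2] := green_k_bounds i (j - 1); have /andP[h3 h4] := green_k_bounds i i.
  by rewrite ler_norml; case: ifP => _; apply/andP; split; lra.
Qed.

End green.

Lemma associated_kernels_exist (h : R) (X : quadruple int R) (J : nat) : 0 < h ->
  (forall j, 0 <= Dplus h (grid_y h X) j) ->
  (forall j, J%:Z <= j \/ j < - J%:Z -> Dplus h (grid_y h X) j = 1) ->
  exists g k gamma kappa, associated_kernels h X g k gamma kappa.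
Proof.
move=> h0; set D := Dplus h (grid_y h X) => D0 DJ.
pose a j := h * D j.
have a0 j : 0 <= a j by rewrite mulr_ge0// ltW.
have aJ j : J%:Z <= j \/ j < - J%:Z -> a j = h by move=> jJ; rewrite /a DJ// mulr1.
have [f [s [f0 s0 sE fE]]] := growing_solution h0 a0 (fun j jJ => aJ j (or_intror jJ)).
(* The solution decaying at +oo is the growing one for the reflected coefficients. Reflection also
   exchanges forward and backward differences, so c' and e' take the places of f and s. *)
have [|c' [e' [c0 e0 eE' cE']]] := @growing_solution _ h (fun j => a (- j)) J.+1 h0 (fun j => a0 _).
  by move=> j jJ; apply: aJ; left; lia.
(* The discrete Wronskian: positive and independent of j, so dividing one solution by it normalizes
   the kernels. *)
pose w j := e' (- j) * s j + f j * c' (- j).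
have wS j : w (j + 1) = w j.
  have E1 : e' (- j) = e' (- (j + 1)) + a j * c' (- j) by rewrite eE' opprK opprD.
  have E2 : c' (- j) = c' (- (j + 1)) + a (j + 1) * e' (- (j + 1)).
    by have := cE' (- (j + 1)); rewrite opprK (_ : - (j + 1) + 1 = - j)//; ring.
  have S1 : s (j + 1) = s j + a (j + 1) * f (j + 1) by rewrite sE addrK.
  rewrite /w S1 [in RHS]E1.
  transitivity (e' (- (j + 1)) * s j + f (j + 1) * c' (- j)); first by rewrite E2; ring.
  by rewrite fE; ring.
have wc j : w j = w 0.
  have W n : w (n%:Z) = w 0 by elim: n => // n IH; rewrite -Posz_addr1 wS.
  case: j => n; first exact: W.
  by elim: n => [|n IH]; rewrite -wS ?Negz0_addr1 ?Negz_addr1.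
have w0 : 0 < w 0 by rewrite addr_gt0// mulr_gt0.
pose e j := e' (- j) / w 0; pose c j := c' (- j) / w 0.
have e_0 j : 0 < e j by rewrite divr_gt0.
have c_0 j : 0 < c j by rewrite divr_gt0.
have cE j : c (j - 1) = c j + a j * e j.
  by rewrite /c /e opprB addrC cE' opprK; ring.
have eE j : e j = e (j + 1) + a j * c j.
  by rewrite /c /e eE' opprK opprD; ring.
have W j : e j * s j + f j * c j = 1.
  have : w j / w 0 = 1 by rewrite wc mulfV// gt_eqF.
  by move=> <-; rewrite /w /e /c; ring.
exists (green_g f e), (green_k s c), (green_gamma f s e c), (green_kappa f s e c).
split.
  split.
  - by apply: (@green_g_ellstar h a f s e c J).
  - by apply: (@green_k_ellstar h a f s e c J).
  - by apply: (@green_gamma_ellstar h a f s e c J).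
  - by apply: (@green_kappa_ellstar h a f s e c J).
move=> i j; rewrite -/D; have h1 : h != 0 by rewrite gt_eqF.
split; last exact: green_symm.
split.
- by rewrite -(green_g_eq h0 sE cE W) /Dminus /a; field.
- by rewrite /Dplus (green_g_eq2 h0 fE eE) /a; field.
- by rewrite -(green_k_eq h0 fE eE W) /Dplus /a; field.
- by rewrite /Dminus (green_k_eq2 h0 sE cE) /a; field.
Qed.

End kernels.

(** * Grid approximation of Lagrangian profiles *)

Section integral_bounds.
Context {R : realType}.
Local Notation leb := (@lebesgue_measure R).
Implicit Types (f g G : R -> R) (A B : R).

(** Bundling measurability and sign with a real bound lets the estimates be chained by arithmetic on
    explicit constants. *)
Definition integral_le f A :=
  [/\ measurable_fun setT f, forall x, 0 <= f x & (\int[leb]_x (f x)%:E <= A%:E)%E].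

Lemma integral_leD f g A B : integral_le f A -> integral_le g B ->
  integral_le (fun x => f x + g x) (A + B).
Proof.
move=> [mf f0 fA] [mg g0 gB]; split; first exact: measurable_funD.
  by move=> x; rewrite addr_ge0.
under eq_integral do rewrite EFinD.
rewrite ge0_integralD//; last 4 first.
- by move=> x _; rewrite lee_fin.
- exact/measurable_EFinP.
- by move=> x _; rewrite lee_fin.
- exact/measurable_EFinP.
by rewrite EFinD leeD.
Qed.

Lemma integral_leZ f A c : 0 <= c -> integral_le f A ->
  integral_le (fun x => c * f x) (c * A).
Proof.
move=> c0 [mf f0 fA]; split; first exact: measurable_funM.
  by move=> x; rewrite mulr_ge0.
under eq_integral do rewrite EFinM.
rewrite ge0_integralZl//; last 2 first.
- exact/measurable_EFinP.
- by move=> x _; rewrite lee_fin.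
by rewrite EFinM lee_wpmul2l// lee_fin.
Qed.

Lemma integral_le_mono f g A : integral_le f A -> measurable_fun setT g ->
  (forall x, 0 <= g x) -> (forall x, g x <= f x) -> integral_le g A.
Proof.
move=> [mf f0 fA] mg g0 gf; split => //; apply: le_trans fA.
apply: ge0_le_integral => //.
- by move=> x _; rewrite lee_fin.
- exact/measurable_EFinP.
- exact/measurable_EFinP.
- by move=> x _; rewrite lee_fin.
Qed.

Lemma integral_le_weaken f A B : A <= B -> integral_le f A -> integral_le f B.
Proof. by move=> AB [mf f0 fA]; split => //; apply: le_trans fA _; rewrite lee_fin. Qed.

Lemma integral_le_itv (a b c : R) : 0 <= c -> a <= b ->
  integral_le (fun x => c * \1_(`[a, b]) x) (c * (b - a)).
Proof.
move=> c0 ab; apply: integral_leZ => //; split.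
- by apply: measurable_indic; exact: measurable_itv.
- by move=> x; rewrite indicE.
have H : (leb `[a, b]%classic <= (b - a)%:E)%E.
  have -> := lebesgue_measure_itv `[a, b].
  by rewrite /= lte_fin; case: ifP => _; rewrite -?EFinB lee_fin ?subr_ge0.
by rewrite integral_indic// setIT; exact: H.
Qed.

Lemma integral_le_of_fin f : measurable_fun setT f -> (forall x, 0 <= f x) ->
  (\int[leb]_x (f x)%:E < +oo)%E -> exists2 A, 0 <= A & integral_le f A.
Proof.
move=> mf f0 fi; exists (\int[leb]_x f x).
  by apply: Rintegral_ge0 => x _.
split => //; rewrite /Rintegral fineK//; apply: integrable_fin_num => //.
exact: ge0_integrableT.
Qed.

(* 2 |b| |a - b| <= t b^2 + (a - b)^2 / t *)
Lemma integral_le_sqr_diff f g A B t : 0 < t -> measurable_fun setT f -> measurable_fun setT g ->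
  integral_le (fun x => (f x - g x) ^+ 2) A -> integral_le (fun x => g x ^+ 2) B ->
  integral_le (fun x => `|f x ^+ 2 - g x ^+ 2|) ((1 + t^-1) * A + t * B).
Proof.
move=> t0 mf mg fg gB.
have ti0 : 0 < t^-1 by rewrite invr_gt0.
have fgt : integral_le (fun x => (1 + t^-1) * (f x - g x) ^+ 2 + t * g x ^+ 2)
    ((1 + t^-1) * A + t * B).
  by apply: integral_leD; apply: integral_leZ => //; [rewrite addr_ge0// ltW|exact: ltW].
apply: integral_le_mono fgt _ _ _ => //.
  apply: measurableT_comp => //; apply: measurable_funB; exact: measurable_funX.
move=> x; set d := f x - g x.
have -> : f x ^+ 2 - g x ^+ 2 = d * (d + 2 * g x) by rewrite /d; ring.
have h1 : 2 * `|d * g x| <= t^-1 * d ^+ 2 + t * g x ^+ 2.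
  have := sqr_ge0 (`|d| - t * `|g x|) => h; rewrite normrM.
  have E : t * (t^-1 * d ^+ 2 + t * g x ^+ 2) = d ^+ 2 + t ^+ 2 * g x ^+ 2.
    by field; rewrite gt_eqF.
  rewrite -(ler_pM2l t0) E.
  rewrite -[d ^+ 2]real_normK ?num_real// -[g x ^+ 2]real_normK ?num_real//; nra.
rewrite mulrDr; apply: (le_trans (ler_normD _ _)).
rewrite -expr2 ger0_norm ?sqr_ge0// mulrCA normrM (ger0_norm (_ : 0 <= 2))//.
by lra.
Qed.

End integral_bounds.

Section clamp.
Context {R : realType}.
Local Notation leb := (@lebesgue_measure R).
Implicit Types (f g G : R -> R).

Definition clamp (a b x : R) : R := Num.max a (Num.min x b).

(** Stopping the argument at a and b extends G by constants, which restricts the slope to [a, b]. *)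
Lemma primitive_clamp G g (a b : R) : a <= b -> locint g -> primitive G g ->
  primitive (fun x => G (clamp a b x)) (g \_ `[a, b]).
Proof.
move=> ab ig Gg s t st; rewrite -Rintegral_mkcondr.
have [le|lt] := leP (Num.max s a) (Num.min t b).
  have -> : `[s, t] `&` `[a, b] = `[Num.max s a, Num.min t b]%classic.
    apply/seteqP; split => x; rewrite /= !in_itv/= ge_max le_min.
      by move=> [/andP[-> ->] /andP[-> ->]].
    by move=> /andP[/andP[-> ->] /andP[-> ->]].
  rewrite -Gg//; move: le; rewrite /clamp !ge_max !le_min => /andP[/andP[h1 h2] /andP[h3 h4]].
  have -> : Num.max a (Num.min t b) = Num.min t b by rewrite max_r// le_min h3 h4.
  by have -> : Num.max a (Num.min s b) = Num.max s a by rewrite (min_l h2) maxC.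
have -> : `[s, t] `&` `[a, b] = set0.
  apply/seteqP; split => x //; rewrite /= !in_itv/= => -[/andP[h1 h2] /andP[h3 h4]].
  have : Num.max s a <= x by rewrite ge_max h1.
  have : x <= Num.min t b by rewrite le_min h2.
  by move=> h5 h6; have := le_trans h6 h5; rewrite leNgt lt.
rewrite Rintegral_set0; apply/eqP; rewrite subr_eq0; apply/eqP; congr G.
move: lt; rewrite /clamp gt_min !lt_max !ltNge st ab/= orbF -!ltNge => /orP[tl|ls].
  by rewrite (min_l (ltW (lt_le_trans tl ab))) (min_l (le_trans st (ltW (lt_le_trans tl ab)))) !max_l// ltW// (le_lt_trans st).
by rewrite (min_r (ltW ls)) (min_r (le_trans (ltW ls) st)).
Qed.

Lemma primitiveD f g F G : locint f -> locint g -> primitive F f -> primitive G g ->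
  primitive (fun x => F x + G x) (fun x => f x + g x).
Proof.
move=> fi gi Ff Gg a b ab; rewrite RintegralD_itvcc// -Ff// -Gg//; ring.
Qed.

Lemma primitive_cst (c : R) : primitive (fun x => c * x) (cst c).
Proof. by move=> a b ab; rewrite Rintegral_itvcc_cst// mulrBr. Qed.

Lemma primitive_shift f F c : primitive F f -> primitive (fun x => F x + c) f.
Proof. by move=> Ff a b ab; rewrite -Ff//; ring. Qed.

End clamp.

Section step_functions.
Context {R : realType}.
Local Notation leb := (@lebesgue_measure R).

Definition stepf (h : R) (v : int -> R) (x : R) : R := v (cellno h x).

Lemma stepf_measurable (h : R) v : 0 < h -> measurable_fun [set: R] (stepf h v).
Proof.
move=> h0 _ Y mY; rewrite setTI.
have -> : stepf h v @^-1` Y = \bigcup_j (if v j \in Y then grid_cell h j else set0).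
  apply/seteqP; split => x /=.
    move=> Yx; exists (cellno h x) => //; rewrite mem_set//.
    by have := cellnoP x h0; rewrite /grid_cell/= in_itv.
  move=> [j _]; case: ifPn => // /set_mem Yj; rewrite /grid_cell/= in_itv/= => /andP[h1 h2].
  by rewrite /stepf (cellno_eq h0 h1 h2).
apply: countable_bigcupT_measurable => // j.
by case: ifP => _ //; exact: measurable_itv.
Qed.

End step_functions.

(** * A parametrization of the cone behind identity (c) *)

Section cone.
Context {R : realType}.
Implicit Types (b q r p s u K : R).

(* The cone [2 P S = q^2 + r^2], [P, S >= 0], is parametrized by [(b, q, r)]
   through [P + S = 2 A], [P - S = 1 - 2 b]; the vertex is replaced by [(1, 0)]. *)
Definition coneA b q r : R := Num.sqrt ((2^-1 - b) ^+ 2 + (q ^+ 2 + r ^+ 2) / 2).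
Definition coneP b q r : R := if coneA b q r == 0 then 1 else coneA b q r + (2^-1 - b).
Definition coneS b q r : R := if coneA b q r == 0 then 0 else coneA b q r - (2^-1 - b).

Lemma coneA_ge0 b q r : 0 <= coneA b q r. Proof. exact: sqrtr_ge0. Qed.

Lemma coneA_sqr b q r : coneA b q r ^+ 2 = (2^-1 - b) ^+ 2 + (q ^+ 2 + r ^+ 2) / 2.
Proof.
rewrite sqr_sqrtr// addr_ge0 ?sqr_ge0//.
by have := sqr_ge0 q; have := sqr_ge0 r; lra.
Qed.

Lemma cone0 : coneP 0 0 0 = 1 /\ coneS 0 0 0 = 0.
Proof.
have A0 : coneA 0 0 0 = 2^-1.
  rewrite /coneA subr0 expr0n/= addr0 mul0r addr0 sqrtr_sqr ger0_norm//.
by rewrite /coneP /coneS A0 gt_eqF//; split; lra.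
Qed.

Lemma cone_eq b q r : 2 * coneP b q r * coneS b q r = q ^+ 2 + r ^+ 2.
Proof.
have := coneA_sqr b q r; rewrite /coneP /coneS; case: eqP => [->|_] E.
  by have := sqr_ge0 q; have := sqr_ge0 r; have := sqr_ge0 (2^-1 - b); rewrite expr0n/= in E *; lra.
by nra.
Qed.

Lemma cone_signs b q r :
  [/\ 0 <= coneP b q r, 0 <= coneS b q r & 0 < coneP b q r + coneS b q r].
Proof.
have E := coneA_sqr b q r; have A0 := coneA_ge0 b q r.
rewrite /coneP /coneS; case: eqP => [_|/eqP ne]; first by split; lra.
have Ap : 0 < coneA b q r by rewrite lt_def ne.
have : `|2^-1 - b| <= coneA b q r.
  rewrite -(@ler_pXn2r _ 2)// ?nnegrE// real_normK ?num_real// E lerDl.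
  by have := sqr_ge0 q; have := sqr_ge0 r; lra.
by rewrite ler_norml => /andP[h1 h2]; split; lra.
Qed.

Lemma cone_bounds b q r K : 0 <= b <= 1 -> `|q| <= K -> `|r| <= K ->
  coneP b q r <= 2 * K + 1 /\ coneS b q r <= 2 * K + 1.
Proof.
move=> /andP[b0 b1] qK rK; have E := coneA_sqr b q r; have A0 := coneA_ge0 b q r.
have K0 : 0 <= K by exact: le_trans qK.
have A1 : coneA b q r <= 2 * K + 2^-1.
  rewrite -(@ler_pXn2r _ 2)// ?nnegrE//; last by lra.
  rewrite E.
  have q2 : q ^+ 2 <= K ^+ 2 by rewrite -[q ^+ 2]real_normK ?num_real// lerXn2r ?nnegrE.
  have r2 : r ^+ 2 <= K ^+ 2 by rewrite -[r ^+ 2]real_normK ?num_real// lerXn2r ?nnegrE.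
  nra.
by rewrite /coneP /coneS; case: eqP => _; split; lra.
Qed.

(** A^2 is Lipschitz in b, q^2 and r^2, and the lower bound c on one of the two values of A
    transfers this to A itself. The errors are measured on q^2 and r^2 because they are
    integrable. *)
Lemma cone_lip b q r b' q' r' p s c : 0 < c <= 1 -> 0 <= b <= 1 -> 0 <= b' <= 1 ->
  0 <= p <= 1 -> 0 <= s <= 1 -> c <= coneA b' q' r' ->
  p = coneA b' q' r' + (2^-1 - b') -> s = coneA b' q' r' - (2^-1 - b') ->
  `|coneP b q r - p| <= (c ^- 2 + 1) * (`|b - b'| + (`|q ^+ 2 - q' ^+ 2| + `|r ^+ 2 - r' ^+ 2|)) /\
  `|coneS b q r - s| <= (c ^- 2 + 1) * (`|b - b'| + (`|q ^+ 2 - q' ^+ 2| + `|r ^+ 2 - r' ^+ 2|)).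
Proof.
move=> /andP[c0 c1] /andP[b0 b1] /andP[b'0 b'1] /andP[p0 p1] /andP[s0 s1] cA pE sE.
set E := `|b - b'| + _.
have E2 := coneA_sqr b q r; have E2' := coneA_sqr b' q' r'.
have A0 := coneA_ge0 b q r.
have bb : `|b - b'| <= E by rewrite lerDl addr_ge0.
have E0 : 0 <= E by exact: le_trans bb.
have dA : `|coneA b q r ^+ 2 - coneA b' q' r' ^+ 2| <= E.
  rewrite E2 E2'.
  have -> : (2^-1 - b) ^+ 2 + (q ^+ 2 + r ^+ 2) / 2 - ((2^-1 - b') ^+ 2 + (q' ^+ 2 + r' ^+ 2) / 2) =
    (b - b') * (b + b' - 1) + ((q ^+ 2 - q' ^+ 2) / 2 + (r ^+ 2 - r' ^+ 2) / 2) by field.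
  apply: (le_trans (ler_normD _ _)); apply: lerD.
    by rewrite normrM ler_piMr// ler_norml; apply/andP; split; lra.
  apply: (le_trans (ler_normD _ _)); rewrite !normrM normfV (ger0_norm (_ : 0 <= 2))//.
  by have := normr_ge0 (q ^+ 2 - q' ^+ 2); have := normr_ge0 (r ^+ 2 - r' ^+ 2); lra.
have c2 : 1 <= c ^- 2 by rewrite invf_ge1 ?exprn_gt0// exprn_ile1// ltW.
have c20 : 0 < c ^+ 2 by rewrite exprn_gt0.
have EC : E <= c ^- 2 * E by rewrite ler_peMl.
(* At the vertex A^2 has moved by at least c^2, so c^-2 E >= 1 dominates the distance between any
   two numbers in [0, 1]. *)
have [A00|An0] := eqVneq (coneA b q r) 0.
  have : c ^+ 2 <= E.
    apply: le_trans dA; rewrite A00 expr0n/= sub0r normrN ger0_norm ?sqr_ge0//.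
    by rewrite lerXn2r ?nnegrE ?(ltW c0)// (le_trans (ltW c0)).
  rewrite -[c ^+ 2]mul1r -ler_pdivlMr// mulrC => h.
  by rewrite /coneP /coneS A00 eqxx !ler_norml; split; apply/andP; split; lra.
have dA' : `|coneA b q r - coneA b' q' r'| <= c ^- 2 * E.
  have sA : 0 < coneA b q r + coneA b' q' r' by rewrite ltr_wpDl// (lt_le_trans c0).
  move: dA; rewrite subr_sqr normrM (gtr0_norm sA) => dA.
  rewrite -(ler_pM2r sA); apply: (le_trans dA).
  rewrite -[leLHS]mul1r mulrAC ler_wpM2r// mulrC -ler_pdivrMr ?invr_gt0// invrK mul1r.
  apply: (@le_trans _ _ c); last by rewrite (le_trans cA)// lerDr.
  by rewrite expr2 ler_piMr// ltW.
by rewrite /coneP /coneS (negbTE An0) pE sE; move: bb dA';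
   rewrite !ler_norml => /andP[h1 h2] /andP[h3 h4]; split; apply/andP; split; lra.
Qed.

(* [s] is [H' - U^2 y' / 2], the variable dual to [p = y'] in the cone. *)
Lemma profile_cone p q r u K : 0 <= p <= 1 ->
  2 * p * (1 - p) = u ^+ 2 * p ^+ 2 + q ^+ 2 + r ^+ 2 -> `|u| <= K ->
  let s := (1 - p) - u ^+ 2 * p / 2 in let b := (1 - p + s) / 2 in
  [/\ 0 <= s <= 1 - p, 0 <= b <= 1 - p, (K ^+ 2 + 2)^-1 <= coneA b q r,
      p = coneA b q r + (2^-1 - b) & s = coneA b q r - (2^-1 - b)].
Proof.
move=> /andP[p0 p1] rel uK s b.
have u2 : u ^+ 2 <= K ^+ 2.
  by rewrite -[u ^+ 2]real_normK ?num_real// lerXn2r ?nnegrE// (le_trans _ uK).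
have K2 : 0 < K ^+ 2 + 2 by rewrite ltr_wpDl// sqr_ge0.
have u20 := sqr_ge0 u.
have up0 : 0 <= u ^+ 2 * p by rewrite mulr_ge0.
have ps : 2 * p * s = q ^+ 2 + r ^+ 2.
  have -> : 2 * p * s = 2 * p * (1 - p) - u ^+ 2 * p ^+ 2 by rewrite /s; field.
  by rewrite rel; ring.
have s0 : 0 <= s.
  have [pz|pn] := eqVneq p 0; first by rewrite /s pz; lra.
  have pp : 0 < p by rewrite lt_def pn.
  have : 0 <= 2 * p * s by rewrite ps addr_ge0 ?sqr_ge0.
  by rewrite pmulr_rge0// mulr_gt0.
have AE : coneA b q r = (p + s) / 2.
  rewrite /coneA -ps (_ : _ + _ = ((p + s) / 2) ^+ 2); last by rewrite /b; field.
  by rewrite sqrtr_sqr ger0_norm// divr_ge0// addr_ge0.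
have sle : s <= 1 - p by rewrite /s; lra.
split.
- by rewrite s0.
- by rewrite /b; apply/andP; split; lra.
(* From 1 = p + s + U^2 p / 2 follows 1 <= (p + s) (1 + K^2/2), that is, A (K^2 + 2) >= 1. *)
- rewrite AE -[leLHS]mul1r ler_pdivrMr//.
  have : 1 - p = s + u ^+ 2 * p / 2 by rewrite /s; ring.
  move=> h; have : u ^+ 2 * p <= K ^+ 2 * p by rewrite ler_wpM2r.
  have : 0 <= K ^+ 2 * s by rewrite mulr_ge0// sqr_ge0.
  have -> : (p + s) / 2 * (K ^+ 2 + 2) = (K ^+ 2 * p) / 2 + (K ^+ 2 * s) / 2 + p + s by field.
  by lra.
- by rewrite AE /b; field.
- by rewrite AE /b; field.
Qed.

End cone.

(** * Convergence of cell averages and choice of tails *)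

Section cell_averages.
Context {R : realType}.
Local Notation leb := (@lebesgue_measure R).
Implicit Types (f g : R -> R) (K L h : R).

Lemma cell_avg_bounds f h (m M : R) j : 0 < h -> locint f -> (forall x, m <= f x <= M) ->
  m <= cell_avg f h j <= M.
Proof.
move=> h0 fi fmM; rewrite cell_avg_itvcc//; set a := gridpt h j.
have ic (c : R) : locint (cst c) by exact/continuous_locint/cst_continuous.
have ah : a <= a + h by rewrite lerDl ltW.
have E (c : R) : c = h^-1 * \int[leb]_(x in `[a, a + h]) c.
  by rewrite Rintegral_itvcc_cst// addrAC subrr add0r mulrCA mulVf ?mulr1// gt_eqF.
have hV : 0 <= h^-1 by rewrite invr_ge0 ltW.
rewrite [in X in X && _](E m) [in X in _ && X](E M).
apply/andP; split; rewrite ler_wpM2l//.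
  by apply: (le_Rintegral_itvcc (ic m) fi) => x _; case/andP: (fmM x).
by apply: (le_Rintegral_itvcc fi (ic M)) => x _; case/andP: (fmM x).
Qed.

Lemma cell_avg_eq0 f h L j : 0 < h -> locint f -> (forall x, L <= `|x| -> f x = 0) ->
  L <= gridpt h j \/ gridpt h j + h <= - L -> cell_avg f h j = 0.
Proof.
move=> h0 fi f0 Lj; rewrite cell_avg_itvcc//.
have -> : \int[leb]_(x in `[gridpt h j, gridpt h j + h]) f x =
    \int[leb]_(x in `[gridpt h j, gridpt h j + h]) (cst 0 : R -> R) x.
  apply: eq_Rintegral => x; rewrite inE/= in_itv/= => /andP[h1 h2]; apply: f0.
  case: Lj => Lj; first by rewrite (le_trans (le_trans Lj h1))// ler_norm.
  by rewrite -normrN (le_trans _ (ler_norm _))// lerNr (le_trans h2).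
by rewrite /cst Rintegral_itvcc_cst ?mul0r ?mulr0// lerDl ltW.
Qed.

(** Dominated convergence on top of the almost everywhere convergence. Cells have length at most 1,
    so every average vanishes beyond |L| + 1 and K times an indicator dominates. *)
Lemma near_integral_cell_avg f K L eta : measurable_fun setT f ->
  (forall x, `|f x| <= K) -> (forall x, L <= `|x| -> f x = 0) -> 0 < eta ->
  \forall n \near \oo, integral_le
    (fun x => `|stepf n.+1%:R^-1 (cell_avg f n.+1%:R^-1) x - f x|) eta.
Proof.
move=> mf fK f0 eta0; have fi := locint_bounded mf fK.
have K0 : 0 <= K by exact: le_trans (fK 0).
pose h (n : nat) : R := n.+1%:R^-1.
have h0 n : 0 < h n by rewrite invr_gt0.
have h1 n : h n <= 1 by rewrite invf_le1// ler1n.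
pose F n := stepf (h n) (cell_avg f (h n)).
have mF n : measurable_fun setT (F n) by exact: stepf_measurable.
have FK n x : `|F n x| <= K.
  by rewrite ler_norml; apply: cell_avg_bounds => // z; rewrite -ler_norml.
have F0 n x : `|L| + 1 <= `|x| -> F n x = 0.
  move=> Lx; apply: (cell_avg_eq0 (L := L)) => //.
  have := cellnoP x (h0 n); rewrite gridptS => /andP[]; set k := gridpt _ _ => k1 k2.
  have := h1 n; have := h0 n; have := ler_norm L; move: Lx.
  by case: (ger0P x) => x0 *; [left|right]; lra.
have key := @dominated_convergence _ _ _ leb setT measurableT
  (fun n x => (F n x)%:E) (fun x => (f x)%:E) (fun x => (K * \1_(`[- (`|L| + 1), `|L| + 1]) x)%:E).
have [|||||_ + _] := key.
- by move=> n; apply/measurable_EFinP; exact: (mF n).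
- exact/measurable_EFinP.
- apply: leb_ae_mono (ae_cvg_cell_avg fi) => x cx _.
  by apply: cvg_EFin; [exact: nearW|exact: cx].
- have LL : - (`|L| + 1) <= `|L| + 1 by have := normr_ge0 L; lra.
  have [mg g0 gA] := integral_le_itv K0 LL.
  by apply: ge0_integrableT => //; apply: le_lt_trans gA _; rewrite ltry.
- apply: aeW => x n _; rewrite /= lee_fin indicE; case: (boolP (x \in _)) => [_|].
    by rewrite mulr1.
  move=> /negP xL; rewrite F0 ?normr0 ?mulr0//; rewrite leNgt; apply/negP => xL'; apply: xL.
  by rewrite inE/= in_itv/= -ler_norml ltW.
move=> /fine_cvgP[_ /cvgrPdist_lt/(_ _ eta0)].
have Ffin n : (\int[leb]_x `|F n x - f x|%:E < +oo)%E.
  have LL : - (`|L| + 1) <= `|L| + 1 by have := normr_ge0 L; lra.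
  have [mg g0 gA] := integral_le_itv (addr_ge0 K0 K0) LL.
  apply: le_lt_trans (le_lt_trans gA (ltry _)); apply: ge0_le_integral => //.
  - by apply/measurable_EFinP; apply: measurableT_comp => //; exact: (measurable_funB (mF n) mf).
  - exact/measurable_EFinP.
  - move=> x _; rewrite lee_fin indicE; case: (boolP (x \in _)) => [_|].
      by rewrite mulr1 (le_trans (ler_normB _ _))// lerD.
    move=> /negP xL; have Lx : `|L| + 1 <= `|x|.
      rewrite leNgt; apply/negP => xL'; apply: xL.
      by rewrite inE/= in_itv/= -ler_norml ltW.
    rewrite F0// f0 ?subrr ?normr0 ?mulr0//; have := ler_norm L; lra.
apply: filterS => n /=; rewrite sub0r normrN => H.
split => //.
  by apply: measurableT_comp => //; exact: (measurable_funB (mF n) mf).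
have -> : (\int[leb]_x `|stepf n.+1%:R^-1 (cell_avg f n.+1%:R^-1) x - f x|%:E)%E =
    (fine (\int[leb]_x `|F n x - f x|%:E)%E)%:E.
  rewrite fineK// ge0_fin_numE; first exact: Ffin.
  by apply: integral_ge0 => x _; rewrite lee_fin.
by rewrite lee_fin (le_trans (ler_norm _))// ltW.
Qed.

(** Otherwise f would be at least eta on [L, L + A/eta + 1], contributing A + eta, more than the
    whole integral A. *)
Lemma exists_small_right f L eta : measurable_fun setT f -> (forall x, 0 <= f x) ->
  (\int[leb]_x (f x)%:E < +oo)%E -> 0 < eta -> exists2 d, L <= d & f d <= eta.
Proof.
move=> mf f0 fi eta0; apply: contrapT => H.
have fe x : L <= x -> eta <= f x.
  by move=> Lx; rewrite leNgt; apply/negP => fx; apply: H; exists x => //; exact: ltW.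
pose A := \int[leb]_x f x; have A0 : 0 <= A by apply: Rintegral_ge0 => x _.
have LA : L <= L + (A / eta + 1) by rewrite lerDl addr_ge0// divr_ge0// ltW.
have ic : locint (cst eta) by exact/continuous_locint/cst_continuous.
have il := integrableT_locint (ge0_integrableT mf f0 fi).
have : eta * (L + (A / eta + 1) - L) <= A.
  rewrite -Rintegral_itvcc_cst//.
  apply: le_trans (Rintegral_itvcc_leT L (L + (A / eta + 1)) mf f0 fi).
  by apply: (le_Rintegral_itvcc ic il) => x /andP[/fe].
have -> : eta * (L + (A / eta + 1) - L) = A + eta by field; rewrite gt_eqF.
by lra.
Qed.

Lemma exists_small_left f L eta : measurable_fun setT f -> (forall x, 0 <= f x) ->
  (\int[leb]_x (f x)%:E < +oo)%E -> 0 < eta -> exists2 c, c <= L & f c <= eta.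
Proof.
move=> mf f0 fi eta0; apply: contrapT => H.
have fe x : x <= L -> eta <= f x.
  by move=> Lx; rewrite leNgt; apply/negP => fx; apply: H; exists x => //; exact: ltW.
pose A := \int[leb]_x f x; have A0 : 0 <= A by apply: Rintegral_ge0 => x _.
have LA : L - (A / eta + 1) <= L by rewrite gerBl addr_ge0// divr_ge0// ltW.
have ic : locint (cst eta) by exact/continuous_locint/cst_continuous.
have il := integrableT_locint (ge0_integrableT mf f0 fi).
have : eta * (L - (L - (A / eta + 1))) <= A.
  rewrite -Rintegral_itvcc_cst//.
  apply: le_trans (Rintegral_itvcc_leT (L - (A / eta + 1)) L mf f0 fi).
  by apply: (le_Rintegral_itvcc ic il) => x /andP[_ /fe].
have -> : eta * (L - (L - (A / eta + 1))) = A + eta by field; rewrite gt_eqF.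
by lra.
Qed.

Lemma exists_tail f eta : measurable_fun setT f -> (forall x, 0 <= f x) ->
  (\int[leb]_x (f x)%:E < +oo)%E -> 0 < eta ->
  exists n : nat, integral_le (f \_ (~` `[- n%:R, n%:R])) eta.
Proof.
move=> mf f0 fi eta0; pose F (n : nat) : set R := [set` `[- n%:R, n%:R]].
have mFn n : measurable (F n) by exact: measurable_itv.
have mfE (A : set R) : measurable_fun A (fun x => (f x)%:E).
  by apply/measurable_EFinP; exact: measurable_funTS.
have cv : (\int[leb]_(x in F n) (f x)%:E)%E @[n --> \oo] --> (\int[leb]_(x in \bigcup_n F n) (f x)%:E)%E.
  apply: ge0_nondecreasing_set_cvg_integral => //.
  - move=> m n mn; rewrite subsetEset /F; apply: subset_itv; rewrite bnd_simp.
      by rewrite lerN2 ler_nat.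
    by rewrite ler_nat.
  - by move=> n; exact: mfE.
  - by move=> n x _; rewrite lee_fin.
have FT : \bigcup_n F n = setT.
  apply/seteqP; split => // x _; exists (Num.bound `|x|) => //; rewrite /F /= in_itv/=.
  by have := archi_boundP (normr_ge0 x); rewrite ltr_norml => /andP[/ltW -> /ltW ->].
rewrite FT in cv; pose A := \int[leb]_x f x.
have AE : (\int[leb]_x (f x)%:E)%E = A%:E.
  by rewrite /A /Rintegral fineK//; apply: integrable_fin_num => //; exact: ge0_integrableT.
rewrite AE in cv; move/fine_cvgP : cv => [_ /cvgrPdist_lt/(_ _ eta0)[n _ /(_ n (leqnn _))/= Hn]].
exists n; split.
- apply/(measurable_restrictT _ _).1; first exact: measurableC.
  exact: measurable_funTS.
- by move=> x; rewrite patchE; case: ifP.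
have -> : (\int[leb]_x ((f \_ (~` `[- n%:R, n%:R])) x)%:E = \int[leb]_(x in ~` F n) (f x)%:E)%E.
  by rewrite [RHS]integral_mkcond restrict_EFin.
have : (\int[leb]_x (f x)%:E = \int[leb]_(x in F n) (f x)%:E + \int[leb]_(x in ~` F n) (f x)%:E)%E.
  rewrite -ge0_integral_setU//; first by rewrite setUv.
  - exact: mFn.
  - exact: measurableC (mFn n).
  - exact: mfE.
  - by move=> x _; rewrite lee_fin.
  - by apply/disj_set2P; rewrite setICr.
rewrite AE.
have if' : leb.-integrable setT (EFin \o f) by exact: ge0_integrableT.
have i1 : (\int[leb]_(x in F n) (f x)%:E)%E \is a fin_num.
  apply: integrable_fin_num; first exact: mFn.
  by apply: (integrableS _ _ _ if') => //; exact: mFn.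
have i2 : (\int[leb]_(x in ~` F n) (f x)%:E)%E \is a fin_num.
  apply: integrable_fin_num; first exact: measurableC (mFn n).
  by apply: (integrableS _ _ _ if') => //; exact: measurableC (mFn n).
rewrite -(fineK i1) -(fineK i2) -EFinD => -[E]; rewrite lee_fin.
by move: Hn; rewrite E addrAC subrr add0r => /ltW; apply: le_trans; exact: ler_norm.
Qed.

End cell_averages.

Section linear_approximation.
Context {R : realType}.
Local Notation leb := (@lebesgue_measure R).
Implicit Types (U b q r : R -> R).

Definition linf (h : R) (v : int -> R) (x : R) : R :=
  v (cellno h x) + (x - gridpt h (cellno h x)) * Dplus h v (cellno h x).

(** V is compared with U twice: as a step function, because (c) involves the values V j, and as a
    piecewise affine function, because that is the interpolation. *)
Record grid_approx U b q r (K eta h : R) (bn V rn : int -> R) (J : nat) : Prop := GridApprox {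
  ga_h : 0 < h <= eta;
  ga_b : forall j, 0 <= bn j <= 1;
  ga_q : forall j, `|Dplus h V j| <= K;
  ga_r : forall j, `|rn j| <= K;
  ga_V : forall j, `|V j| <= K;
  ga_0 : forall j, J%:Z <= j \/ j < - J%:Z ->
    [/\ bn j = 0, V j = 0, Dplus h V j = 0 & rn j = 0];
  ga_eb : integral_le (fun x => `|stepf h bn x - b x|) eta;
  ga_eq : integral_le (fun x => (stepf h (Dplus h V) x - q x) ^+ 2) eta;
  ga_er : integral_le (fun x => (stepf h rn x - r x) ^+ 2) eta;
  ga_eV : integral_le (fun x => (stepf h V x - U x) ^+ 2) eta;
  ga_eU : integral_le (fun x => (linf h V x - U x) ^+ 2) eta }.

Lemma clamp_l (a b x : R) : a <= b -> x <= a -> clamp a b x = a.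
Proof. by move=> ab xa; rewrite /clamp (min_l (le_trans xa ab)) max_l. Qed.

Lemma clamp_m (a b x : R) : a <= x -> x <= b -> clamp a b x = x.
Proof. by move=> ax xb; rewrite /clamp (min_l xb) max_r. Qed.

Lemma clamp_r (a b x : R) : a <= b -> b <= x -> clamp a b x = b.
Proof. by move=> ab bx; rewrite /clamp (min_r bx) max_r. Qed.

(* [U] on [c, d], continued affinely to 0 on [c - 1, c] and on [d, d + 1]. *)
Definition cutoff U (c d x : R) : R :=
  U (clamp c d x) + U c * (clamp (c - 1) c x - c) - U d * (clamp d (d + 1) x - d).

Definition cutoff' U q (c d x : R) : R :=
  (q \_ `[c, d]) x + (cst (U c) \_ `[c - 1, c]) x + (cst (- U d) \_ `[d, d + 1]) x.

Lemma locint_patch (f : R -> R) (a b : R) : locint f -> locint (f \_ `[a, b]).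
Proof.
move=> [mf fi]; have m : measurable_fun setT (f \_ `[a, b]).
  apply/(measurable_restrictT _ _).1; first exact: measurable_itv.
  exact: measurable_funTS.
split => // s t; apply: (le_integrable _ _ _ (fi s t)) => //.
  by apply/measurable_EFinP; exact: measurable_funTS.
by move=> x _; rewrite /= lee_fin patchE; case: ifP => // _; rewrite normr0.
Qed.

Lemma cutoff_primitive U q (c d : R) : c <= d -> locint q -> primitive U q ->
  primitive (cutoff U c d) (cutoff' U q c d).
Proof.
move=> cd qi Uq.
have ic (k : R) : locint (cst k) by exact/continuous_locint/cst_continuous.
have c1 : c - 1 <= c by lra.
have d1 : d <= d + 1 by lra.
have p1 := primitive_clamp cd qi Uq.
have p2 := primitive_clamp c1 (ic (U c)) (primitive_shift (- (U c * c)) (primitive_cst (U c))).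
have p3 := primitive_clamp d1 (ic (- U d)) (primitive_shift (U d * d) (primitive_cst (- U d))).
have := primitiveD (locintD (locint_patch _ _ qi) (locint_patch _ _ (ic _))) (locint_patch _ _ (ic _))
  (primitiveD (locint_patch _ _ qi) (locint_patch _ _ (ic _)) p1 p2) p3.
congr primitive; apply/funext => x; rewrite /cutoff; ring.
Qed.

Lemma cutoff_cases U (c d x : R) : c <= d ->
  [\/ c <= x <= d /\ cutoff U c d x = U x,
      c - 1 <= x <= c /\ `|cutoff U c d x| <= `|U c|,
      d <= x <= d + 1 /\ `|cutoff U c d x| <= `|U d| |
      (x <= c - 1 \/ d + 1 <= x) /\ cutoff U c d x = 0].
Proof.
move=> cd; rewrite /cutoff.
have c1 : c - 1 <= c by lra.
have d1 : d <= d + 1 by lra.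
have [xc1|/ltW c1x] := leP x (c - 1).
  constructor 4; split; first by left.
  by rewrite !clamp_l//; [ring|lra|lra].
have [xc|/ltW cx] := leP x c.
  constructor 2; split; first by rewrite c1x.
  rewrite (clamp_l cd)// (clamp_m c1x)// (clamp_l d1); last by lra.
  rewrite subrr mulr0 subr0 -[X in X + _]mulr1 -mulrDr normrM ler_piMr// ler_norml.
  by apply/andP; split; lra.
have [xd|/ltW dx] := leP x d.
  constructor 1; split; first by rewrite cx.
  rewrite (clamp_m cx)// (clamp_r c1)// (clamp_l d1)//; ring.
have [xd1|/ltW d1x] := leP x (d + 1).
  constructor 3; split; first by rewrite dx.
  rewrite (clamp_r cd)// (clamp_r c1)// (clamp_m dx)//.
  rewrite subrr mulr0 addr0 -[X in X - _]mulr1 -mulrBr normrM ler_piMr// ler_norml.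
  by apply/andP; split; lra.
constructor 4; split; first by right.
by rewrite (clamp_r cd)// (clamp_r c1)// (clamp_r d1)//; ring.
Qed.

Lemma cutoff'_bound U q (c d K Q x : R) : 0 <= Q ->
  (forall x, `|q x| <= Q) -> (forall x, `|U x| <= K) ->
  `|cutoff' U q c d x| <= Q + 2 * K.
Proof.
move=> Q0 qQ UK; have K0 : 0 <= K by exact: le_trans (UK 0).
have p (f : R -> R) (A : set R) (M : R) : 0 <= M -> (forall x, `|f x| <= M) -> `|(f \_ A) x| <= M.
  by move=> M0 fM; rewrite patchE; case: ifP => // _; rewrite normr0.
rewrite /cutoff' (_ : Q + 2 * K = Q + K + K); last by ring.
apply: (le_trans (ler_normD _ _)); apply: lerD.
  by apply: (le_trans (ler_normD _ _)); apply: lerD; apply: p => // z; exact: UK.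
by apply: p => // z; rewrite /cst normrN.
Qed.

Lemma cutoff'_eq0 U q (c d x : R) : c <= d -> x < c - 1 \/ d + 1 < x ->
  cutoff' U q c d x = 0.
Proof.
move=> cd cx; rewrite /cutoff' !patchE !memNset ?addr0//= in_itv/= => /andP[h1 h2];
  by case: cx => cx; lra.
Qed.

Lemma cutoff'_sub_sqr U q (c d x : R) : c <= d ->
  (cutoff' U q c d x - q x) ^+ 2 <=
    3 * (((fun x => q x ^+ 2) \_ (~` `[c, d])) x +
      (U c ^+ 2 * \1_(`[c - 1, c]) x + U d ^+ 2 * \1_(`[d, d + 1]) x)).
Proof.
move=> cd; rewrite /cutoff' !indicE !patchE in_setC.
set B := x \in _; set C := x \in _; set D := x \in _.
have key (a1 a2 a3 : R) : (a1 + a2 + a3) ^+ 2 <= 3 * (a1 ^+ 2 + (a2 ^+ 2 + a3 ^+ 2)).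
  have := sqr_ge0 (a1 - a2); have := sqr_ge0 (a2 - a3); have := sqr_ge0 (a1 - a3).
  by lra.
have := key (if B then 0 else - q x) (if C then U c else 0) (if D then - U d else 0).
have -> : (point : R) = 0 by [].
by rewrite /cst; case: B; case: C; case: D; rewrite /= ?mulr1n ?mulr0n; lra.
Qed.

End linear_approximation.

(** * Grid approximation of the cone parameters *)

Section grid_approximation.
Context {R : realType}.
Local Notation leb := (@lebesgue_measure R).
Implicit Types U b q r : R -> R.

Lemma linf_measurable (h : R) v : 0 < h -> measurable_fun [set: R] (linf h v).
Proof.
move=> h0; apply: measurable_funD; first exact: stepf_measurable.
apply: measurable_funM; last exact: (stepf_measurable (Dplus h v)).
by apply: measurable_funB => //; exact: (stepf_measurable (gridpt h)).
Qed.

Lemma integral_le_sqr_add (f g m : R -> R) A B : measurable_fun setT f -> measurable_fun setT g ->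
  integral_le (fun x => (f x - m x) ^+ 2) A -> integral_le (fun x => (m x - g x) ^+ 2) B ->
  integral_le (fun x => (f x - g x) ^+ 2) (2 * A + 2 * B).
Proof.
move=> mf mg fA gB; have := integral_leD (integral_leZ (ler0n _ 2) fA) (integral_leZ (ler0n _ 2) gB).
move=> H; apply: integral_le_mono H _ _ _.
- by apply: measurable_funX; exact: measurable_funB.
- by move=> x; exact: sqr_ge0.
- by move=> x; have := sqr_ge0 ((f x - m x) - (m x - g x)); lra.
Qed.

Lemma integral_le_sqr_norm (f g : R -> R) A K : measurable_fun setT f -> measurable_fun setT g ->
  0 <= K -> (forall x, `|f x| <= K) -> (forall x, `|g x| <= K) ->
  integral_le (fun x => `|f x - g x|) A ->
  integral_le (fun x => (f x - g x) ^+ 2) (2 * K * A).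
Proof.
move=> mf mg K0 fK gK fA; have := integral_leZ (mulr_ge0 (ler0n _ 2) K0) fA.
move=> H; apply: integral_le_mono H _ _ _.
- by apply: measurable_funX; exact: measurable_funB.
- by move=> x; exact: sqr_ge0.
- move=> x; rewrite -[leLHS]real_normK ?num_real// expr2 ler_wpM2r//.
  by apply: (le_trans (ler_normB _ _)); have := fK x; have := gK x; lra.
Qed.

Lemma outside_support (c d x : R) : `|c| + `|d| + 2 <= `|x| -> x < c - 1 \/ d + 1 < x.
Proof.
have c2 := ler_norm (- c); rewrite normrN in c2.
have d2 := ler_norm d; have c0 := normr_ge0 c; have d0 := normr_ge0 d.
by case: (ger0P x) => x0 h; [right|left]; lra.
Qed.

Lemma far_cell (h L x : R) : 0 < h -> h <= 1 -> L + 1 <= `|x| ->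
  L <= gridpt h (cellno h x) \/ gridpt h (cellno h x) + h <= - L.
Proof.
move=> h0 h1; have := cellnoP x h0; rewrite gridptS => /andP[].
by set k := gridpt _ _ => k1 k2; case: (ger0P x) => x0 *; [left|right]; lra.
Qed.

Lemma far_norm (h L z : R) : 0 < h -> L <= z \/ z + h <= - L -> L <= `|z|.
Proof.
move=> h0 [hz|hz]; first by rewrite (le_trans hz)// ler_norm.
by rewrite -normrN (le_trans _ (ler_norm _))//; lra.
Qed.

Lemma cutoff_eq0 U (c d x : R) : c <= d -> `|c| + `|d| + 2 <= `|x| -> cutoff U c d x = 0.
Proof.
move=> cd /outside_support hx.
by case: (cutoff_cases U x cd) => [] [] // /andP[h1 h2]; exfalso; case: hx => hx; lra.
Qed.

(** A tail bound for the sum of the four functions serves all of them. The ends c and d are then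
    moved further out to points where U^2 is small, so that the affine closing of U is cheap. *)
Lemma exists_cut b q r U eta : measurable_fun setT b -> measurable_fun setT q ->
  measurable_fun setT r -> measurable_fun setT U -> (forall x, 0 <= b x) ->
  (\int[leb]_x (b x)%:E < +oo)%E -> (\int[leb]_x (q x ^+ 2)%:E < +oo)%E ->
  (\int[leb]_x (r x ^+ 2)%:E < +oo)%E -> (\int[leb]_x (U x ^+ 2)%:E < +oo)%E ->
  0 < eta -> exists c d, [/\ c <= d, U c ^+ 2 <= eta, U d ^+ 2 <= eta,
    integral_le (b \_ (~` `[c, d])) eta & [/\
    integral_le ((fun x => q x ^+ 2) \_ (~` `[c, d])) eta,
    integral_le ((fun x => r x ^+ 2) \_ (~` `[c, d])) eta &
    integral_le ((fun x => U x ^+ 2) \_ (~` `[c, d])) eta]].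
Proof.
move=> mb mq mr mU b0 bi q2 r2 U2 e0.
pose F x := b x + (q x ^+ 2 + (r x ^+ 2 + U x ^+ 2)).
have sq (f : R -> R) x : 0 <= f x ^+ 2 by exact: sqr_ge0.
have F0 x : 0 <= F x by rewrite !addr_ge0.
have m2 (f : R -> R) : measurable_fun setT f -> measurable_fun setT (fun x => f x ^+ 2).
  by move=> mf; exact: measurable_funX.
have mF : measurable_fun setT F.
  by apply: measurable_funD => //; apply: measurable_funD; [exact: m2|apply: measurable_funD; exact: m2].
have Ffin : (\int[leb]_x (F x)%:E < +oo)%E.
  have [A1 _ iA1] := integral_le_of_fin mb b0 bi.
  have [A2 _ iA2] := integral_le_of_fin (m2 _ mq) (sq q) q2.
  have [A3 _ iA3] := integral_le_of_fin (m2 _ mr) (sq r) r2.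
  have [A4 _ iA4] := integral_le_of_fin (m2 _ mU) (sq U) U2.
  have [_ _ H] := integral_leD iA1 (integral_leD iA2 (integral_leD iA3 iA4)).
  by apply: le_lt_trans H _; rewrite ltry.
have [n tn] := exists_tail mF F0 Ffin e0.
have [c cn Uc] := exists_small_left (- n%:R) (m2 _ mU) (sq U) U2 e0.
have [d nd Ud] := exists_small_right n%:R (m2 _ mU) (sq U) U2 e0.
have n0 : 0 <= n%:R :> R by [].
have cd : c <= d by lra.
have T (f : R -> R) : measurable_fun setT f -> (forall x, 0 <= f x) -> (forall x, f x <= F x) ->
    integral_le (f \_ (~` `[c, d])) eta.
  move=> mf f0 fF; apply: integral_le_mono tn _ _ _.
  - apply/(measurable_restrictT _ _).1; last exact: measurable_funTS.
    by apply: measurableC; exact: measurable_itv.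
  - by move=> x; rewrite patchE; case: ifP.
  - move=> x; rewrite !patchE; case: ifPn => [|_]; last by case: ifP.
    rewrite inE/= in_itv/= => /negP H; rewrite mem_set//= in_itv/=; apply/negP.
    apply: contra H => /andP[h1 h2]; rewrite (le_trans cn h1).
    exact: le_trans h2 nd.
exists c, d; split => //.
  by apply: T => // x; rewrite /F lerDl !addr_ge0.
split; apply: T => //; try exact: m2.
- by move=> x; rewrite /F; have := b0 x; have := sq r x; have := sq U x; lra.
- by move=> x; rewrite /F; have := b0 x; have := sq q x; have := sq U x; lra.
- by move=> x; rewrite /F; have := b0 x; have := sq q x; have := sq r x; lra.
Qed.

Lemma cutoff_sub_sqr U (c d x : R) : c <= d ->
  (cutoff U c d x - U x) ^+ 2 <=
    2 * (((fun x => U x ^+ 2) \_ (~` `[c, d])) x +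
      (U c ^+ 2 * \1_(`[c - 1, c]) x + U d ^+ 2 * \1_(`[d, d + 1]) x)).
Proof.
move=> cd; rewrite patchE !indicE in_setC.
have u3 := sqr_ge0 (U x).
have i1 : 0 <= U c ^+ 2 * (x \in `[c - 1, c]%classic)%:R by rewrite mulr_ge0// sqr_ge0.
have i2 : 0 <= U d ^+ 2 * (x \in `[d, d + 1]%classic)%:R by rewrite mulr_ge0// sqr_ge0.
have sqn (w z : R) : `|w| <= `|z| -> w ^+ 2 <= z ^+ 2.
  by move=> wz; rewrite -[w ^+ 2]real_normK ?num_real// -[z ^+ 2]real_normK ?num_real// lerXn2r ?nnegrE.
case: ifPn => [xcd|/negPn/set_mem]; last first.
  rewrite /= in_itv/= => /andP[cx xd]; have -> : (point : R) = 0 by [].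
  have -> : cutoff U c d x = U x.
    rewrite /cutoff (clamp_m cx xd) (clamp_r _ cx); last by lra.
    by rewrite (clamp_l _ xd); [ring|lra].
  by rewrite subrr expr0n/=; lra.
have s2 := sqr_ge0 (cutoff U c d x + U x).
have out : ~ (c <= x <= d).
  by move=> h; move: xcd; rewrite mem_set.
case: (cutoff_cases U x cd) => -[hx h2] //.
- have e1 : (x \in `[c - 1, c]%classic) = true by rewrite mem_set//= in_itv.
  by move: i1; rewrite e1 mulr1; have := sqn _ _ h2; lra.
- have e1 : (x \in `[d, d + 1]%classic) = true by rewrite mem_set//= in_itv.
  by move: i2; rewrite e1 mulr1; have := sqn _ _ h2; lra.
- by rewrite h2 sub0r sqrrN; lra.
Qed.

Lemma cutoff_bound U (c d x K : R) : c <= d -> (forall x, `|U x| <= K) -> `|cutoff U c d x| <= K.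
Proof.
move=> cd UK; case: (cutoff_cases U x cd) => -[_ h2].
- by rewrite h2.
- exact: le_trans h2 (UK c).
- exact: le_trans h2 (UK d).
- by rewrite h2 normr0 (le_trans _ (UK 0)).
Qed.

Lemma integral_le_compact (f : R -> R) (L M A : R) : 0 <= L -> measurable_fun setT f ->
  (forall x, `|f x| <= M) -> (forall x, L <= `|x| -> f x = 0) ->
  M ^+ 2 * (2 * L) <= A -> integral_le (fun x => f x ^+ 2) A.
Proof.
move=> L0 mf fM f0 MA; have LL : - L <= L by lra.
have H := integral_le_itv (sqr_ge0 M) LL.
have {}H : integral_le (fun x => M ^+ 2 * \1_(`[- L, L]) x) A.
  by apply: integral_le_weaken H; rewrite opprK -mulr2n -mulr_natl.
apply: integral_le_mono H _ _ _.
- exact: measurable_funX.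
- by move=> x; exact: sqr_ge0.
- move=> x; rewrite indicE; case: (boolP (x \in _)) => [_|].
    by rewrite mulr1 -[f x ^+ 2]real_normK ?num_real// lerXn2r ?nnegrE// (le_trans _ (fM x)).
  move=> /negP xL; rewrite f0 ?expr0n/= ?mulr0//; rewrite leNgt; apply/negP => xL'; apply: xL.
  by rewrite inE/= in_itv/= -ler_norml ltW.
Qed.

(** The bound 3 K comes from the slope of the truncated U: at most 1 from q and at most K from each
    affine end, and 1 <= K. *)
Lemma grid_approx_exists U b q r K : measurable_fun setT b -> measurable_fun setT q ->
  measurable_fun setT r -> (forall x, 0 <= b x <= 1) -> (forall x, `|q x| <= 1) ->
  (forall x, `|r x| <= 1) -> primitive U q -> (forall x, `|U x| <= K) -> 1 <= K ->
  (\int[leb]_x (b x)%:E < +oo)%E -> (\int[leb]_x (q x ^+ 2)%:E < +oo)%E ->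
  (\int[leb]_x (r x ^+ 2)%:E < +oo)%E -> (\int[leb]_x (U x ^+ 2)%:E < +oo)%E ->
  forall eta, 0 < eta -> exists h bn V rn J, grid_approx U b q r (3 * K) eta h bn V rn J.
Proof.
move=> mb mq mr b01 q1 r1 Uq UK K1 bi q2 r2 U2 eta eta0.
have K0 : 0 < K by exact: lt_le_trans ltr01 K1.
have K3 : 0 <= 3 * K by rewrite mulr_ge0// ltW.
have K13 : 1 <= 3 * K by lra.
have KK3 : K <= 3 * K by lra.
have qi : locint q := locint_bounded mq q1.
have b0 x : 0 <= b x by case/andP: (b01 x).
have bi' : locint b.
  by apply: (locint_bounded mb (C := 1)) => x; rewrite ger0_norm//; case/andP: (b01 x).
have ri : locint r := locint_bounded mr r1.
have mU : measurable_fun setT U.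
  by apply: continuous_measurable_fun; apply: lip_continuous (primitive_lip qi Uq q1).
(* The costliest error, that of the slope q, adds up to 12 K e + 18 e <= 30 K e. *)
pose e := eta / (30 * K).
have K30 : 0 < 30 * K by rewrite mulr_gt0.
have e0 : 0 < e by rewrite divr_gt0.
have eK (k : R) : k <= 30 -> k * (K * e) <= eta.
  move=> k30; have -> : eta = 30 * (K * e) by rewrite /e; field; rewrite gt_eqF.
  by rewrite ler_wpM2r// mulr_ge0// ltW.
have Ke : e <= K * e by rewrite ler_peMl// ltW.
have [c [d [cd Uc Ud Tb [Tq Tr TU]]]] := exists_cut mb mq mr mU b0 bi q2 r2 U2 e0.
have pm (f : R -> R) : measurable_fun setT f -> measurable_fun setT (f \_ `[c, d]).
  by move=> mf; apply/(measurable_restrictT _ _).1; [exact: measurable_itv|exact: measurable_funTS].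
have c1 : c - 1 <= c by rewrite gerBl.
have d1 : d <= d + 1 by rewrite lerDl.
have Ic : integral_le (fun x => U c ^+ 2 * \1_(`[c - 1, c]) x) e.
  apply: integral_le_weaken (integral_le_itv (sqr_ge0 (U c)) c1).
  by rewrite opprB addrC subrK mulr1.
have Id : integral_le (fun x => U d ^+ 2 * \1_(`[d, d + 1]) x) e.
  apply: integral_le_weaken (integral_le_itv (sqr_ge0 (U d)) d1).
  by rewrite addrAC subrr add0r mulr1.
pose L := `|c| + `|d| + 2.
have L00 : 0 <= L by rewrite !addr_ge0.
have L0 : 0 < L + 1 by rewrite ltr_wpDl.
pose bL := b \_ `[c, d]; pose rL := r \_ `[c, d]; pose qL := cutoff' U q c d.
have pL (f : R -> R) x : L <= `|x| -> (f \_ `[c, d]) x = 0.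
  move=> /outside_support cx; rewrite patchE memNset//= in_itv/= => /andP[h1 h2].
  case: cx => cx.
    by have := lt_le_trans cx (le_trans c1 h1); rewrite ltxx.
  by have := le_lt_trans (le_trans h2 d1) cx; rewrite ltxx.
have qL0 x : L <= `|x| -> qL x = 0 by move=> /outside_support; exact: cutoff'_eq0.
have qLi : locint qL.
  have ic (k : R) : locint (cst k) by exact/continuous_locint/cst_continuous.
  by apply: locintD; [apply: locintD|]; exact: locint_patch.
have mqL : measurable_fun setT qL by case: qLi.
have qLK x : `|qL x| <= 3 * K.
  apply: (le_trans (cutoff'_bound c d x ler01 q1 UK)).
  by move: K1; clear; lra.
have bL01 x : 0 <= bL x <= 1.
  by rewrite /bL patchE; case: ifP => // _; have -> : (point : R) = 0 by []; rewrite lexx ler01.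
have bL1 x : `|bL x| <= 1 by rewrite ger0_norm; case/andP: (bL01 x).
have rL1 x : `|rL x| <= 1 by rewrite /rL patchE; case: ifP => // _; rewrite normr0.
have mbL : measurable_fun setT bL by exact: pm.
have mrL : measurable_fun setT rL by exact: pm.
(* Pointwise errors of V are at most 6 K h on a segment of length 2 (L + 1); their squares integrate
   to at most 72 K^2 (L + 1) h^2, hence to at most e when h < t and h <= 1. *)
pose t := Num.min e (e / (72 * K ^+ 2 * (L + 1))).
have KL : 0 < 72 * K ^+ 2 * (L + 1) by rewrite !mulr_gt0// exprn_gt0.
have t0 : 0 < t by rewrite lt_min e0/= divr_gt0.
have Hb := near_integral_cell_avg mbL bL1 (pL b) e0.
have Hr := near_integral_cell_avg mrL rL1 (pL r) e0.
have Hq := near_integral_cell_avg mqL qLK qL0 e0.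
have Ht := near_invS_lt t0.
have [N _ /(_ N (leqnn _))/= [{}Hb {}Hr {}Hq {}Ht]] : \forall n \near \oo, [/\
    integral_le (fun x => `|stepf n.+1%:R^-1 (cell_avg bL n.+1%:R^-1) x - bL x|) e,
    integral_le (fun x => `|stepf n.+1%:R^-1 (cell_avg rL n.+1%:R^-1) x - rL x|) e,
    integral_le (fun x => `|stepf n.+1%:R^-1 (cell_avg qL n.+1%:R^-1) x - qL x|) e &
    n.+1%:R^-1 < t] by near=> n'; split; near: n'.
have h0 : 0 < N.+1%:R^-1 :> R by rewrite invr_gt0.
have h1 : N.+1%:R^-1 <= 1 :> R by rewrite invf_le1// ler1n.
move: (N.+1%:R^-1 : R) h0 h1 Hb Hr Hq Ht => h h0 h1 Hb Hr Hq; rewrite lt_min => /andP[he ht].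
have hK : (6 * K * h) ^+ 2 * (2 * (L + 1)) <= e.
  have -> : (6 * K * h) ^+ 2 * (2 * (L + 1)) = 72 * K ^+ 2 * (L + 1) * h * h by ring.
  apply: (@le_trans _ _ (72 * K ^+ 2 * (L + 1) * h * 1)).
    by rewrite ler_wpM2l// ltW// mulr_gt0.
  by rewrite mulr1 mulrC -ler_pdivlMr// ltW.
have Vq : primitive (cutoff U c d) qL by exact: cutoff_primitive.
have Vl := primitive_lip qLi Vq qLK.
pose V (j : int) := cutoff U c d (gridpt h j).
have DV j : Dplus h V j = cell_avg qL h j.
  by rewrite cell_avg_itvcc// -Vq ?lerDl ?(ltW h0)// /Dplus /V gridptS mulrC.
have bi1 : locint bL := locint_patch _ _ bi'.
have ri1 : locint rL := locint_patch _ _ ri.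
have V0 (x : R) : L <= `|x| -> cutoff U c d x = 0 by exact: cutoff_eq0.
have VK (x : R) : `|cutoff U c d x| <= 3 * K by apply: le_trans KK3; exact: cutoff_bound.
have avgK (f : R -> R) M j : locint f -> (forall x, `|f x| <= M) -> `|cell_avg f h j| <= M.
  by move=> fi fM; rewrite ler_norml; apply: cell_avg_bounds => // x; rewrite -ler_norml.
have L1L (x : R) : L + 1 <= `|x| -> L <= `|x| by apply: le_trans; rewrite lerDl.
have mcut : measurable_fun setT (cutoff U c d).
  by apply: continuous_measurable_fun; apply: lip_continuous Vl.
have eVU : integral_le (fun x => (cutoff U c d x - U x) ^+ 2) (2 * (e + (e + e))).
  have H := integral_leZ (ler0n _ 2) (integral_leD TU (integral_leD Ic Id)).
  apply: integral_le_mono H _ _ _.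
  - by apply: measurable_funX; exact: measurable_funB.
  - by move=> x; exact: sqr_ge0.
  - by move=> x; exact: cutoff_sub_sqr.
have cellh x : 0 <= x - gridpt h (cellno h x) <= h.
  have := cellnoP x h0; rewrite gridptS; clear => /andP[k1 k2].
  by apply/andP; split; lra.
have stepV x : `|stepf h V x - cutoff U c d x| <= 3 * K * h.
  apply: (le_trans (Vl _ _)); rewrite ler_wpM2l// distrC.
  by have /andP[k1 k2] := cellh x; rewrite ger0_norm.
(* With J h >= L + 1, the cells with index outside [-J, J[ miss the supports. *)
exists h, (cell_avg bL h), V, (cell_avg rL h), (Num.bound ((L + 1) / h)).
split.
- by rewrite h0/= (le_trans (ltW he))// (le_trans Ke)// -[leLHS]mul1r eK//; clear; lra.
- by move=> j; exact: cell_avg_bounds.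
- by move=> j; rewrite DV; exact: avgK.
- by move=> j; apply: le_trans K13; exact: avgK.
- by move=> j; exact: VK.
- set J := Num.bound _ => j hj.
  have JL : L + 1 <= J%:R * h.
    rewrite -ler_pdivrMr//; apply: ltW; apply: archi_boundP.
    by rewrite divr_ge0// ltW.
  have far : L <= gridpt h j \/ gridpt h j + h <= - L.
    case: hj => hj; [left|right].
      have : J%:R * h <= gridpt h j.
        by rewrite /gridpt ler_wpM2r ?(ltW h0)// -[J%:R]/(J%:Z%:~R) ler_int.
      by move: JL; clear; lra.
    have : gridpt h (j + 1) <= (- J%:Z)%:~R * h.
      by rewrite /gridpt ler_wpM2r ?(ltW h0)// ler_int; move: hj; clear; lia.
    by rewrite gridptS mulrNz mulNr; move: JL; rewrite -[J%:Z%:~R]/(J%:R); clear; lra.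
  split.
  + exact: (cell_avg_eq0 h0 bi1 (pL b) far).
  + by apply: V0; exact: far_norm far.
  + by rewrite DV (cell_avg_eq0 h0 qLi qL0 far).
  + exact: (cell_avg_eq0 h0 ri1 (pL r) far).
- have H := integral_leD Hb Tb.
  apply: integral_le_mono (integral_le_weaken _ H) _ _ _.
  + have /(_ 2) := eK; move=> /(_ ltac:(by lra)); move: Ke; clear; lra.
  + apply: measurableT_comp => //; apply: measurable_funB => //; exact: stepf_measurable.
  + by [].
  + move=> x; rewrite /bL !patchE in_setC; have -> : (point : R) = 0 by [].
    case: ifPn => /= _; first by rewrite addr0.
    by rewrite subr0 (le_trans (ler_normB _ _))// lerD2l ger0_norm.
- have msq : measurable_fun setT (stepf h (Dplus h V)) by exact: stepf_measurable.
  have H1 : integral_le (fun x => (stepf h (Dplus h V) x - qL x) ^+ 2) (2 * (3 * K) * e).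
    apply: integral_le_sqr_norm => //.
      by move=> x; rewrite /stepf DV; exact: avgK.
    by have -> : Dplus h V = cell_avg qL h by apply/funext.
  have H2 : integral_le (fun x => (qL x - q x) ^+ 2) (3 * (e + (e + e))).
    have H := integral_leZ (ler0n _ 3) (integral_leD Tq (integral_leD Ic Id)).
    apply: integral_le_mono H _ _ _.
    + by apply: measurable_funX; exact: measurable_funB.
    + by move=> x; exact: sqr_ge0.
    + by move=> x; exact: cutoff'_sub_sqr.
  apply: integral_le_weaken (integral_le_sqr_add msq mq H1 H2).
  by have /(_ 30) := eK; move=> /(_ (lexx _)); move: Ke; clear; lra.
- have msr : measurable_fun setT (stepf h (cell_avg rL h)) by exact: stepf_measurable.
  have H1 : integral_le (fun x => (stepf h (cell_avg rL h) x - rL x) ^+ 2) (2 * 1 * e).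
    apply: integral_le_sqr_norm => //.
    by move=> x; exact: avgK.
  have H2 : integral_le (fun x => (rL x - r x) ^+ 2) e.
    apply: integral_le_mono Tr _ _ _.
    + by apply: measurable_funX; exact: measurable_funB.
    + by move=> x; exact: sqr_ge0.
    + move=> x; rewrite /rL !patchE in_setC; have -> : (point : R) = 0 by [].
      case: ifPn => /= _; first by rewrite subrr expr0n.
      by rewrite sub0r sqrrN.
  apply: integral_le_weaken (integral_le_sqr_add msr mr H1 H2).
  by have /(_ 30) := eK; move=> /(_ (lexx _)); move: Ke e0; clear; lra.
- have msV : measurable_fun setT (stepf h V) by exact: stepf_measurable.
  have H1 : integral_le (fun x => (stepf h V x - cutoff U c d x) ^+ 2) e.
    apply: integral_le_compact hK; rewrite ?(ltW L0)//; first exact: measurable_funB.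
      move=> x; apply: (le_trans (stepV x)); rewrite ler_wpM2r ?(ltW h0)//.
      by move: K0; clear; lra.
    move=> x xL; rewrite /stepf /V !V0 ?subrr//; first exact: L1L.
    by apply: far_norm (far_cell _ _ xL).
  apply: integral_le_weaken (integral_le_sqr_add msV mU H1 eVU).
  by have /(_ 30) := eK; move=> /(_ (lexx _)); move: Ke e0; clear; lra.
- have msV : measurable_fun setT (linf h V) by exact: linf_measurable.
  have H1 : integral_le (fun x => (linf h V x - cutoff U c d x) ^+ 2) e.
    apply: integral_le_compact hK; rewrite ?(ltW L0)//; first exact: measurable_funB.
      move=> x; rewrite /linf addrAC; apply: (le_trans (ler_normD _ _)).
      have /andP[k1 k2] := cellh x.
      have : `|(x - gridpt h (cellno h x)) * Dplus h V (cellno h x)| <= h * (3 * K).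
        rewrite normrM; apply: ler_pM => //; first by rewrite ger0_norm.
        by rewrite DV; exact: avgK.
      by have := stepV x; rewrite /stepf; clear; lra.
    move=> x xL; have fx := far_cell h0 h1 xL.
    rewrite /linf DV (cell_avg_eq0 h0 qLi qL0 fx) mulr0 addr0.
    rewrite /V !V0 ?subrr//; first exact: L1L.
    exact: far_norm fx.
  apply: integral_le_weaken (integral_le_sqr_add msV mU H1 eVU).
  by have /(_ 30) := eK; move=> /(_ (lexx _)); move: Ke e0; clear; lra.
Unshelve. all: by end_near. Qed.

End grid_approximation.

(** * Grid profiles satisfying identity (c) exactly *)

Section profile_approximation.
Context {R : realType}.
Local Notation leb := (@lebesgue_measure R).
Implicit Types U p q r : R -> R.

(** Pn and Qn are the future D+y and D+H. Their L^1 errors will bound the primitives in sup norm,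
    their L^2 errors the derivatives. *)
Record profile_approx U p q r (eps h C : R) (V rn Pn Qn : int -> R) (J : nat) : Prop := ProfileApprox {
  pa_h : 0 < h <= eps;
  pa_rel : forall j, 2 * Pn j * Qn j = V j ^+ 2 * Pn j ^+ 2 + Dplus h V j ^+ 2 + rn j ^+ 2;
  pa_signs : forall j, [/\ 0 <= Pn j, 0 <= Qn j & 0 < Pn j + Qn j];
  pa_bnd : forall j, [/\ `|V j| <= C, `|Dplus h V j| <= C, `|rn j| <= C, Pn j <= C & Qn j <= C];
  pa_0 : forall j, J%:Z <= j \/ j < - J%:Z ->
    [/\ V j = 0, Dplus h V j = 0, rn j = 0, Pn j = 1 & Qn j = 0];
  pa_P1 : integral_le (fun x => `|stepf h Pn x - p x|) eps;
  pa_P2 : integral_le (fun x => (stepf h Pn x - p x) ^+ 2) eps;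
  pa_Q1 : integral_le (fun x => `|stepf h Qn x - (1 - p x)|) eps;
  pa_Q2 : integral_le (fun x => (stepf h Qn x - (1 - p x)) ^+ 2) eps;
  pa_q2 : integral_le (fun x => (stepf h (Dplus h V) x - q x) ^+ 2) eps;
  pa_r2 : integral_le (fun x => (stepf h rn x - r x) ^+ 2) eps;
  pa_U2 : integral_le (fun x => (linf h V x - U x) ^+ 2) eps }.

Lemma profile_approx_exists U p q r : profile U p q r -> forall eps, 0 < eps ->
  exists h C V rn Pn Qn J, profile_approx U p q r eps h C V rn Pn Qn J.
Proof.
move=> P eps eps0; have [K' UK'] := profile_bnd P.
pose K := Num.max 1 K'.
have K1 : 1 <= K by rewrite le_max lexx.
have UK x : `|U x| <= K by rewrite (le_trans (UK' x))// le_max lexx orbT.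
have K0 : 0 < K by exact: lt_le_trans ltr01 K1.
have mp := profile_mp P; have mq := profile_mq P; have mr := profile_mr P.
have mU : measurable_fun setT U.
  apply: continuous_measurable_fun; apply: lip_continuous (primitive_lip _ (profile_Uq P) (profile_q1 P)).
  exact: (locint_bounded mq (profile_q1 P)).
pose s x := 1 - p x - U x ^+ 2 * p x / 2; pose b x := (1 - p x + s x) / 2.
have cone x := profile_cone (profile_p01 P x) (profile_rel P x) (UK x).
have m1p : measurable_fun setT (fun x => 1 - p x) by exact: measurable_funB.
have ms : measurable_fun setT s.
  apply: measurable_funB => //; apply: measurable_funM => //; apply: measurable_funM => //.
  exact: measurable_funX.
have mb : measurable_fun setT b by apply: measurable_funM => //; exact: measurable_funD.
have b1p x : 0 <= b x <= 1 - p x by case: (cone x).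
have s01 x : 0 <= s x <= 1.
  have [/andP[h1 h2] _ _ _ _] := cone x; have /andP[h3 h4] := profile_p01 P x.
  by rewrite h1 (le_trans h2)// gerBl.
have b01 x : 0 <= b x <= 1.
  have /andP[h1 h2] := b1p x; have /andP[h3 h4] := profile_p01 P x.
  by rewrite h1 (le_trans h2)// gerBl.
have bi : (\int[leb]_x (b x)%:E < +oo)%E.
  apply: le_lt_trans (profile_H1 P); apply: ge0_le_integral => //.
  - by move=> x _; rewrite lee_fin; case/andP: (b01 x).
  - exact/measurable_EFinP.
  - exact/measurable_EFinP.
  - by move=> x _; rewrite lee_fin; case/andP: (b1p x).
have m2 (f : R -> R) : measurable_fun setT f -> measurable_fun setT (fun x => f x ^+ 2).
  by move=> mf; exact: measurable_funX.
have sq (f : R -> R) x : 0 <= f x ^+ 2 by exact: sqr_ge0.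
have [Aq Aq0 iAq] := integral_le_of_fin (m2 _ mq) (sq q) (profile_q2 P).
have [Ar Ar0 iAr] := integral_le_of_fin (m2 _ mr) (sq r) (profile_r2 P).
have [AU AU0 iAU] := integral_le_of_fin (m2 _ mU) (sq U) (profile_U2 P).
pose A := Aq + Ar + AU.
have [AqA ArA AUA A0] : [/\ Aq <= A, Ar <= A, AU <= A & 0 <= A].
  by move: Aq0 Ar0 AU0; rewrite /A; clear; split; lra.
pose c := (K ^+ 2 + 2)^-1.
have c01 : 0 < c <= 1.
  have h : 1 <= K ^+ 2 + 2 by have := sqr_ge0 K; clear; lra.
  by rewrite invr_gt0 (lt_le_trans ltr01 h)//= invf_le1// (lt_le_trans ltr01 h).
pose C1 := c ^- 2 + 1.
have C10 : 0 <= C1 by rewrite addr_ge0// invr_ge0 exprn_ge0//; case/andP: c01 => /ltW.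
(* Error t^2 <= t from b, and (2 + A) t from each of q^2 and r^2, multiplied by the Lipschitz
   constant C1. *)
pose C2 := C1 * (5 + 2 * A).
have C20 : 0 <= C2 by rewrite mulr_ge0// addr_ge0// mulr_ge0.
pose M := 6 * K + 1.
have M0 : 0 <= M by rewrite addr_ge0// mulr_ge0// ltW.
pose C3 := 2^-1 * (M * (2 + A)) + (2^-1 * (K ^+ 2 * C2) + C2).
have C30 : 0 <= C3.
  have MA : 0 <= M * (2 + A) by rewrite mulr_ge0// addr_ge0.
  have KC : 0 <= K ^+ 2 * C2 by rewrite mulr_ge0// sqr_ge0.
  by move: MA KC C20; rewrite /C3; clear; lra.
pose MQ := (3 * K) ^+ 2 * M / 2 + M + 1.
have K9M : 0 <= (3 * K) ^+ 2 * M by rewrite mulr_ge0// sqr_ge0.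
have MQ1 : 1 <= MQ by move: K9M M0; rewrite /MQ; clear; lra.
have MQ0 : 0 <= MQ by exact: le_trans ler01 MQ1.
pose C := C2 + C3 + 2 * M * C2 + 2 * MQ * C3 + 1.
have C0' : [/\ 0 <= 2 * M * C2 & 0 <= 2 * MQ * C3] by split; apply: mulr_ge0 => //; apply: mulr_ge0.
have [C4 C5] := C0'.
have [CC2 CC3 CC4 CC5 CC1] : [/\ C2 <= C, C3 <= C, 2 * M * C2 <= C, 2 * MQ * C3 <= C & 1 <= C].
  by move: C20 C30 C4 C5; rewrite /C; clear; split; lra.
have C0 : 0 < C by exact: lt_le_trans ltr01 CC1.
pose t := Num.min 1 (eps / C).
have t0 : 0 < t by rewrite lt_min ltr01 divr_gt0.
have t1 : t <= 1 by rewrite ge_min lexx.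
have tC (k : R) : k <= C -> k * t <= eps.
  move=> kC; apply: (@le_trans _ _ (C * t)); first by rewrite ler_wpM2r// ltW.
  by rewrite mulrC -ler_pdivlMr// ge_min lexx orbT.
have t2 : 0 < t ^+ 2 by rewrite exprn_gt0.
have tt : t ^+ 2 <= t by rewrite expr2 ler_piMr// ltW.
have tte : t ^+ 2 <= eps by rewrite (le_trans tt)// -[leLHS]mul1r tC.
(* Accuracy t^2 rather than t: comparing squares costs a factor 1 + 1/t, which leaves t^2 + t. *)
have [h [bn [V [rn [J G]]]]] := grid_approx_exists mb mq mr b01 (profile_q1 P) (profile_r1 P)
  (profile_Uq P) UK K1 bi (profile_q2 P) (profile_r2 P) (profile_U2 P) t2.
have h0 : 0 < h by case/andP: (ga_h G).
pose Pn j := coneP (bn j) (Dplus h V j) (rn j).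
pose Sn j := coneS (bn j) (Dplus h V j) (rn j).
(* Undoing s = H' - U^2 p / 2 with the grid values V: then 2 Pn Qn = V^2 Pn^2 + 2 Pn Sn, and the
   cone equation gives (c) exactly. *)
pose Qn j := V j ^+ 2 * Pn j / 2 + Sn j.
have signs j := cone_signs (bn j) (Dplus h V j) (rn j).
have P0 j : 0 <= Pn j by case: (signs j).
have S0 j : 0 <= Sn j by case: (signs j).
have VP0 j : 0 <= V j ^+ 2 * Pn j / 2 by rewrite divr_ge0// mulr_ge0// sqr_ge0.
have Q0 j : 0 <= Qn j by rewrite addr_ge0.
have PSM j : Pn j <= M /\ Sn j <= M.
  have := cone_bounds (ga_b G j) (ga_q G j) (ga_r G j).
  by rewrite (_ : 2 * (3 * K) + 1 = M) // /M; ring.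
have V2 j : V j ^+ 2 <= (3 * K) ^+ 2.
  by rewrite -[leLHS]real_normK ?num_real// lerXn2r ?nnegrE ?(ga_V G)// mulr_ge0// ltW.
have QM j : Qn j <= MQ.
  have [h1 h2] := PSM j; have : V j ^+ 2 * Pn j <= (3 * K) ^+ 2 * M by rewrite ler_pM ?sqr_ge0.
  by move: h2; rewrite /Qn /MQ; clear; lra.
have mst (v : int -> R) : measurable_fun setT (stepf h v) by exact: stepf_measurable.
have Iq : integral_le (fun x => `|stepf h (Dplus h V) x ^+ 2 - q x ^+ 2|) ((2 + A) * t).
  apply: integral_le_weaken (integral_le_sqr_diff t0 (mst _) mq (ga_eq G) iAq).
  have -> : (1 + t^-1) * t ^+ 2 = t ^+ 2 + t by field; rewrite gt_eqF.
  have : t * Aq <= t * A by rewrite ler_wpM2l// ltW.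
  by move: tt; clear; lra.
have Ir : integral_le (fun x => `|stepf h rn x ^+ 2 - r x ^+ 2|) ((2 + A) * t).
  apply: integral_le_weaken (integral_le_sqr_diff t0 (mst _) mr (ga_er G) iAr).
  have -> : (1 + t^-1) * t ^+ 2 = t ^+ 2 + t by field; rewrite gt_eqF.
  have : t * Ar <= t * A by rewrite ler_wpM2l// ltW.
  by move: tt; clear; lra.
have IV : integral_le (fun x => `|stepf h V x ^+ 2 - U x ^+ 2|) ((2 + A) * t).
  apply: integral_le_weaken (integral_le_sqr_diff t0 (mst _) mU (ga_eV G) iAU).
  have -> : (1 + t^-1) * t ^+ 2 = t ^+ 2 + t by field; rewrite gt_eqF.
  have : t * AU <= t * A by rewrite ler_wpM2l// ltW.
  by move: tt; clear; lra.
have IE : integral_le (fun x => C1 * (`|stepf h bn x - b x| +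
    (`|stepf h (Dplus h V) x ^+ 2 - q x ^+ 2| + `|stepf h rn x ^+ 2 - r x ^+ 2|))) (C2 * t).
  apply: integral_le_weaken (integral_leZ C10 (integral_leD (ga_eb G) (integral_leD Iq Ir))).
  rewrite /C2 -mulrA ler_wpM2l//.
  by move: tt; clear; lra.
have lip x : `|stepf h Pn x - p x| <= C1 * (`|stepf h bn x - b x| +
    (`|stepf h (Dplus h V) x ^+ 2 - q x ^+ 2| + `|stepf h rn x ^+ 2 - r x ^+ 2|)) /\
    `|stepf h Sn x - s x| <= C1 * (`|stepf h bn x - b x| +
    (`|stepf h (Dplus h V) x ^+ 2 - q x ^+ 2| + `|stepf h rn x ^+ 2 - r x ^+ 2|)).
  have [_ _ h1 h2 h3] := cone x.
  exact: (cone_lip _ _ c01 (ga_b G _) (b01 x) (profile_p01 P x) (s01 x) h1 h2 h3).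
have IP : integral_le (fun x => `|stepf h Pn x - p x|) (C2 * t).
  apply: integral_le_mono IE _ _ _ => //; last by move=> x; case: (lip x).
  by apply: measurableT_comp => //; exact: measurable_funB.
have IS : integral_le (fun x => `|stepf h Sn x - s x|) (C2 * t).
  apply: integral_le_mono IE _ _ _ => //; last by move=> x; case: (lip x).
  by apply: measurableT_comp => //; exact: measurable_funB.
have IQ : integral_le (fun x => `|stepf h Qn x - (1 - p x)|) (C3 * t).
  have half0 : 0 <= 2^-1 :> R by rewrite invr_ge0.
  have H := integral_leD (integral_leZ half0 (integral_leZ M0 IV))
    (integral_leD (integral_leZ half0 (integral_leZ (sqr_ge0 K) IP)) IS).
  have {}H := integral_le_weaken _ H.
  apply: (integral_le_mono (H (C3 * t) _)) => //.
  - by rewrite /C3 le_eqVlt; apply/orP; left; apply/eqP; ring.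
  - by apply: measurableT_comp => //; exact: measurable_funB.
  - move=> x; set j := cellno h x.
    (* Each difference is paired with a bounded factor: V^2 - U^2 with Pn <= M, and Pn - p with U^2
       <= K^2. This is the origin of C3. *)
    have -> : stepf h Qn x - (1 - p x) =
        2^-1 * ((V j ^+ 2 - U x ^+ 2) * Pn j) + (2^-1 * (U x ^+ 2 * (Pn j - p x)) + (Sn j - s x)).
      by rewrite /stepf -/j /Qn /s; field.
    apply: (le_trans (ler_normD _ _)); apply: lerD.
      rewrite normrM (ger0_norm half0) ler_wpM2l// normrM mulrC ler_wpM2r// ger0_norm//.
      by case: (PSM j).
    apply: (le_trans (ler_normD _ _)); apply: lerD => //.
    rewrite normrM (ger0_norm half0) ler_wpM2l// normrM ler_wpM2r// ger0_norm ?sqr_ge0//.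
    by rewrite -[leLHS]real_normK ?num_real// lerXn2r ?nnegrE ?UK// ltW.
have p01 x : 0 <= p x /\ p x <= 1 by case/andP: (profile_p01 P x).
have M1 : 1 <= M by rewrite /M lerDr mulr_ge0// ltW.
exists h, (MQ + M + 3 * K), V, rn, Pn, Qn, J; split.
- by have /andP[_ hh] := ga_h G; rewrite h0 (le_trans hh).
- move=> j; have := cone_eq (bn j) (Dplus h V j) (rn j); rewrite -/(Pn j) -/(Sn j) => E.
  have -> : 2 * Pn j * Qn j = V j ^+ 2 * Pn j ^+ 2 + 2 * Pn j * Sn j by rewrite /Qn; field.
  by rewrite E addrA.
- move=> j; split => //; case: (signs j) => _ _ PS.
  by move: PS (VP0 j); rewrite /Qn -/(Pn j) -/(Sn j); clear; lra.
- have K30 : 0 <= 3 * K by rewrite mulr_ge0// ltW.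
  move=> j; have [h1 _] := PSM j; split.
  + by apply: (le_trans (ga_V G j)); rewrite lerDr addr_ge0.
  + by apply: (le_trans (ga_q G j)); rewrite lerDr addr_ge0.
  + by apply: (le_trans (ga_r G j)); rewrite lerDr addr_ge0.
  + by apply: (le_trans h1); rewrite addrAC lerDr addr_ge0.
  + by apply: (le_trans (QM j)); rewrite -addrA lerDl addr_ge0.
- move=> j /(ga_0 G)[b0 V0 D0 r0]; have [cP cS] := @cone0 R.
  have PE : Pn j = 1 by rewrite /Pn b0 D0 r0.
  have SE : Sn j = 0 by rewrite /Sn b0 D0 r0.
  by split => //; rewrite /Qn V0 SE expr0n/= !mul0r addr0.
- exact: integral_le_weaken (tC _ CC2) IP.
(* Both functions are bounded by M, so the squared error is at most 2 M times the L^1 error. *)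
- apply: integral_le_weaken (tC _ CC4) _; rewrite -[_ * C2 * t]mulrA.
  apply: (integral_le_sqr_norm (mst _) mp M0 _ _ IP) => x.
    by rewrite /stepf ger0_norm//; case: (PSM (cellno h x)).
  by have [h1 h2] := p01 x; rewrite ger0_norm// (le_trans h2).
- exact: integral_le_weaken (tC _ CC3) IQ.
- apply: integral_le_weaken (tC _ CC5) _; rewrite -[_ * C3 * t]mulrA.
  apply: (integral_le_sqr_norm (mst _) m1p MQ0 _ _ IQ) => x.
    by rewrite /stepf ger0_norm.
  have [h1 h2] := p01 x; rewrite ger0_norm ?subr_ge0//.
  by apply: le_trans MQ1; rewrite gerBl.
- exact: integral_le_weaken tte (ga_eq G).
- exact: integral_le_weaken tte (ga_er G).
- exact: integral_le_weaken tte (ga_eU G).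
Qed.

End profile_approximation.

(** * Interpolation and convergence *)

Section interpolations.
Context {R : realType}.
Local Notation leb := (@lebesgue_measure R).
Implicit Types v : int -> R.

Lemma fsbig_grid_cell (h x : R) (F : int -> R) : 0 < h ->
  \sum_(j \in [set: int]) F j * \1_(grid_cell h j) x = F (cellno h x).
Proof.
move=> h0; have /andP[c1 c2] := cellnoP x h0.
rewrite -(fsbig_widen [set cellno h x])//.
  by rewrite fsbig_set1 indicE mem_set ?mulr1// /grid_cell/= in_itv/= c1 c2.
move=> j [_ /= jx]; rewrite indicE memNset ?mulr0// /grid_cell/= in_itv/= => /andP[d1 d2].
by apply: jx; rewrite (cellno_eq h0 d1 d2).
Qed.

Lemma interp_constE (h : R) v : 0 < h -> interp_const h v = stepf h v.
Proof. by move=> h0; apply/funext => x; exact: fsbig_grid_cell. Qed.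

Lemma interp_linearE (h : R) v : 0 < h -> interp_linear h v = linf h v.
Proof.
move=> h0; apply/funext => x.
exact: (fsbig_grid_cell x (fun j => v j + (x - gridpt h j) * Dplus h v j) h0).
Qed.

Lemma stepf_locint (h C : R) v : 0 < h -> (forall j, `|v j| <= C) -> locint (stepf h v).
Proof.
move=> h0 vC; apply: (@locint_bounded _ _ C); first exact: stepf_measurable.
by move=> x; exact: vC.
Qed.

(** The right end is included: [cellno] has already moved to the next cell there, and agreement of
    the two affine formulas is the continuity of the interpolant. *)
Lemma linf_cell (h x : R) v j : 0 < h -> gridpt h j <= x -> x <= gridpt h (j + 1) ->
  linf h v x = v j + (x - gridpt h j) * Dplus h v j.
Proof.
move=> h0 jx; rewrite le_eqVlt => /orP[/eqP xj|xj]; last by rewrite /linf (cellno_eq h0 jx xj).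
have xj2 : x < gridpt h (j + 1 + 1) by rewrite gridptS -xj ltrDl.
have jx2 : gridpt h (j + 1) <= x by rewrite xj.
rewrite /linf (cellno_eq h0 jx2 xj2) xj subrr mul0r addr0 gridptS /Dplus.
by field; rewrite gt_eqF.
Qed.

Lemma Rintegral_stepf_cell (h C a b : R) v j : 0 < h -> (forall j, `|v j| <= C) ->
  gridpt h j <= a -> a <= b -> b <= gridpt h (j + 1) ->
  \int[leb]_(x in `[a, b]) stepf h v x = v j * (b - a).
Proof.
move=> h0 vC ja ab bj; have [_ /(_ a b) iv] := stepf_locint h0 vC.
have ico : forall f : R -> R, leb.-integrable `[a, b] (EFin \o f) ->
    leb.-integrable `[a, b[ (EFin \o f).
  by move=> f; apply: integrableS => //; apply: subset_itvl; rewrite bnd_simp.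
rewrite -Rintegral_itv_bndo_bndc; last exact: ico.
have cC (x : R) : `|cst (v j) x| <= C by exact: vC.
have [_ /(_ a b) ic] := locint_bounded (measurable_cst (v j)) cC.
rewrite -(Rintegral_itvcc_cst (v j) ab) -[RHS]Rintegral_itv_bndo_bndc; last exact: ico.
apply: eq_Rintegral => x; rewrite inE/= in_itv/= => /andP[ax xb].
by rewrite /stepf (cellno_eq h0 (le_trans ja ax) (lt_le_trans xb bj)).
Qed.

Lemma primitive_linf (h C : R) v : 0 < h -> (forall j, `|Dplus h v j| <= C) ->
  primitive (linf h v) (stepf h (Dplus h v)).
Proof.
move=> h0 DC a b.
have cell x y j : gridpt h j <= x -> x <= y -> y <= gridpt h (j + 1) ->
    linf h v y - linf h v x = \int[leb]_(t in `[x, y]) stepf h (Dplus h v) t.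
  move=> jx xy yj; rewrite (Rintegral_stepf_cell h0 DC jx xy yj).
  rewrite (linf_cell v h0 jx (le_trans xy yj)) (linf_cell v h0 (le_trans jx xy) yj); ring.
have iD := stepf_locint h0 DC.
(* Induction on the number of cells between x and y; the step moves x to the right end of its
   cell. *)
suff H (n : nat) x y : x <= y -> y <= gridpt h (cellno h x + n%:Z + 1) ->
    linf h v y - linf h v x = \int[leb]_(t in `[x, y]) stepf h (Dplus h v) t.
  move=> ab; apply: (H `|cellno h b - cellno h a|%N) => //.
  rewrite gez0_abs; last by rewrite subr_ge0; apply: le_floor; rewrite ler_pM2r ?invr_gt0.
  by rewrite [cellno h a + _]addrC subrK; have /andP[_ /ltW] := cellnoP b h0.
elim: n x => [|n IH] x xy.
  by rewrite addr0 => yj; apply: cell yj => //; have /andP[] := cellnoP x h0.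
move=> yj; have /andP[x1 x2] := cellnoP x h0.
set c := gridpt h (cellno h x + 1) in x2.
have [yc|/ltW cy] := leP y c; first exact: cell x1 xy yc.
rewrite (Rintegral_itvcc_split iD (ltW x2) cy) -(cell _ _ _ x1 (ltW x2) (lexx _)).
rewrite -IH//; first by ring.
rewrite (@cellno_eq _ h c (cellno h x + 1))// ?/c ?lexx//.
  by move: yj; rewrite [_ + 1 + _]addrAC -[X in _ -> _ <= gridpt h (X + 1)]addrA Posz_addr1.
by rewrite [X in _ < X]gridptS ltrDl.
Qed.

End interpolations.

Section grid_data.
Context {R : realType}.
Implicit Types v : int -> R.

(** Discrete integration from index 0 in both directions; prescribing the value there lets the
    interpolant agree with the datum at label 0. *)
Lemma exists_Dplus (h c : R) (a : int -> R) : 0 < h ->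
  exists2 z, z 0 = c & forall j, Dplus h z j = a j.
Proof.
move=> h0; pose z (j : int) := match j with
  | Posz n => c + \sum_(k < n) h * a k%:Z
  | Negz n => c - \sum_(k < n.+1) h * a (Negz k) end.
exists z; first by rewrite /z/= big_ord0 addr0.
suff H j : z (j + 1) - z j = h * a j.
  by move=> j; rewrite /Dplus H mulrAC mulfV ?mul1r// gt_eqF.
case: j => [n|[|n]].
- by rewrite Posz_addr1 /z big_ord_recr/=; ring.
- by rewrite Negz0_addr1 /z/= big_ord0 big_ord_recr big_ord0/=; ring.
- by rewrite Negz_addr1 /z [in X in _ - X]big_ord_recr/=; ring.
Qed.

Lemma in_ellinf_bound v (C : R) : (forall j, `|v j| <= C) -> in_ellinf v.
Proof.
move=> vC; apply: (@le_lt_trans _ _ C%:E); last exact: ltry.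
by apply: ub_ereal_sup => _ [j _ <-]; rewrite lee_fin.
Qed.

Lemma in_ell2_supp (h C : R) v (J : nat) : 0 < h -> (forall j, `|v j| <= C) ->
  (forall j, J%:Z <= j \/ j < - J%:Z -> v j = 0) -> in_ell h 2 v.
Proof.
move=> h0 vC vJ; apply: poweR_lty.
(* A weight that is zero on the block allowed to carry v makes T = 0 admissible, and only the block
   term of the weighted bound survives. *)
pose a j : R := if (J%:Z <= j) || (j < - J%:Z) then h else 0.
have H : (\esum_(j in [set: int]) (`|v j| `^ 2)%:E <= (4 * (0 / h + C ^+ 2 * J%:R))%:E)%E.
  apply: (@esum_weighted_le R a (fun j => `|v j| `^ 2) (fun=> 0)) => //.
  - by move=> j; rewrite powR_mulrn// lerXn2r ?nnegrE// (le_trans _ (vC j)).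
  - by move=> j jJ; rewrite /a; case: ifPn => // /negP[]; apply/orP.
  - by move=> j; rewrite /a; case: ifP => // _; exact: ltW.
  - move=> j; rewrite /a subrr; case: ifPn => [/orP/vJ ->|_]; last by rewrite mul0r.
    by rewrite normr0 powR_mulrn// expr0n mulr0.
  - by move=> j; rewrite normr0.
apply: (@le_lt_trans _ _ (h%:E * (4 * (0 / h + C ^+ 2 * J%:R))%:E)%E).
  by rewrite lee_pmul2l// lte_fin.
by rewrite -EFinM ltry.
Qed.

Lemma in_h1_ell2 (h : R) v : in_ell h 2 v -> in_ell h 2 (Dplus h v) -> in_h1 h v.
Proof. by move=> v2 Dv2; apply: poweR_lty; apply: lte_add_pinfty; exact: poweR_lty. Qed.

Lemma grid_datum_in_B U p q r (eps h C C' : R) (z V w rn Pn Qn : int -> R) J :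
  profile_approx U p q r eps h C V rn Pn Qn J ->
  (forall j, `|z j| <= C') -> (forall j, `|w j| <= C') ->
  (forall j, Dplus h z j = Pn j - 1) -> (forall j, Dplus h w j = Qn j) ->
  exists g k gamma kappa, in_B h (Quadruple z V w rn) g k gamma kappa.
Proof.
move=> A zC wC Dz Dw; have /andP[h0 _] := pa_h A.
have h1 : h != 0 by rewrite gt_eqF.
have Dy j : Dplus h (grid_y h (Quadruple z V w rn)) j = Pn j.
  have -> : Pn j = 1 + Dplus h z j by rewrite Dz; ring.
  by rewrite /Dplus /grid_y/= gridptS; field.
have PQ j : `|Pn j| <= C /\ `|Qn j| <= C.
  have [P0 Q0 _] := pa_signs A j; have [_ _ _ PC QC] := pa_bnd A j.
  by rewrite !ger0_norm.
have [|j jJ|g [k [gamma [kappa K]]]] := @associated_kernels_exist R h (Quadruple z V w rn) J h0.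
- by move=> j; rewrite Dy; case: (pa_signs A j).
- by rewrite Dy; case: (pa_0 A jJ).
have VC j : `|V j| <= C by case: (pa_bnd A j).
have DVC j : `|Dplus h V j| <= C by case: (pa_bnd A j).
have rC j : `|rn j| <= C by case: (pa_bnd A j).
exists g, k, gamma, kappa; split => //=.
- split => /=.
  + split; first exact: in_ellinf_bound zC.
    apply: (@in_ell2_supp _ (C + 1) _ J) => // [j|j /(pa_0 A)[_ _ _ P1 _]].
      by rewrite Dz (le_trans (ler_normB _ _))// normr1 lerD2r; case: (PQ j).
    by rewrite Dz P1 subrr.
  + by apply: in_h1_ell2; apply: (@in_ell2_supp _ C _ J) => // j /(pa_0 A)[].
  + split; first exact: in_ellinf_bound wC.
    apply: (@in_ell2_supp _ C _ J) => // [j|j /(pa_0 A)[_ _ _ _ Q0]]; rewrite Dw//.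
    by case: (PQ j).
  + by apply: (@in_ell2_supp _ C _ J) => // j /(pa_0 A)[].
- split; apply: (@in_ellinf_bound _ C) => // j; rewrite ?Dy ?Dw.
  + by case: (PQ j).
  + by case: (PQ j).
- by move=> j; rewrite Dy Dw; exact: pa_rel A j.
- by move=> j; rewrite Dy Dw; exact: pa_signs A j.
Qed.

End grid_data.

Section norm_estimates.
Context {R : realType}.
Local Notation leb := (@lebesgue_measure R).
Implicit Types f g : R -> R.

Lemma L2norm_le f e : 0 <= e -> integral_le (fun x => f x ^+ 2) (e ^+ 2) ->
  (L2norm f <= e%:E)%E.
Proof.
move=> e0 [_ _ fe]; rewrite L2normE.
have i0 : (0 <= \int[leb]_x (f x ^+ 2)%:E)%E.
  by apply: integral_ge0 => x _; rewrite lee_fin sqr_ge0.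
have -> : e%:E = ((e ^+ 2)%:E `^ 2^-1)%E.
  by rewrite poweR_EFin powR12_sqrt ?sqr_ge0// sqrtr_sqr ger0_norm.
by apply: gt0_ler_poweR; rewrite ?invr_ge0// in_itv/= ?i0 ?leey// lee_fin sqr_ge0.
Qed.

Lemma integral_le_inL2 f A : measurable_fun setT f -> integral_le (fun x => f x ^+ 2) A -> inL2 f.
Proof.
by move=> mf [_ _ fA]; apply/inL2P; split => //; apply: le_lt_trans fA _; rewrite ltry.
Qed.

Lemma integral_le_sqr_subr f g A B : measurable_fun setT f ->
  integral_le (fun x => (f x - g x) ^+ 2) A -> integral_le (fun x => g x ^+ 2) B ->
  integral_le (fun x => f x ^+ 2) (2 * A + 2 * B).
Proof.
move=> mf fA gB.
have S (k : R -> R) : (fun x => (k x - cst 0 x) ^+ 2) = (fun x => k x ^+ 2).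
  by apply/funext => x; rewrite subr0.
by rewrite -(S f); apply: integral_le_sqr_add fA _; rewrite ?S.
Qed.

Lemma Linfnorm_le f e : (forall x, `|f x| <= e) -> (Linfnorm f <= e%:E)%E.
Proof.
move=> fe; rewrite /Linfnorm unlock; case: ifPn => [_|].
  by apply: ess_sup_ler => x; rewrite lee_fin.
by move=> _; rewrite lee_fin (le_trans _ (fe 0)).
Qed.

Lemma L2norm_ae f g : measurable_fun setT f -> measurable_fun setT g ->
  {ae leb, forall x, f x = g x} -> L2norm f = L2norm g.
Proof. by move=> mf mg fg; rewrite !L2normE (ae_eq_integral_sqr mf mg fg). Qed.

Lemma inL2_ae f g : measurable_fun setT f -> {ae leb, forall x, f x = g x} -> inL2 g -> inL2 f.
Proof.
by move=> mf fg /inL2P[mg ig]; apply/inL2P; split; rewrite // (ae_eq_integral_sqr mf mg fg).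
Qed.

(** The chosen weak derivative agrees with g almost everywhere, so its norm can be computed from the
    explicit slope. *)
Lemma wderiv_primitive f g C : measurable_fun setT g -> (forall x, `|g x| <= C) ->
  primitive f g ->
  [/\ continuous f, weakly_derivable f, inL2 g -> inL2 (wderiv f) &
      L2norm (wderiv f) = L2norm g].
Proof.
move=> mg gC fg; have fc : continuous f.
  exact: lip_continuous (primitive_lip (locint_bounded mg gC) fg gC).
have W := primitive_weak_derivative mg gC fg; have ae := wderiv_ae fc W.
have mw : measurable_fun setT (wderiv f).
  by have [_ /locally_integrable_locint[]] := wderivP W.
by split => //; [exists g | exact: inL2_ae | exact: L2norm_ae].
Qed.

Lemma primitive_inV f g C M : measurable_fun setT g -> (forall x, `|g x| <= C) ->
  primitive f g -> (forall x, `|f x| <= M) -> inL2 g -> inV f.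
Proof.
move=> mg gC fg fM g2; have [fc fw f2 _] := wderiv_primitive mg gC fg.
split => //; last exact: f2.
by exists M; split; [exact: num_real | move=> N MN x _; apply: le_trans (fM x) (ltW MN)].
Qed.

Lemma primitive_Vnorm_le f g C e : 0 <= e -> measurable_fun setT g -> (forall x, `|g x| <= C) ->
  primitive f g -> (forall x, `|f x| <= e) -> integral_le (fun x => g x ^+ 2) (e ^+ 2) ->
  (Vnorm f <= (2 * e)%:E)%E.
Proof.
move=> e0 mg gC fg fe g2; have [_ _ _ fE] := wderiv_primitive mg gC fg.
rewrite /Vnorm fE (_ : 2 * e = e + e) ?EFinD; last by ring.
by apply: leeD; [exact: Linfnorm_le | exact: L2norm_le].
Qed.

Lemma primitive_inH1 f g C : measurable_fun setT g -> (forall x, `|g x| <= C) ->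
  primitive f g -> inL2 f -> inL2 g -> inH1 f.
Proof.
by move=> mg gC fg f2 g2; have [_ fw fL _] := wderiv_primitive mg gC fg; split => //; exact: fL.
Qed.

Lemma primitive_H1norm_le f g C e : 0 <= e -> measurable_fun setT g -> (forall x, `|g x| <= C) ->
  primitive f g -> integral_le (fun x => f x ^+ 2) (e ^+ 2) ->
  integral_le (fun x => g x ^+ 2) (e ^+ 2) -> (H1norm f <= (2 * e)%:E)%E.
Proof.
move=> e0 mg gC fg f2 g2; have [_ _ _ fE] := wderiv_primitive mg gC fg.
have sq (a : \bar R) : (0 <= a)%E -> (a <= e%:E)%E -> (a `^ 2 <= (e ^+ 2)%:E)%E.
  move=> a0 ae; have -> : (e ^+ 2)%:E = (e%:E `^ 2)%E by rewrite poweR_EFin powR_mulrn.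
  by apply: gt0_ler_poweR; rewrite ?in_itv/= ?a0 ?leey ?lee_fin ?e0// ler0n.
have -> : (2 * e)%:E = (((2 * e) ^+ 2)%:E `^ 2^-1)%E.
  by rewrite poweR_EFin powR12_sqrt ?sqr_ge0// sqrtr_sqr ger0_norm// mulr_ge0.
rewrite /H1norm fE; apply: gt0_ler_poweR; rewrite ?invr_ge0//.
- by rewrite in_itv/= leey andbT; apply: adde_ge0; exact: poweR_ge0.
- by rewrite in_itv/= leey andbT lee_fin sqr_ge0.
- apply: (@le_trans _ _ ((e ^+ 2)%:E + (e ^+ 2)%:E)%E).
    by apply: leeD; apply: sq; rewrite ?Lnorm_ge0//; exact: L2norm_le.
  by rewrite -EFinD lee_fin; have := sqr_ge0 e; rewrite exprMn; clear; lra.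
Qed.

(** This turns the L^1 errors of the slopes into sup norm errors for zeta and H, which need not
    decay at infinity. *)
Lemma primitive_sup_le f g e : locint g -> primitive f g -> f 0 = 0 ->
  integral_le (fun x => `|g x|) e -> forall x, `|f x| <= e.
Proof.
move=> ig fg f0 [mn n0 ie].
have H a b : a <= b -> `|f b - f a| <= e.
  move=> ab; rewrite fg//; apply: (le_trans (le_normr_Rintegral _ (ig.2 a b))) => //.
  have ni : (\int[leb]_x (`|g x|)%:E < +oo)%E by apply: le_lt_trans ie _; rewrite ltry.
  apply: (le_trans (Rintegral_itvcc_leT a b mn n0 ni)).
  rewrite -lee_fin fineK// ge0_fin_numE//; apply: integral_ge0 => x _.
  by rewrite lee_fin.
move=> x; have [x0|/ltW x0] := leP 0 x; have := H _ _ x0; first by rewrite f0 subr0.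
by rewrite f0 sub0r normrN.
Qed.

Lemma primitiveB f g F G : locint f -> locint g -> primitive F f -> primitive G g ->
  primitive (fun x => F x - G x) (fun x => f x - g x).
Proof.
move=> [_ fi] [_ gi] Ff Gg a b ab; rewrite RintegralB ?Ff// -?Ff// -?Gg//; ring.
Qed.

End norm_estimates.

(** * Assembly of the grid datum and the estimate in E *)

Section lagrangian_approximation.
Context {R : realType}.
Local Notation leb := (@lebesgue_measure R).
Variables (X0 : quadruple R R) (p q r : R -> R) (M : R).
Hypotheses (P : profile (q_U X0) p q r)
  (zp : primitive (q_zeta X0) (fun x => p x - 1)) (Hp : primitive (q_H X0) (fun x => 1 - p x))
  (zM : forall x, `|q_zeta X0 x| <= M) (HM : forall x, `|q_H X0 x| <= M)
  (mr0 : measurable_fun setT (q_r X0)) (r0r : {ae leb, forall x, q_r X0 x = r x}).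

Let mp := profile_mp P.
Let mq := profile_mq P.
Let mr := profile_mr P.
Let q1 := profile_q1 P.

Let mp1 : measurable_fun setT (fun x => p x - 1). Proof. exact: measurable_funB. Qed.
Let m1p : measurable_fun setT (fun x => 1 - p x). Proof. exact: measurable_funB. Qed.

Let p1 x : `|p x - 1| <= 1.
Proof. by have /andP[h1 h2] := profile_p01 P x; rewrite ler_norml; apply/andP; split; lra. Qed.

Let p1' x : `|1 - p x| <= 1. Proof. by rewrite distrC. Qed.

(** 1 - p is integrable with values in [0, 1], so it dominates its own square. *)
Lemma slope_inL2 (g : R -> R) : measurable_fun setT g -> (forall x, `|g x| = 1 - p x) -> inL2 g.
Proof.
move=> mg gp; apply/inL2P; split => //; apply: le_lt_trans (profile_H1 P).
apply: ge0_le_integral => //.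
- by move=> x _; rewrite lee_fin sqr_ge0.
- exact: measurable_sqr_EFin.
- exact/measurable_EFinP.
- move=> x _; rewrite lee_fin -real_normK ?num_real// gp.
  by have /andP[] := profile_p01 P x; nra.
Qed.

Let p1E x : `|p x - 1| = 1 - p x.
Proof. by rewrite distrC ger0_norm// subr_ge0; case/andP: (profile_p01 P x). Qed.

Let p2 : inL2 (fun x => p x - 1). Proof. exact: slope_inL2 mp1 p1E. Qed.
Let p2' : inL2 (fun x => 1 - p x). Proof. by apply: slope_inL2 => // x; rewrite distrC. Qed.

Let mU : measurable_fun setT (q_U X0).
Proof.
apply: continuous_measurable_fun.
exact: lip_continuous (primitive_lip (locint_bounded mq q1) (profile_Uq P) q1).
Qed.

Let q2 : inL2 q. Proof. by apply/inL2P; split => //; exact: profile_q2 P. Qed.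
Let r2 : inL2 r. Proof. by apply/inL2P; split => //; exact: profile_r2 P. Qed.
Let U2 : inL2 (q_U X0). Proof. by apply/inL2P; split => //; exact: profile_U2 P. Qed.

Lemma profile_inE : Defs.inE X0.
Proof.
split.
- exact: (primitive_inV mp1 p1 zp zM p2).
- exact: (primitive_inH1 mq q1 (profile_Uq P) U2 q2).
- exact: (primitive_inV m1p p1' Hp HM p2').
- exact: (inL2_ae mr0 r0r r2).
Qed.

Let inL2_near (f g : R -> R) A : measurable_fun setT f ->
  integral_le (fun x => (f x - g x) ^+ 2) A -> inL2 g -> inL2 f.
Proof.
move=> mf fA /inL2P[mg ig].
have [B _ gB] := integral_le_of_fin (measurable_funX 2 mg) (fun x => sqr_ge0 (g x)) ig.
exact: integral_le_inL2 mf (integral_le_sqr_subr mf fA gB).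
Qed.

Lemma scheme_datum_exists e : 0 < e ->
  exists (h : R) (X : quadruple int R),
    [/\ 0 < h <= e, exists g k gamma kappa, in_B h X g k gamma kappa,
        Defs.inE (interpolation h X) &
        (Enorm (quad_sub (interpolation h X) X0) <= (7 * e)%:E)%E].
Proof.
move=> e0; pose eps := Num.min e (e ^+ 2).
have eps0 : 0 < eps by rewrite lt_min e0 exprn_gt0.
have epse : eps <= e by rewrite ge_min lexx.
have epse2 : eps <= e ^+ 2 by rewrite ge_min lexx orbT.
have [h [C [V [rn [Pn [Qn [J A]]]]]]] := profile_approx_exists P eps0.
have /andP[h0 he] := pa_h A.
have [z z0 Dz] := exists_Dplus (q_zeta X0 0) (fun j => Pn j - 1) h0.
have [w w0 Dw] := exists_Dplus (q_H X0 0) Qn h0.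
have PQC j : `|Pn j| <= C /\ `|Qn j| <= C.
  have [P0 Q0 _] := pa_signs A j; have [_ _ _ PC QC] := pa_bnd A j.
  by rewrite !ger0_norm.
have DzC j : `|Dplus h z j| <= C + 1.
  by rewrite Dz (le_trans (ler_normB _ _))// normr1 lerD2r; case: (PQC j).
have DwC j : `|Dplus h w j| <= C by rewrite Dw; case: (PQC j).
have VC j : `|V j| <= C by case: (pa_bnd A j).
have DVC j : `|Dplus h V j| <= C by case: (pa_bnd A j).
have rC j : `|rn j| <= C by case: (pa_bnd A j).
have lz := primitive_linf h0 DzC; have lw := primitive_linf h0 DwC.
have lV := primitive_linf h0 DVC.
have iz := stepf_locint h0 DzC; have iw := stepf_locint h0 DwC.
have iV := stepf_locint h0 DVC.
have ip := locint_bounded mp1 p1; have ip' := locint_bounded m1p p1'.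
have iq := locint_bounded mq q1.
have dz := primitiveB iz ip lz zp; have dw := primitiveB iw ip' lw Hp.
have dV := primitiveB iV iq lV (profile_Uq P).
have zE : (fun x => stepf h (Dplus h z) x - (p x - 1)) = (fun x => stepf h Pn x - p x).
  by apply/funext => x; rewrite /stepf Dz; ring.
have wE : (fun x => stepf h (Dplus h w) x - (1 - p x)) = (fun x => stepf h Qn x - (1 - p x)).
  by apply/funext => x; rewrite /stepf Dw.
rewrite zE in dz; rewrite wE in dw.
have mst v : measurable_fun setT (stepf h v) by exact: stepf_measurable.
have mln v : measurable_fun setT (linf h v) by exact: linf_measurable.
have mz : measurable_fun setT (fun x => stepf h Pn x - p x) by exact: measurable_funB.
have mw : measurable_fun setT (fun x => stepf h Qn x - (1 - p x)) by exact: measurable_funB.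
have mV : measurable_fun setT (fun x => stepf h (Dplus h V) x - q x) by exact: measurable_funB.
have zC x : `|stepf h Pn x - p x| <= C + 1 + 1.
  have := congr1 (@^~ x) zE; move=> /= <-.
  by apply: (le_trans (ler_normB _ _)); apply: lerD => //; exact: DzC.
have wC x : `|stepf h Qn x - (1 - p x)| <= C + 1.
  by apply: (le_trans (ler_normB _ _)); apply: lerD => //; case: (PQC (cellno h x)).
have VqC x : `|stepf h (Dplus h V) x - q x| <= C + 1.
  by apply: (le_trans (ler_normB _ _)); apply: lerD => //; exact: DVC.
have lin0 v : linf h v 0 = v 0.
  rewrite (@linf_cell _ h 0 v 0 h0); last 2 first.
  - by rewrite /gridpt mul0r.
  - by rewrite gridptS /gridpt mul0r add0r ltW.
  by rewrite /gridpt mul0r subrr mul0r addr0.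
have supz : forall x, `|linf h z x - q_zeta X0 x| <= e.
  apply: (primitive_sup_le (locint_bounded mz zC) dz); first by rewrite lin0 z0 subrr.
  exact: integral_le_weaken epse (pa_P1 A).
have supw : forall x, `|linf h w x - q_H X0 x| <= e.
  apply: (primitive_sup_le (locint_bounded mw wC) dw); first by rewrite lin0 w0 subrr.
  exact: integral_le_weaken epse (pa_Q1 A).
have bnd (f g : R -> R) : (forall x, `|f x - g x| <= e) -> (forall x, `|g x| <= M) ->
    forall x, `|f x| <= e + M.
  by move=> fg gM x; rewrite -[f x](subrK (g x)) (le_trans (ler_normD _ _))// lerD.
have bz := bnd _ _ supz zM; have bw := bnd _ _ supw HM.
(* Grid values are values of the interpolant, so its closeness to the bounded datum bounds the
   sequences z and w. *)
have grid v : (forall x, `|linf h v x| <= e + M) -> forall j, `|v j| <= e + M.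
  move=> vM j; suff <- : linf h v (gridpt h j) = v j by exact: vM.
  rewrite (@linf_cell _ h _ v j h0) ?lexx// ?subrr ?mul0r ?addr0//.
  by rewrite gridptS lerDl ltW.
have z2 := pa_P2 A; have w2 := pa_Q2 A.
have z2' : integral_le (fun x => (stepf h (Dplus h z) x - (p x - 1)) ^+ 2) eps.
  rewrite (_ : (fun x => _) = (fun x => (stepf h Pn x - p x) ^+ 2))//.
  by apply/funext => x; congr (_ ^+ 2); exact: (congr1 (@^~ x) zE).
have w2' : integral_le (fun x => (stepf h (Dplus h w) x - (1 - p x)) ^+ 2) eps.
  rewrite (_ : (fun x => _) = (fun x => (stepf h Qn x - (1 - p x)) ^+ 2))//.
  by apply/funext => x; congr (_ ^+ 2); exact: (congr1 (@^~ x) wE).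
exists h, (Quadruple z V w rn); split.
- by rewrite h0 (le_trans he).
- exact: (grid_datum_in_B A (grid _ bz) (grid _ bw) Dz Dw).
- split => /=; rewrite ?interp_constE ?interp_linearE//.
  + apply: (primitive_inV (mst _) _ lz bz); first by move=> x; exact: DzC.
    exact: (inL2_near (mst _) z2' p2).
  + apply: (primitive_inH1 (mst _) _ lV); first by move=> x; exact: DVC.
      exact: (inL2_near (mln _) (pa_U2 A) U2).
    exact: (inL2_near (mst _) (pa_q2 A) q2).
  + apply: (primitive_inV (mst _) _ lw bw); first by move=> x; exact: DwC.
    exact: (inL2_near (mst _) w2' p2').
  + exact: (inL2_near (mst _) (pa_r2 A) r2).
- rewrite /Enorm/= !interp_linearE// interp_constE//.
  (* At most 2 e for each of zeta, U and H, function and derivative together, and e for rbar. *)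
  have -> : 7 * e = 2 * e + 2 * e + 2 * e + e by ring.
  have e0' := ltW e0; have W := integral_le_weaken epse2.
  rewrite !EFinD; apply: leeD; [apply: leeD; [apply: leeD|]|].
  + exact: (primitive_Vnorm_le e0' mz zC dz supz (W _ z2)).
  + exact: (primitive_H1norm_le e0' mV VqC dV (W _ (pa_U2 A)) (W _ (pa_q2 A))).
  + exact: (primitive_Vnorm_le e0' mw wC dw supw (W _ w2)).
  + have m1 : measurable_fun setT (fun x => stepf h rn x - q_r X0 x).
      by apply: measurable_funB => //; exact: (mst rn).
    have m2 : measurable_fun setT (fun x => stepf h rn x - r x).
      by apply: measurable_funB => //; exact: (mst rn).
    rewrite (L2norm_ae m1 m2); first exact: (L2norm_le e0' (W _ (pa_r2 A))).
    by apply: leb_ae_mono r0r => x ->.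
Qed.

End lagrangian_approximation.

Unset Implicit Arguments.

Theorem theorem7p1 (R : realType) (u0 rho0 : R -> R) (rho_inf : R)
    (mu0 : {finite_measure set (measurableTypeR R) -> \bar R})
    (mus : {measure set (measurableTypeR R) -> \bar R}) :
  let rho_bar0 := fun x : R => rho0 x - rho_inf in
  inH1 u0 -> continuous u0 ->
  0 <= rho_inf -> inL2 rho_bar0 ->
  lebesgue_decomposition mu0 (energy_density u0 rho_bar0) mus ->
  atomic mus ->
  exists (dxi : nat -> R) (X : nat -> quadruple int R),
    [/\ forall n, 0 < dxi n,
        dxi n @[n --> \oo] --> 0,
        forall n, in_Egrid (dxi n) (X n),
        forall n, exists g k gamma kappa : int -> int -> R,
          in_B (dxi n) (X n) g k gamma kappa &
        cvg_in_E (fun n => interpolation (dxi n) (X n))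
                 (lagrangian_datum u0 rho_bar0 mu0)].
Proof.
move=> rho_bar0 uH uc _ rho2 dec _.
have [p [q [r [P zp Hp [M zHM] [mr r0]]]]] := lagrangian_datum_profile uH uc rho2 dec.
set X0 := lagrangian_datum _ _ _ in P zp Hp zHM mr r0 *.
have zM xi : `|q_zeta X0 xi| <= M by case: (zHM xi).
have HM xi : `|q_H X0 xi| <= M by case: (zHM xi).
have e0 n : 0 < n.+1%:R^-1 :> R by rewrite invr_gt0.
have /choice[hX hXP] n : exists hX : R * quadruple int R,
    [/\ 0 < hX.1 <= n.+1%:R^-1, exists g k gamma kappa, in_B hX.1 hX.2 g k gamma kappa,
        Defs.inE (interpolation hX.1 hX.2) &
        (Enorm (quad_sub (interpolation hX.1 hX.2) X0) <= (7 * n.+1%:R^-1)%:E)%E].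
  by have [h [X H]] := scheme_datum_exists P zp Hp zM HM mr r0 (e0 n); exists (h, X).
have e_cvg : (n.+1%:R^-1 : R) @[n --> \oo] --> 0.
  exact: cvg_harmonic.
exists (fun n => (hX n).1), (fun n => (hX n).2); split.
- by move=> n; case: (hXP n) => /andP[].
- apply: (squeeze_cvgr _ (cvg_cst 0) e_cvg); near=> n.
  by case: (hXP n) => /andP[/ltW -> ->].
- by move=> n; case: (hXP n) => _ [g [k [gamma [kappa []]]]].
- by move=> n; case: (hXP n).
split.
- by move=> n; case: (hXP n).
- exact: profile_inE P zp Hp zM HM mr r0.
- apply: (@squeeze_cvge _ _ _ _ (cst 0%E) _ (fun n => (7 * n.+1%:R^-1)%:E)).
  + near=> n; case: (hXP n) => _ _ _ ->; rewrite andbT.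
    have L2 (f : R -> R) : (0 <= L2norm f)%E by exact: Lnorm_ge0.
    have Li (f : R -> R) : (0 <= Linfnorm f)%E by exact: Lnorm_ge0.
    rewrite /Enorm; apply: adde_ge0 => //; apply: adde_ge0; last exact: adde_ge0.
    by apply: adde_ge0; [exact: adde_ge0 | exact: poweR_ge0].
  + exact: cvg_cst.
  + apply: cvg_EFin; first by near=> n.
    by rewrite -[X in _ --> X](mulr0 7); apply: cvgMr; exact: e_cvg.
Unshelve. all: by end_near. Qed.
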